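(* For $\alpha=x_-+ip_+\in\mathbb C$ ($x_-,p_+\in\mathbb R$) consider the generalized vector $$B_\alpha=\pi^{-1/2}\sum_{n=0}^\infty (D(\alpha)|n\rangle_0)\otimes|n\rangle_1,\qquad\text{i.e.}\qquad B_\alpha(\bar v_0,\bar v_1)=\pi^{-1/2}e^{-|\alpha|^2/2}\,e^{\bar v_0\bar v_1}\,e^{-\bar\alpha\bar v_1}\,e^{\alpha\bar v_0}.$$ Then $\{B_\alpha:\alpha\in\mathbb C\}$ is a generalized Bell basis, i.e., a complete orthonormal system (of generalized vectors) in the Hilbert space of the holomorphic representation with two degrees of freedom: (i) Completeness: the identity operator satisfies $$I=\pi^{-1}\int dx_-\,dp_+\ \Big(\sum_{m=0}^\infty (D(\alpha)|m\rangle_0)\otimes|m\rangle_1\Big)\Big(\sum_{k=0}^\infty {}_0\langle k|D(\alpha)^\dagger\otimes{}_1\langle k|\Big),\qquad \alpha=x_-+ip_+,$$ which in terms of integral kernels is $$\pi^{-1}\int e^{-\bar\alpha\alpha}\,e^{\bar u_0\bar u_1}e^{-\bar\alpha\bar u_1}e^{\alpha\bar u_0}\,e^{v_0v_1}e^{-\alpha v_1}e^{\bar\alpha v_0}\,dx_-\,dp_+=e^{\bar u_0v_0}e^{\bar u_1v_1},$$ the right-hand side being the kernel of the identity operator. (ii) Orthonormality (in the delta-function sense): for $\alpha=x_-+ip_+$ and $\alpha'=x_-'+ip_+'$, $$\pi^{-1}\Big(\sum_{m=0}^\infty{}_0\langle m|D(\alpha')^\dagger\otimes{}_1\langle m|\Big)\Big(\sum_{n=0}^\infty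 (D(\alpha)|n\rangle_0)\otimes|n\rangle_1\Big)=\delta(x_-'-x_-)\,\delta(p_+'-p_+).$$
   Context: Holomorphic (Bargmann) representation with $n$ degrees of freedom: the Hilbert space $\mathcal H$ is the subspace of $L^2(\mathbb C^n,d\mu_n)$ generated by the functions $f(\bar u)$ holomorphic in $\bar u=(\bar u_1,\dots,\bar u_n)$, where $d\mu_n=\prod_{j}e^{-\bar u_ju_j}\frac{d\bar u_jdu_j}{2\pi i}$ and $\frac{d\bar u\,du}{2\pi i}$ denotes $\frac{1}{\pi}\,dx\,dy$ for $u=x+iy$. The inner product is $\langle f|g\rangle=\int\overline{f(\bar u)}g(\bar u)\,d\mu_n$. An operator $T$ has integral kernel $T(\bar u,v)$ if $(Tg)(\bar u)=\int T(\bar u,v)g(\bar v)\prod_je^{-\bar v_jv_j}\frac{d\bar v_jdv_j}{2\pi i}$. Here there are two degrees of freedom, with variables labelled by indices $0,1$, and the Hilbert space is the tensor product of two one-degree-of-freedom spaces. In one degree of freedom, $|n\rangle=\bar u^n/\sqrt{n!}$, $n=0,1,2,\dots$, is the standard orthonormal basis; subscripts on kets and bras indicate the variable. The displacement operator is the unitary operator $(D(\alpha)f)(\bar u)=e^{-|\alpha|^2/2}e^{\alpha\bar u}f(\bar u-\bar\alpha)$. Generalized vectors are elements of the dual $\Phi'$ in a rigged Hilbert space $\Phi\subset\mathcal H\subset\Phi'$, where (for one degree of freedom) $\Phi$ is the countably normed space of vectors $\phi=\sum_n c_n|n\rangle$ with $\sum_n(1+n^2)^r|c_n|^2<\infty$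 for every $r\in\mathbb N$; for two degrees of freedom the corresponding space is used. For instance $\sum_n|n\rangle_0\otimes|n\rangle_1=e^{\bar v_0\bar v_1}$ has infinite norm and is a generalized vector. Products of generalized vectors, as in (ii), are understood formally in the Dirac sense. *)

(* Defs.v *)
From HB Require Import structures.
From mathcomp Require Import all_boot all_order all_algebra.
From mathcomp Require Import all_classical all_reals all_analysis.
From mathcomp Require Import complex.

Set Implicit Arguments.
Unset Strict Implicit.
Unset Printing Implicit Defensive.

Import Order.TTheory GRing.Theory Num.Theory numFieldNormedType.Exports.

Local Open Scope classical_set_scope.
Local Open Scope ring_scope.

(* Wave functions with one (resp. two) degrees of freedom have type
   R[i] -> R[i] (resp. R[i] -> R[i] -> R[i]); their arguments are the values
   of the variables \bar u (resp. \bar u_0, \bar u_1). *)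

Section Complex.
Context (R : realType).
Local Notation C := R[i].

Definition ofR (x : R) : C := Complex x 0.

Definition cexp (z : C) : C :=
  Complex (expR (complex.Re z) * cos (complex.Im z))
          (expR (complex.Re z) * sin (complex.Im z)).

Definition sqnorm (z : C) : R := complex.Re z ^+ 2 + complex.Im z ^+ 2.

Definition toC (z : R * R) : C := Complex z.1 z.2.

Section Integral.
Context (d : measure_display) (T : measurableType d).
Context (mu : {measure set T -> \bar R}).

Definition cintegrable (f : T -> C) : Prop :=
  mu.-integrable setT (EFin \o (fun t => complex.Re (f t))) /\
  mu.-integrable setT (EFin \o (fun t => complex.Im (f t))).

Definition cintegral (f : T -> C) : C :=
  Complex (\int[mu]_t complex.Re (f t)) (\int[mu]_t complex.Im (f t)).

(* [cintegral] takes a junk value on non-integrable functions. *)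
Definition is_cintegral (f : T -> C) (v : C) : Prop :=
  cintegrable f /\ cintegral f = v.

End Integral.

(* The library's sigma-finite structure on product measures is shadowed by its
   structure for products of subprobabilities, hence the instance below. *)
Definition leb1 := (@lebesgue_measure R \x @lebesgue_measure R)%E.

HB.instance Definition _ := Measure.on leb1.

Lemma leb1_sigma_finite : sigma_finite setT leb1.
Proof.
have /sigma_finiteP[F [TF ndF Foo]] := sigma_finiteT (@lebesgue_measure R).
exists (fun n => F n `*` F n).
  rewrite -setXTT TF predeqE => -[x y]; split.
    move=> [/= [n _ Fnx] [k _ Gky]]; exists (maxn n k) => //; split.
    - by move: x Fnx; exact/subsetPset/ndF/leq_maxl.
    - by move: y Gky; exact/subsetPset/ndF/leq_maxr.
  by move=> [n _ []/= ? ?]; split; exists n.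
move=> k; have [mF Fk] := Foo k; split; first exact: measurableX.
by rewrite /leb1 product_measure1E// lte_mul_pinfty// ge0_fin_numE.
Qed.

HB.instance Definition _ :=
  Measure_isSigmaFinite.Build _ _ _ leb1 leb1_sigma_finite.

Definition leb2 := (leb1 \x leb1)%E.

HB.instance Definition _ := Measure.on leb2.

(* Density of \prod_j e^{- \bar u_j u_j} d\bar u_j du_j / (2 pi i) with respect
   to Lebesgue measure, where d\bar u du / (2 pi i) is dx dy / pi. *)
Definition gauss (u0 u1 : C) : R :=
  (pi^-1 * expR (- sqnorm u0)) * (pi^-1 * expR (- sqnorm u1)).

Definition mu_integrand (F : C -> C -> C) (u : (R * R) * (R * R)) : C :=
  F (toC u.1) (toC u.2) * ofR (gauss (toC u.1) (toC u.2)).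

Definition mu_integrable (F : C -> C -> C) : Prop :=
  cintegrable leb2 (mu_integrand F).

Definition mu_integral (F : C -> C -> C) : C :=
  cintegral leb2 (mu_integrand F).

Definition mu_is_integral (F : C -> C -> C) (v : C) : Prop :=
  mu_integrable F /\ mu_integral F = v.

Definition braket_integrand (f g : C -> C -> C) : C -> C -> C :=
  fun u0 u1 => (f u0^* u1^*)^* * g u0^* u1^*.

(* <f|g>.  The same integral gives the pairing <f|B> of a vector f of Phi with
   a generalized vector B that is represented by a function. *)
Definition braket (f g : C -> C -> C) : C := mu_integral (braket_integrand f g).

(* Holomorphy as Frechet differentiability over the field C = R[i]. *)
Definition entire2 (f : C -> C -> C) : Prop :=
  forall z : C^o * C^o,
    differentiable ((fun w => f w.1 w.2) : C^o * C^o -> C^o) z.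

Definition Hspace (f : C -> C -> C) : Prop :=
  entire2 f /\ mu_integrable (fun u0 u1 => ofR (sqnorm (f u0^* u1^*))).

Definition ket (n : nat) : C -> C :=
  fun w => w ^+ n / ofR (Num.sqrt n`!%:R).

Definition tensor (f g : C -> C) : C -> C -> C := fun w0 w1 => f w0 * g w1.

Definition displacement (alpha : C) (f : C -> C) : C -> C :=
  fun w => ofR (expR (- sqnorm alpha / 2)) * cexp (alpha * w)
           * f (w - alpha^*).

Definition has_kernel (T : (C -> C -> C) -> (C -> C -> C))
    (K : C -> C -> C -> C -> C) : Prop :=
  forall g, Hspace g -> forall u0 u1 : C,
    mu_is_integral (fun v0 v1 => K u0^* u1^* v0 v1 * g v0^* v1^*)
                   (T g u0^* u1^*).

(* Squared norms defining Phi.  The weights (1 + m^2)^r (1 + n^2)^r are the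
   products of the one-mode weights; they give the same space and topology as
   (1 + m^2 + n^2)^r.  The coefficients c_{mn} of f are the <mn|f>. *)
Definition Phi_norm2 (r : nat) (f : C -> C -> C) : \bar R :=
  (\sum_(0 <= m <oo) \sum_(0 <= n <oo)
    (((1 + m%:R ^+ 2) * (1 + n%:R ^+ 2)) ^+ r
      * sqnorm (braket (tensor (ket m) (ket n)) f))%:E)%E.

Definition Phi (f : C -> C -> C) : Prop :=
  Hspace f /\ forall r : nat, (Phi_norm2 r f < +oo)%E.

(* Elements of Phi', as antilinear functionals phi |-> <phi|B>; continuity is
   for the topology defined by the (increasing) sequence of norms of Phi. *)
Definition antidual (L : (C -> C -> C) -> C) : Prop :=
  (forall (a : C) (f g : C -> C -> C), Phi f -> Phi g ->
     L (fun w0 w1 => a * f w0 w1 + g w0 w1) = a^* * L f + L g) /\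
  (forall f, Phi f -> forall e : R, 0 < e ->
     exists (r : nat) (delta : R), 0 < delta /\
       forall g, Phi g ->
         (Phi_norm2 r (fun w0 w1 => g w0 w1 - f w0 w1)%R
            < (delta ^+ 2)%:E)%E ->
         sqnorm (L g - L f) < e ^+ 2).

Definition generalized_vector (B : C -> C -> C) : Prop :=
  (forall f, Phi f -> mu_integrable (braket_integrand f B)) /\
  antidual (fun f => braket f B).

Definition bell_sum (N : nat) (alpha : C) : C -> C -> C :=
  fun w0 w1 =>
    \sum_(n < N) tensor (displacement alpha (ket n)) (ket n) w0 w1.

Definition bell (alpha : C) : C -> C -> C :=
  fun w0 w1 =>
    ofR (Num.sqrt pi)^-1 * ofR (expR (- sqnorm alpha / 2))
    * cexp (w0 * w1) * cexp (- alpha^* * w1) * cexp (alpha * w0).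

Fixpoint Ck (k : nat) (f : R -> R -> R) : Prop :=
  continuous (fun z : R * R => f z.1 z.2) /\
  if k is k'.+1 then
    [/\ forall x p, derivable (fun s => f s p) x 1,
        forall x p, derivable (fun s => f x s) p 1,
        Ck k' (fun x p => derive1 (fun s => f s p) x) &
        Ck k' (fun x p => derive1 (fun s => f x s) p)]
  else True.

(* C_c^oo on the plane of alpha = x + i p. *)
Definition test_function (g : C -> C) : Prop :=
  [/\ forall k, Ck k (fun x p => complex.Re (g (Complex x p))),
      forall k, Ck k (fun x p => complex.Im (g (Complex x p))) &
      exists r : R, forall a : C, r < sqnorm a -> g a = 0].

End Complex.

(* Main.v *)
(* For [u] in C^2 the modulus of [bell a] at the conjugate of [u], times
   [exp (- |u|^2 / 2)], is [pi^{-1/2} exp (- |u_0 - u_1^* - a|^2 / 2)].  It is bounded,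
   and the coefficients of a vector [f] of [Phi] decay fast enough for
   [|f| exp (- |u|^2 / 2)] to be integrable, so all pairings converge absolutely.

   Completeness: by Fubini, the integral of [<f|B_a> <B_a|g>] over [a] is [<f|h>], where [h]
   is the integral of [B_a <B_a|g>].  The Gaussian integral of the kernel
   [B_a B_a^*] is [exp (u_0^* v_0) exp (u_1^* v_1)], which reproduces holomorphic functions
   (mean value property, after averaging over rotations), so that [h = g].

   Orthonormality: [phi] is the integral of [g(a) B_a].  Since [w_0 - w_1] and [i (w_0 + w_1)]
   act on [B_a] as [d/dx + x] and [d/dp + p], integration by parts shows that
   [phi exp (- |u|^2 / 2)] decays rapidly, hence [phi] is in [Phi].  To compute [<B_b|phi>],
   replace [exp ((w_0 - b^* ) w_1)] in [B_b] by [exp (t (w_0 - b^* ) w_1)] with [t < 1]: the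
   overlap with [B_a] becomes a Gaussian in [a - b], up to a phase, which is an approximate
   identity as [t] tends to [1].  Finally, the overlap of the partial sums of length [M] and
   [N] is that of the partial sum of length [min M N] with the whole series. *)
Require Import Defs.
From HB Require Import structures.
From mathcomp Require Import all_boot all_order all_algebra.
From mathcomp Require Import all_classical all_reals all_analysis.
From mathcomp Require Import complex.
From mathcomp Require Import measurable_realfun.
From mathcomp Require Import ring lra.
Import Order.TTheory GRing.Theory Num.Theory numFieldNormedType.Exports.
Local Open Scope classical_set_scope.
Local Open Scope ring_scope.

Set Implicit Arguments.
Unset Strict Implicit.
Unset Printing Implicit Defensive.

(** * Modulus and exponential on [R[i]] *)

Section Modulus.
Context (R : realType).
Local Notation C := R[i].
Implicit Types (x y : R) (z w : C).

(** The Bell vectors, their partial sums and their regularizations are all of the form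
    [bell_series E a] with [E] entire and |E(z)| <= exp |z|. This bound alone keeps the modulus
    times [damp2] (up to a constant, the square root of the weight [gauss]) below 1, whatever [E]
    and [a] are. Hence the pairing with a [tempered] vector, one whose damped modulus is integrable,
    converges absolutely, and one majorant serves for every passage to the limit.

    The obstacle is that two Bell vectors cannot be paired: the modulus of the integrand depends on
    u_0 - u_1^* alone and does not decay along the planes where this is constant. One factor must
    obey the stronger bound K exp (k |z|) with [k < 1], which makes it tempered. The regularized
    exponential does so with [k = t]; the partial sums, being polynomials in z, do so with
    [k = 1/2]. This is why every overlap is computed with a regularized or truncated left factor,
    the limit being taken only after smearing the right factor.

    Complex integrals and increments are estimated through real and imaginary parts, which costs
    factors 2 that affect no limit. *)

Definition cmod z : R := Num.sqrt (sqnorm z).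

Lemma sqnorm_ge0 z : 0 <= sqnorm z.
Proof. by rewrite /sqnorm addr_ge0 ?sqr_ge0. Qed.

Lemma cmodE z : cmod z = Normc.normc z. Proof. by case: z. Qed.

Lemma cmod_ge0 z : 0 <= cmod z. Proof. exact: sqrtr_ge0. Qed.

Lemma cmod2 z : cmod z ^+ 2 = sqnorm z.
Proof. by rewrite /cmod sqr_sqrtr ?sqnorm_ge0. Qed.

Lemma cmodM z w : cmod (z * w) = cmod z * cmod w.
Proof. by rewrite !cmodE Normc.normcM. Qed.

Lemma cmodD z w : cmod (z + w) <= cmod z + cmod w.
Proof. by rewrite !cmodE le_normcD. Qed.

Lemma cmodN z : cmod (- z) = cmod z.
Proof. by rewrite !cmodE normcN. Qed.

Lemma cmodB z w : cmod (z - w) <= cmod z + cmod w.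
Proof. by rewrite -[cmod w]cmodN cmodD. Qed.

Lemma cmod_distC z w : cmod (z - w) = cmod (w - z).
Proof. by rewrite -cmodN opprB. Qed.

Lemma cmod0 : cmod (0 : C) = 0.
Proof. by rewrite cmodE Normc.normc0. Qed.

Lemma cmod1 : cmod (1 : C) = 1.
Proof. by rewrite cmodE Normc.normc1. Qed.

Lemma cmod_eq0 z : cmod z = 0 -> z = 0.
Proof. by rewrite cmodE; exact: Normc.eq0_normc. Qed.

Lemma cmodX z n : cmod (z ^+ n) = cmod z ^+ n.
Proof. by elim: n => [|n IH]; rewrite ?expr0 ?cmod1// !exprS cmodM IH. Qed.

Lemma cmod_sum (I : Type) (r : seq I) (P : pred I) (F : I -> C) :
  cmod (\sum_(i <- r | P i) F i) <= \sum_(i <- r | P i) cmod (F i).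
Proof.
elim/big_ind2 : _ => [|a b c d ab cd|i _]; rewrite ?cmod0//.
exact: (le_trans (cmodD _ _) (lerD ab cd)).
Qed.

Lemma conjE (a b : R) : (Complex a b)^* = Complex a (- b) :> C.
Proof. by []. Qed.

Lemma Re_conj z : complex.Re z^* = complex.Re z. Proof. by case: z. Qed.
Lemma Im_conj z : complex.Im z^* = - complex.Im z. Proof. by case: z. Qed.

Lemma ReD z w : complex.Re (z + w) = complex.Re z + complex.Re w.
Proof. by case: z w => ? ? [? ?]. Qed.
Lemma ImD z w : complex.Im (z + w) = complex.Im z + complex.Im w.
Proof. by case: z w => ? ? [? ?]. Qed.
Lemma ReN z : complex.Re (- z) = - complex.Re z. Proof. by case: z. Qed.
Lemma ImN z : complex.Im (- z) = - complex.Im z. Proof. by case: z. Qed.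
Lemma ReM z w :
  complex.Re (z * w) = complex.Re z * complex.Re w - complex.Im z * complex.Im w.
Proof. by case: z w => ? ? [? ?]. Qed.
Lemma ImM z w :
  complex.Im (z * w) = complex.Re z * complex.Im w + complex.Im z * complex.Re w.
Proof. by case: z w => ? ? [? ?]. Qed.
Lemma ReC x y : complex.Re (Complex x y) = x. Proof. by []. Qed.
Lemma ImC x y : complex.Im (Complex x y) = y. Proof. by []. Qed.
Lemma ReofR x : complex.Re (ofR x) = x. Proof. by []. Qed.
Lemma ImofR x : complex.Im (ofR x) = 0. Proof. by []. Qed.
Definition ReImE := (ReD, ImD, ReN, ImN, ReM, ImM, ReC, ImC, ReofR, ImofR, Re_conj, Im_conj).

Lemma complex_ext z w :
  complex.Re z = complex.Re w -> complex.Im z = complex.Im w -> z = w.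
Proof. by case: z w => ? ? [? ?] /= -> ->. Qed.

Lemma sqnorm_conj z : sqnorm z^* = sqnorm z.
Proof. by rewrite /sqnorm !ReImE sqrrN. Qed.

Lemma cmod_conj z : cmod z^* = cmod z.
Proof. by rewrite /cmod sqnorm_conj. Qed.

Lemma cmod_ofR x : cmod (ofR x) = `|x|.
Proof. by rewrite /cmod /sqnorm /= expr0n addr0 sqrtr_sqr. Qed.

Lemma ofRM x y : ofR (x * y) = ofR x * ofR y.
Proof. by apply: complex_ext; rewrite !ReImE; ring. Qed.
Lemma ofRD x y : ofR (x + y) = ofR x + ofR y.
Proof. by apply: complex_ext; rewrite !ReImE; ring. Qed.
Lemma ofRN x : ofR (- x) = - ofR x.
Proof. by apply: complex_ext; rewrite !ReImE; ring. Qed.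
Lemma ofR1 : ofR 1 = 1 :> C. Proof. by []. Qed.
Lemma ofR0 : ofR 0 = 0 :> C. Proof. by []. Qed.
Lemma ofRV x : ofR x^-1 = (ofR x)^-1.
Proof. exact: (fmorphV (@real_complex_def R (Phant R))). Qed.
Lemma ofR_nat n : ofR n%:R = n%:R :> C.
Proof. by elim: n => // n IH; rewrite -natr1 ofRD IH natr1. Qed.
Lemma ofRX x n : ofR (x ^+ n) = ofR x ^+ n.
Proof. by elim: n => // n IH; rewrite !exprS ofRM IH. Qed.
Lemma conj_ofR x : (ofR x)^* = ofR x.
Proof. by apply: complex_ext; rewrite !ReImE ?oppr0. Qed.

Lemma mulC_conj z : z * z^* = ofR (sqnorm z).
Proof. by apply: complex_ext; rewrite !ReImE /sqnorm; ring. Qed.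

Lemma Re_le_cmod z : `|complex.Re z| <= cmod z.
Proof. by rewrite -sqrtr_sqr ler_wsqrtr// lerDl sqr_ge0. Qed.

Lemma Im_le_cmod z : `|complex.Im z| <= cmod z.
Proof. by rewrite -sqrtr_sqr ler_wsqrtr// lerDr sqr_ge0. Qed.

Lemma cmod_le_ReIm z : cmod z <= `|complex.Re z| + `|complex.Im z|.
Proof.
have -> : z = ofR (complex.Re z) + Complex 0 1 * ofR (complex.Im z).
  by apply: complex_ext; rewrite !ReImE; ring.
apply: (le_trans (cmodD _ _)); rewrite cmodM !cmod_ofR.
rewrite {1}/cmod /sqnorm ReC ImC expr0n expr1n add0r sqrtr1 mul1r !ReImE /=.
by rewrite !(mul0r, mulr0, subr0, add0r, addr0, mul1r, oppr0).
Qed.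

Lemma sqnormM z w : sqnorm (z * w) = sqnorm z * sqnorm w.
Proof. by rewrite -!cmod2 cmodM exprMn. Qed.

Lemma cexp0 : cexp 0 = 1 :> C.
Proof. by rewrite /cexp /= expR0 cos0 sin0 mulr1 mulr0. Qed.

Lemma cexpD z w : cexp (z + w) = cexp z * cexp w.
Proof.
by apply: complex_ext; rewrite /cexp !ReImE expRD ?cosD ?sinD; ring.
Qed.

Lemma cexp_conj z : cexp z^* = (cexp z)^*.
Proof.
by apply: complex_ext; rewrite /cexp !ReImE ?cosN ?sinN; ring.
Qed.

Lemma cmod_cexp z : cmod (cexp z) = expR (complex.Re z).
Proof.
rewrite /cmod /sqnorm /= !exprMn -mulrDr cos2Dsin2 mulr1 sqrtr_sqr ger0_norm//.
Qed.

Lemma cexp_ofR x : cexp (ofR x) = ofR (expR x).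
Proof. by rewrite /cexp /= cos0 sin0 mulr1 mulr0. Qed.

Lemma cexpN z : cexp z * cexp (- z) = 1.
Proof. by rewrite -cexpD subrr cexp0. Qed.

Lemma cexpMn z n : cexp (z *+ n) = cexp z ^+ n.
Proof. by elim: n => [|n IH]; rewrite ?cexp0// mulrS cexpD IH exprS. Qed.

End Modulus.

(** * Complex functions of a real variable; the exponential series *)

Section RealVariable.
Context (R : realType).
Local Notation C := R[i].
Implicit Types (F G : R -> C).

(** Taken componentwise, so that the mean value theorem and the fundamental theorem of calculus
    apply to each part. *)
Definition cder F (t : R) (v : C) :=
  is_derive t 1 (fun s => complex.Re (F s)) (complex.Re v) /\
  is_derive t 1 (fun s => complex.Im (F s)) (complex.Im v).

Lemma cderD F G t v w : cder F t v -> cder G t w ->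
  cder (fun s => F s + G s) t (v + w).
Proof.
move=> [? ?] [? ?]; split.
  rewrite (_ : (fun s => _) = (fun s => complex.Re (F s)) \+
    (fun s => complex.Re (G s))); first by rewrite ReD; exact: is_deriveD.
  by apply/funext => s; rewrite ReD.
rewrite (_ : (fun s => _) = (fun s => complex.Im (F s)) \+
  (fun s => complex.Im (G s))); first by rewrite ImD; exact: is_deriveD.
by apply/funext => s; rewrite ImD.
Qed.

Lemma cder_cst (c : C) t : cder (fun _ => c) t 0.
Proof. by split; exact: is_derive_cst. Qed.

Lemma cderM F G t v w : cder F t v -> cder G t w ->
  cder (fun s => F s * G s) t (v * G t + F t * w).
Proof.
move=> [? ?] [? ?]; split.
  rewrite (_ : (fun s => _) = (fun s => complex.Re (F s)) \* (fun s => complex.Re (G s)) \-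
    (fun s => complex.Im (F s)) \* (fun s => complex.Im (G s))).
    by apply: is_derive_eq; rewrite !ReImE /GRing.scale /=; ring.
  by apply/funext => s; rewrite ReM.
rewrite (_ : (fun s => _) = (fun s => complex.Re (F s)) \* (fun s => complex.Im (G s)) \+
  (fun s => complex.Im (F s)) \* (fun s => complex.Re (G s))).
  by apply: is_derive_eq; rewrite !ReImE /GRing.scale /=; ring.
by apply/funext => s; rewrite ImM.
Qed.

Lemma cderN F t v : cder F t v -> cder (fun s => - F s) t (- v).
Proof.
move=> Fv; rewrite (_ : (fun s => _) = (fun s => - 1 * F s)).
  have := cderM (cder_cst (- 1) t) Fv.
  by rewrite mul0r add0r mulN1r.
by apply/funext => s; rewrite mulN1r.
Qed.

Lemma cderB F G t v w : cder F t v -> cder G t w ->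
  cder (fun s => F s - G s) t (v - w).
Proof. by move=> Fv Gw; apply: cderD => //; exact: cderN. Qed.

Lemma cder_ofR (t : R) : cder (fun s => ofR s) t 1.
Proof. by split; [exact: is_derive_id|exact: is_derive_cst]. Qed.

Lemma cder_line (z c : C) t : cder (fun s => c + ofR s * z) t z.
Proof.
have := cderD (cder_cst c t) (cderM (cder_ofR t) (cder_cst z t)).
by rewrite mul1r mulr0 addr0 add0r.
Qed.

Lemma cder_expi (y t : R) :
  cder (fun s => cexp (Complex 0 (s * y))) t (Complex 0 y * cexp (Complex 0 (t * y))).
Proof.
have D : is_derive t 1 (fun s : R => s * y) y.
  apply: is_derive_eq.
  by rewrite /GRing.scale /= mulr1 mulr0 add0r.
split.
  rewrite (_ : (fun s => _) = cos \o (fun s : R => s * y)); last first.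
    by apply/funext => s; rewrite /cexp !ReImE /= expR0 mul1r.
  apply: is_derive_eq.
  by rewrite /cexp !ReImE expR0 /GRing.scale/=; ring.
rewrite (_ : (fun s => _) = sin \o (fun s : R => s * y)); last first.
  by apply/funext => s; rewrite /cexp !ReImE /= expR0 mul1r.
apply: is_derive_eq.
by rewrite /cexp !ReImE expR0 /GRing.scale/=; ring.
Qed.

Lemma cder_expr (x t : R) :
  cder (fun s => ofR (expR (s * x))) t (ofR (x * expR (t * x))).
Proof.
have D : is_derive t 1 (fun s : R => s * x) x.
  apply: is_derive_eq.
  by rewrite /GRing.scale /= mulr1 mulr0 add0r.
split; last by rewrite ImofR; exact: is_derive_cst.
rewrite (_ : (fun s => _) = expR \o (fun s : R => s * x))//.
by apply: is_derive_eq; rewrite /GRing.scale/=; ring.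
Qed.

Lemma cexp_polar (z : C) (s : R) :
  cexp (ofR s * z) = ofR (expR (s * complex.Re z)) * cexp (Complex 0 (s * complex.Im z)).
Proof.
rewrite -cexp_ofR -cexpD; congr cexp.
by apply: complex_ext; rewrite !ReImE; ring.
Qed.

Lemma cder_cexp (z : C) t : cder (fun s => cexp (ofR s * z)) t (z * cexp (ofR t * z)).
Proof.
rewrite (_ : (fun s => _) = (fun s => ofR (expR (s * complex.Re z)) *
  cexp (Complex 0 (s * complex.Im z)))); last first.
  by apply/funext => s; exact: cexp_polar.
have := cderM (cder_expr (complex.Re z) t) (cder_expi (complex.Im z) t).
congr cder; rewrite cexp_polar ofRM.
have -> : z = ofR (complex.Re z) + Complex 0 (complex.Im z).
  by apply: complex_ext; rewrite !ReImE; ring.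
by rewrite !ReImE addr0 add0r; ring.
Qed.

Lemma cder_cvg F t v : cder F t v ->
  {for t, continuous (fun s => complex.Re (F s))} /\
  {for t, continuous (fun s => complex.Im (F s))}.
Proof.
by move=> [[d1 _] [d2 _]]; split;
  exact/differentiable_continuous/derivable1_diffP.
Qed.

(** The mean value theorem gives a different intermediate point for each component; adding the two
    estimates produces the factor 2. *)
Lemma cder_MVT F (f : R -> C) (a b M : R) : a <= b ->
  (forall t, cder F t (f t)) -> (forall t, a <= t <= b -> cmod (f t) <= M) ->
  cmod (F b - F a) <= 2 * M * (b - a).
Proof.
move=> ab dF fM; apply: (le_trans (cmod_le_ReIm _)).
rewrite -mulrA mulr_natl mulr2n lerD//.
  have [||c] := @MVT_segment R (fun s => complex.Re (F s)) (fun s => complex.Re (f s)) a b ab.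
  - by move=> x _; have [] := dF x.
  - exact: continuous_subspaceT (fun x => (cder_cvg (dF x)).1).
  rewrite in_itv /= => cab; rewrite !ReImE => ->.
  rewrite normrM [X in _ * X]ger0_norm ?subr_ge0// ler_wpM2r ?subr_ge0//.
  exact: le_trans (Re_le_cmod _) (fM _ cab).
have [||c] := @MVT_segment R (fun s => complex.Im (F s)) (fun s => complex.Im (f s)) a b ab.
- by move=> x _; have [] := dF x.
- exact: continuous_subspaceT (fun x => (cder_cvg (dF x)).2).
rewrite in_itv /= => cab; rewrite !ReImE => ->.
rewrite normrM [X in _ * X]ger0_norm ?subr_ge0// ler_wpM2r ?subr_ge0//.
exact: le_trans (Im_le_cmod _) (fM _ cab).
Qed.

Definition exp_sum N (z : C) : C := \sum_(n < N) z ^+ n / ofR n`!%:R.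

Lemma exp_sumS N z : exp_sum N.+1 z = exp_sum N z + z ^+ N / ofR N`!%:R.
Proof. by rewrite /exp_sum big_ord_recr. Qed.

Lemma cder_exp_sum N (z : C) t : cder (fun s => exp_sum N.+1 (ofR s * z)) t
  (z * exp_sum N (ofR t * z)).
Proof.
elim: N => [|N IH].
  rewrite /exp_sum big_ord0 mulr0.
  rewrite (_ : (fun s => _) = cst 1); first exact: cder_cst.
  by apply/funext => s; rewrite big_ord1 expr0 fact0 divr1.
rewrite (_ : (fun s => _) =
    (fun s => exp_sum N.+1 (ofR s * z) + (ofR s * z) ^+ N.+1 / ofR N.+1`!%:R)); last first.
  by apply/funext => s; rewrite exp_sumS.
rewrite exp_sumS mulrDr; apply: (cderD IH).
have dX : forall m, cder (fun s => (ofR s * z) ^+ m) t (m%:R * z * (ofR t * z) ^+ m.-1).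
  elim=> [|m IHm]; first by rewrite !mul0r; exact: cder_cst.
  rewrite (_ : (fun s => _) = (fun s => ofR s * z * (ofR s * z) ^+ m)); last first.
    by apply/funext => s; rewrite exprS.
  have := cderM (cderM (cder_ofR t) (cder_cst z t)) IHm.
  congr cder; case: m {IHm} => [|m]; first by rewrite !expr0; ring.
  by rewrite /= !exprS -!natr1; ring.
have := cderM (dX N.+1) (cder_cst ((ofR N.+1`!%:R)^-1) t).
congr cder; rewrite mulr0 addr0 /= factS natrM ofRM !ofR_nat.
have n1 : (N.+1%:R : C) != 0 by rewrite pnatr_eq0.
have n2 : (N`!%:R : C) != 0 by rewrite pnatr_eq0 -lt0n fact_gt0.
move: n1 n2; move: (N.+1%:R : C) (N`!%:R : C) ((_ ^+ N) : C) => p q r p0 q0.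
by field; rewrite p0 q0.
Qed.

Lemma exp_sum0 N : exp_sum N.+1 0 = 1.
Proof.
rewrite /exp_sum big_ord_recl big1 ?addr0 ?expr0 ?fact0 ?divr1// => i _.
by rewrite expr0n mul0r.
Qed.

(* The derivative of [e^{-tz} E_{N+1}(tz)] is [- z (tz)^N / N! e^{-tz}]. *)
Lemma exp_sum_error N (z : C) : cmod (exp_sum N.+1 z - cexp z) <=
  2 * (cmod z ^+ N.+1 / N`!%:R * expR (2 * cmod z)).
Proof.
have N0 : 0 < (N`!%:R : R) by rewrite ltr0n fact_gt0.
set f := fun t => - (z * (ofR t * z) ^+ N / ofR N`!%:R) * cexp (ofR t * - z).
have D t : cder (fun s => exp_sum N.+1 (ofR s * z) * cexp (ofR s * - z)) t (f t).
  have := cderM (cder_exp_sum N z t) (cder_cexp (- z) t).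
  by congr cder; rewrite /f exp_sumS; ring.
have fM t : 0 <= t <= 1 -> cmod (f t) <= cmod z ^+ N.+1 / N`!%:R * expR (cmod z).
  move=> /andP[t0 t1].
  rewrite /f !cmodM cmodN !cmodM cmodX cmodM -ofRV !cmod_ofR cmod_cexp.
  rewrite !ger0_norm ?invr_ge0 ?(ltW N0)// exprMn.
  have h1 : t ^+ N <= 1 by rewrite exprn_ile1.
  have h2 : complex.Re (ofR t * - z) <= cmod z.
    rewrite !ReImE mul0r subr0 mulrN -mulNr.
    apply: (le_trans (ler_norm _)); rewrite normrM normrN (ger0_norm t0).
    by rewrite -[leRHS]mul1r ler_pM// Re_le_cmod.
  apply: ler_pM; rewrite ?expR_ge0 ?ler_expR//.
    by rewrite !mulr_ge0 ?exprn_ge0 ?invr_ge0 ?cmod_ge0 ?(ltW N0).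
  rewrite ler_pM2r ?invr_gt0// exprS ler_wpM2l ?cmod_ge0//.
  by rewrite -[leRHS]mul1r ler_wpM2r ?exprn_ge0 ?cmod_ge0.
have := cder_MVT ler01 D fM; rewrite subr0 mulr1 ofR0 ofR1 !mul0r !mul1r exp_sum0 cexp0 mulr1.
(* Undoing the multiplication by exp (- z) costs a second factor exp |z|, hence the exponent
   [2 * cmod z]. *)
move=> h; have -> : exp_sum N.+1 z - cexp z = (exp_sum N.+1 z * cexp (- z) - 1) * cexp z.
  by rewrite mulrBl mul1r -mulrA [cexp (- z) * _]mulrC cexpN mulr1.
rewrite cmodM cmod_cexp [2 * cmod z]mulr_natl mulr2n expRD !mulrA in h *.
rewrite ler_pM ?cmod_ge0 ?expR_ge0 ?ler_expR//.
exact: le_trans (ler_norm _) (Re_le_cmod _).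
Qed.

Lemma cmod_exp_sum_le N (z : C) : cmod (exp_sum N z) <= expR (cmod z).
Proof.
apply: (le_trans (cmod_sum _ _ _)).
rewrite (eq_bigr (fun n : 'I_N => exp_coeff (cmod z) n)); last first.
  by move=> i _; rewrite cmodM cmodX -ofRV cmod_ofR ger0_norm.
rewrite -(big_mkord xpredT (exp_coeff (cmod z))).
apply: nondecreasing_cvgn_le; last exact: is_cvg_series_exp_coeff.
apply/nondecreasing_seqP => n; rewrite /series /= big_nat_recr//= lerDl.
by rewrite exp_coeff_ge0// cmod_ge0.
Qed.

Lemma cvg_cmod (T : Type) (F : set_system T) {FF : Filter F} (f : T -> C) (l : C) :
  (fun t => cmod (f t - l)) @ F --> (0 : R) -> (f : T -> C^o) @ F --> (l : C^o).
Proof.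
move=> h; apply/cvgrPdist_lt => /= -[e i]; rewrite ltcE /= => /andP[/eqP -> e0].
move/cvgrPdist_lt : h => /(_ _ e0); apply: filterS => t.
rewrite sub0r normrN ger0_norm ?cmod_ge0// cmod_distC => h.
by rewrite normc_def ltcE /= eqxx.
Qed.

Lemma cvg_exp_sum (z : C) : (fun N => cmod (exp_sum N z - cexp z)) @ \oo --> (0 : R).
Proof.
rewrite -cvg_shiftS.
apply: (@squeeze_cvgr _ _ _ _ (cst 0)
  (fun N => 2 * (cmod z * exp_coeff (cmod z) N * expR (2 * cmod z)))).
- apply: nearW => N; rewrite cmod_ge0 /=.
  by have := exp_sum_error N z; rewrite exprS /exp_coeff /= !mulrA.
- exact: cvg_cst.
- rewrite [X in _ --> X](_ : _ = 2 * (cmod z * 0 * expR (2 * cmod z))); last by ring.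
  apply: cvgM; first exact: cvg_cst.
  apply: cvgM; last exact: cvg_cst.
  by apply: cvgM; [exact: cvg_cst|exact: cvg_exp_coeff].
Qed.

(** Since n! <= (n + 2)!, the tail is at most |z|^2 times the exponential series of |z|. The bound
    does not depend on [N] and so survives the limit in [cexp_taylor2]. *)
Lemma cmod_exp_sum2 N (z : C) :
  cmod (exp_sum N.+2 z - 1 - z) <= cmod z ^+ 2 * expR (cmod z).
Proof.
have -> : exp_sum N.+2 z - 1 - z = \sum_(n < N) z ^+ n.+2 / ofR n.+2`!%:R.
  rewrite /exp_sum !big_ord_recl /= /bump /= expr0 expr1 fact0 !divr1.
  by rewrite (addrC 1) addrK addrAC subrr add0r.
apply: (le_trans (cmod_sum _ _ _)).
have h : \sum_(n < N) exp_coeff (cmod z) n <= expR (cmod z).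
  rewrite -(big_mkord xpredT (exp_coeff (cmod z))).
  apply: nondecreasing_cvgn_le; last exact: is_cvg_series_exp_coeff.
  apply/nondecreasing_seqP => n; rewrite /series /= big_nat_recr//= lerDl.
  by rewrite exp_coeff_ge0// cmod_ge0.
apply: le_trans (_ : cmod z ^+ 2 * \sum_(n < N) exp_coeff (cmod z) n <= _); last first.
  by rewrite ler_wpM2l ?exprn_ge0 ?cmod_ge0.
rewrite mulr_sumr; apply: ler_sum => i _.
rewrite cmodM cmodX -ofRV cmod_ofR ger0_norm ?invr_ge0// /exp_coeff /= mulrA -exprD add2n.
rewrite ler_wpM2l ?exprn_ge0 ?cmod_ge0// lef_pV2 ?posrE ?ltr0n ?fact_gt0//.
by rewrite ler_nat leq_fact// -addn2 leq_addr.
Qed.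

Lemma cexp_taylor2 (z : C) : cmod (cexp z - 1 - z) <= cmod z ^+ 2 * expR (cmod z).
Proof.
have h : (fun N => cmod z ^+ 2 * expR (cmod z) + cmod (exp_sum N.+2 z - cexp z)) @ \oo
    --> cmod z ^+ 2 * expR (cmod z) + 0.
  apply: cvgD; first exact: cvg_cst.
  by have := @cvg_exp_sum z; rewrite -cvg_shiftS -cvg_shiftS.
rewrite -[leRHS]addr0 -(cvg_lim _ h)//.
apply: limr_ge; first by apply/cvg_ex; eexists; exact: h.
apply: nearW => N.
have -> : cexp z - 1 - z = (exp_sum N.+2 z - 1 - z) - (exp_sum N.+2 z - cexp z) by ring.
by apply: (le_trans (cmodB _ _)); rewrite lerD2r cmod_exp_sum2.
Qed.

End RealVariable.

(** * Primitives of continuous functions on the whole line *)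

Section Primitive.
Context (R : realType).
Local Notation mu := (@lebesgue_measure R).

(** Vanishing on the left half-line makes the integral from minus infinity converge, so a single
    formula serves for all [t]. *)
Let primitive_half (f : R -> R) : continuous f -> (forall t, t <= 0 -> f t = 0) ->
  exists F : R -> R, forall t : R, is_derive t 1 F (f t).
Proof.
move=> cf f0; exists (fun x => \int[mu]_(t in `]-oo, x]) f t)%R => t.
have intf : mu.-integrable `]-oo, (t + 1)] (EFin \o f).
  have -> : EFin \o f = (EFin \o f) \_ `[0, +oo[.
    apply/funext => x; rewrite patchE; case: ifPn => //.
    rewrite notin_setE /= in_itv /= andbT => /negP; rewrite -ltNge => /ltW x0.
    by rewrite f0.
  apply/integrable_restrict => //.
  have -> : `]-oo, t + 1]%classic `&` `[0, +oo[%classic = `[0, t + 1]%classic :> set R.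
    apply/seteqP; split => x /=; rewrite !in_itv /= ?andbT; first by move=> [-> ->].
    by move=> /andP[-> ->].
  apply: continuous_compact_integrable; first exact: segment_compact.
  exact: continuous_subspaceT.
have t1 : t < t + 1 by rewrite ltrDl.
have [|d e] := @continuous_FTC1 R f -oo%O t (t + 1) t1 intf _ (cf t).
  by rewrite ltNyr.
split; first exact: d.
by rewrite -derive1E; exact: e.
Qed.

(** [f] minus [f 0] splits into a part supported on the right and a part supported on the left. The
    second is reflected, so that [primitive_half] applies to both, and the linear term restores
    [f 0]. *)
Lemma primitive (f : R -> R) : continuous f ->
  exists F : R -> R, forall t : R, is_derive t 1 F (f t).
Proof.
move=> cf.
have [F dF] : exists F : R -> R, forall t : R, is_derive t 1 F (f (Num.max t 0) - f 0).
  apply: primitive_half => [x|t t0]; last by rewrite max_r// subrr.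
  apply: cvgB; last exact: cvg_cst.
  apply: (@continuous_comp _ _ _ (fun t : R => Num.max t 0) f); last exact: cf.
  by apply: continuous_max; [exact: cvg_id|exact: cvg_cst].
have [G dG] : exists G : R -> R, forall t : R, is_derive t 1 G (f (- Num.max t 0) - f 0).
  apply: primitive_half => [x|t t0]; last by rewrite max_r// oppr0 subrr.
  apply: cvgB; last exact: cvg_cst.
  apply: (@continuous_comp _ _ _ (fun t : R => - Num.max t 0) f); last exact: cf.
  apply: continuousN.
  by apply: continuous_max; [exact: cvg_id|exact: cvg_cst].
exists (fun t => F t - G (- t) + f 0 * t) => t.
have dGN : is_derive t 1 (G \o -%R) (- (f (- Num.max (- t) 0) - f 0)).
  have dN := is_deriveN (is_derive_id t (1 : R)).
  have := @is_derive1_comp R G -%R t _ _ (dG (- t)) dN.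
  by rewrite mulrN1.
have dl : is_derive t 1 (fun t : R => f 0 * t) (f 0).
  by apply: is_derive_eq; rewrite /GRing.scale/=; ring.
have := is_deriveD (is_deriveB (dF t) dGN) dl.
have -> : (fun t0 : R => F t0 - G (- t0) + f 0 * t0) = F - (G \o -%R) + ( *%R (f 0)) by [].
move=> h; apply: is_derive_eq h _.
have [t0|t0] := leP 0 t.
  by rewrite [Num.max (- t) 0]max_r ?oppr_le0// oppr0; ring.
by rewrite [Num.max (- t) 0]max_l ?oppr_ge0 ?ltW// (opprK t); ring.
Qed.

End Primitive.

(** * Cauchy's theorem and the mean value property *)

Section Holomorphic.
Context (R : realType).
Local Notation C := R[i].
Implicit Types (f g : C -> C) (z d : C).

(** The remainder is compared with [e * cmod h] instead of being divided by [h]: no exception at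
    [h = 0], and Goursat's estimate uses it in this form. *)
Definition cderivable_at f z d := forall e : R, 0 < e -> exists2 r : R, 0 < r &
  forall h : C, cmod h < r -> cmod (f (z + h) - f z - d * h) <= e * cmod h.

Definition centire f := forall z, exists d, cderivable_at f z d.

Lemma cderivable_lipschitz f z d : cderivable_at f z d -> exists2 r : R, 0 < r &
  forall h : C, cmod h < r -> cmod (f (z + h) - f z) <= (1 + cmod d) * cmod h.
Proof.
move=> /(_ 1 ltr01) [r r0 H]; exists r => // h /H hr.
have -> : f (z + h) - f z = (f (z + h) - f z - d * h) + d * h by ring.
by apply: (le_trans (cmodD _ _)); rewrite mulrDl cmodM lerD2r.
Qed.

Lemma centire_cvg f z : centire f -> forall e : R, 0 < e -> exists2 r : R, 0 < r &
  forall h : C, cmod h < r -> cmod (f (z + h) - f z) < e.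
Proof.
move=> ef e e0; have [d /cderivable_lipschitz [r r0 H]] := ef z.
have d0 : 0 < 1 + cmod d by rewrite ltr_pwDl ?cmod_ge0.
exists (Num.min r (e / (1 + cmod d))); first by rewrite lt_min r0 divr_gt0.
move=> h; rewrite lt_min => /andP[hr he]; apply: (le_lt_trans (H _ hr)).
by rewrite mulrC -ltr_pdivlMr.
Qed.

Lemma centire_cst (c : C) : centire (fun _ => c).
Proof.
move=> z; exists 0 => e e0; exists 1 => // h _.
by rewrite subrr mul0r subrr cmod0 mulr_ge0 ?cmod_ge0 ?ltW.
Qed.

Lemma centire_id : centire id.
Proof.
move=> z; exists 1 => e e0; exists 1 => // h _.
have -> : z + h - z - 1 * h = 0 by ring.
by rewrite cmod0 mulr_ge0 ?cmod_ge0 ?ltW.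
Qed.

Lemma centireD f g : centire f -> centire g -> centire (fun z => f z + g z).
Proof.
move=> ef eg z; have [d Hd] := ef z; have [d' Hd'] := eg z.
exists (d + d') => e e0; have e2 : 0 < e / 2 by rewrite divr_gt0.
have [r r0 H] := Hd _ e2; have [r' r'0 H'] := Hd' _ e2.
exists (Num.min r r'); first by rewrite lt_min r0.
move=> h; rewrite lt_min => /andP[/H h1 /H' h2].
have -> : f (z + h) + g (z + h) - (f z + g z) - (d + d') * h =
  (f (z + h) - f z - d * h) + (g (z + h) - g z - d' * h) by ring.
by apply: (le_trans (cmodD _ _)); rewrite (splitr e) mulrDl lerD.
Qed.

Lemma centireM f g : centire f -> centire g -> centire (fun z => f z * g z).
Proof.
move=> ef eg z; have [d Hd] := ef z; have [d' Hd'] := eg z.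
exists (d * g z + f z * d') => e e0.
have [r1 r10 H1] := cderivable_lipschitz Hd.
have [r2 r20 H2] := cderivable_lipschitz Hd'.
(* [K] collects the coefficients of [e / K * cmod h] in the three error terms of the product; the
   leading 1 makes it positive. *)
set K := 1 + cmod (f z) + cmod (g z) + (1 + cmod d) * (1 + cmod d').
have K0 : 0 < K.
  by rewrite /K -!addrA ltr_pwDl// !addr_ge0 ?mulr_ge0 ?addr_ge0 ?cmod_ge0.
have eK : 0 < e / K by rewrite divr_gt0.
have [r3 r30 H3] := Hd _ eK; have [r4 r40 H4] := Hd' _ eK.
exists (Num.min (Num.min r1 r2) (Num.min (Num.min r3 r4) (e / K))).
  by rewrite !lt_min r10 r20 r30 r40 eK.
move=> h; rewrite !lt_min => /andP[/andP[/H1 h1 /H2 h2] /andP[/andP[/H3 h3 /H4 h4] h5]].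
have -> : f (z + h) * g (z + h) - f z * g z - (d * g z + f z * d') * h =
  (f (z + h) - f z - d * h) * g z + f z * (g (z + h) - g z - d' * h) +
  (f (z + h) - f z) * (g (z + h) - g z) by ring.
have hh : cmod h * cmod h <= e / K * cmod h by rewrite ler_wpM2r ?cmod_ge0 ?ltW.
apply: le_trans (_ : e / K * cmod h * cmod (g z) + cmod (f z) * (e / K * cmod h) +
    ((1 + cmod d) * cmod h) * ((1 + cmod d') * cmod h) <= _).
  apply: (le_trans (cmodD _ _)); apply: lerD; last by rewrite cmodM ler_pM ?cmod_ge0.
  apply: (le_trans (cmodD _ _)); rewrite !cmodM lerD// ?ler_wpM2r ?ler_wpM2l ?cmod_ge0//.
apply: le_trans (_ : e / K * cmod h * K <= _); last first.
  by rewrite mulrAC divfK ?gt_eqF.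
have h6 : (1 + cmod d) * (1 + cmod d') * (cmod h * cmod h) <=
    (1 + cmod d) * (1 + cmod d') * (e / K * cmod h).
  by rewrite ler_wpM2l ?mulr_ge0 ?addr_ge0 ?cmod_ge0.
have h7 : 0 <= e / K * cmod h by rewrite mulr_ge0 ?cmod_ge0 ?ltW.
set X := e / K * cmod h in h6 h7 *; clearbody X.
by rewrite /K; lra.
Qed.

Lemma centire_comp f g : centire f -> centire g -> centire (fun z => f (g z)).
Proof.
move=> ef eg z; have [d' Hd'] := eg z; have [d Hd] := ef (g z).
exists (d * d') => e e0.
have [r1 r10 H1] := cderivable_lipschitz Hd'.
set K := 1 + cmod d + cmod d'.
have K0 : 0 < K by rewrite /K -addrA ltr_pwDl// addr_ge0 ?cmod_ge0.
have eK : 0 < e / K by rewrite divr_gt0.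
have [r2 r20 H2] := Hd _ eK; have [r3 r30 H3] := Hd' _ eK.
exists (Num.min r1 (Num.min r3 (r2 / K))); first by rewrite !lt_min r10 r30 divr_gt0.
move=> h; rewrite !lt_min => /andP[/H1 h1 /andP[/H3 h3 h4]].
have dK : 1 + cmod d' <= K by rewrite /K addrAC lerDl cmod_ge0.
have k2 : cmod (g (z + h) - g z) < r2.
  apply: le_lt_trans h1 _; apply: le_lt_trans (_ : K * cmod h < _).
    by rewrite ler_wpM2r ?cmod_ge0.
  by rewrite mulrC -ltr_pdivlMr.
have := H2 _ k2; rewrite (_ : g z + _ = g (z + h)); last by ring.
move=> k3.
have -> : f (g (z + h)) - f (g z) - d * d' * h =
  (f (g (z + h)) - f (g z) - d * (g (z + h) - g z)) + d * (g (z + h) - g z - d' * h) by ring.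
apply: (le_trans (cmodD _ _)); rewrite cmodM.
apply: le_trans (_ : e / K * ((1 + cmod d') * cmod h) + cmod d * (e / K * cmod h) <= _).
  apply: lerD; last by rewrite ler_wpM2l ?cmod_ge0.
  by apply: (le_trans k3); rewrite ler_wpM2l ?(ltW eK).
rewrite le_eqVlt; apply/orP; left; apply/eqP.
have -> : e = e / K * K by rewrite divfK ?gt_eqF.
by rewrite mulfK ?gt_eqF// /K; ring.
Qed.

Lemma centire_cexp : centire (@cexp R).
Proof.
move=> z; exists (cexp z) => e e0.
have K0 : 0 < expR (complex.Re z) * expR 1 by rewrite mulr_gt0 ?expR_gt0.
exists (Num.min 1 (e / (expR (complex.Re z) * expR 1))).
  by rewrite lt_min ltr01 divr_gt0.
move=> h; rewrite lt_min => /andP[h1 h2].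
have -> : cexp (z + h) - cexp z - cexp z * h = cexp z * (cexp h - 1 - h).
  by rewrite cexpD; ring.
rewrite cmodM cmod_cexp.
apply: le_trans (_ : expR (complex.Re z) * (cmod h ^+ 2 * expR 1) <= _).
  rewrite ler_wpM2l ?expR_ge0//; apply: (le_trans (cexp_taylor2 h)).
  by rewrite ler_wpM2l ?exprn_ge0 ?cmod_ge0// ler_expR ltW.
rewrite (_ : _ * _ = cmod h * (expR (complex.Re z) * expR 1) * cmod h); last by ring.
by rewrite ler_wpM2r ?cmod_ge0// -ler_pdivlMr// ltW.
Qed.

Lemma centireX n : centire (fun z => z ^+ n).
Proof.
elim: n => [|n IH]; first by rewrite (_ : (fun z => _) = fun=> 1)//; exact: centire_cst.
rewrite (_ : (fun z => _) = fun z => z * z ^+ n); last by apply/funext => z; rewrite exprS.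
exact: centireM centire_id IH.
Qed.

Lemma centireMl (c : C) f : centire f -> centire (fun z => c * f z).
Proof. exact/centireM/centire_cst. Qed.

End Holomorphic.

(** * Cauchy's theorem for rectangles *)

Section Goursat.
Context (R : realType).
Local Notation C := R[i].
Implicit Types (x y a b t s : R).

Lemma continuous_line (f : C -> C) (c v : C) : centire f ->
  continuous (fun t : R => complex.Re (f (c + ofR t * v))) /\
  continuous (fun t : R => complex.Im (f (c + ofR t * v))).
Proof.
move=> ef.
have key t e : 0 < e ->
    \forall s \near t, cmod (f (c + ofR t * v) - f (c + ofR s * v)) < e.
  move=> e0; have [r r0 H] := centire_cvg (c + ofR t * v) ef e0.
  have v0 : 0 < 1 + cmod v by rewrite ltr_pwDl ?cmod_ge0.
  have d0 : 0 < r / (1 + cmod v) by rewrite divr_gt0.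
  have : \forall s \near t, `|t - s| < r / (1 + cmod v).
    by apply/nbhs_ballP; exists (r / (1 + cmod v)).
  apply: filterS => s ts; rewrite cmod_distC.
  have -> : c + ofR s * v = c + ofR t * v + ofR (s - t) * v.
    by rewrite ofRD ofRN; ring.
  apply: H; rewrite cmodM cmod_ofR.
  apply: le_lt_trans (_ : `|s - t| * (1 + cmod v) < _).
    by rewrite ler_wpM2l// lerDr.
  by rewrite -ltr_pdivlMr// distrC.
split=> t; apply/cvgrPdist_lt => e /(key t); apply: filterS => s; apply: le_lt_trans.
  by rewrite -ReN -ReD Re_le_cmod.
by rewrite -ImN -ImD Im_le_cmod.
Qed.

(** Integrals along the sides of a rectangle are represented by increments of such primitives, so
    Cauchy's theorem is proved by differential calculus alone. *)
Lemma primitive_line (f : C -> C) (c v : C) : centire f ->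
  exists F : R -> C, forall t : R, cder F t (f (c + ofR t * v)).
Proof.
move=> ef; have [c1 c2] := continuous_line c v ef.
have [F dF] := primitive c1; have [G dG] := primitive c2.
exists (fun t => Complex (F t) (G t)) => t.
by split; [exact: dF|exact: dG].
Qed.

(** Makes a side integral independent of the chosen primitive; used to identify the two horizontal
    sides of a period rectangle of [cexp]. *)
Lemma cder_eq_increment (F G : R -> C) (h : R -> C) a b :
  (forall t, cder F t (h t)) -> (forall t, cder G t (h t)) -> a <= b ->
  F b - F a = G b - G a.
Proof.
move=> dF dG ab.
have D t : cder (fun s => F s - G s) t (h t - h t) by exact: cderB.
have := @cder_MVT _ _ _ a b 0 ab D.
rewrite mulr0 mul0r => /(_ _) h0.
have /eqP : cmod (F b - G b - (F a - G a)) = 0.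
  by apply/eqP; rewrite eq_le cmod_ge0 h0// => t _; rewrite subrr cmod0.
move=> /eqP/cmod_eq0 e.
by apply/eqP; rewrite -subr_eq0 -e; apply/eqP; ring.
Qed.

Section Rectangle.
Context (f : C -> C) (H V : R -> R -> C) (ef : centire f)
  (dH : forall y t, cder (H y) t (f (Complex t y)))
  (dV : forall x t, cder (V x) t (f (Complex x t))).

(* The integral of [f] along the boundary of [x, x + a] x [y, y + b]. *)
Let boundary x y a b : C :=
  (H y (x + a) - H y x) + Complex 0 1 * (V (x + a) (y + b) - V (x + a) y)
  - (H (y + b) (x + a) - H (y + b) x) - Complex 0 1 * (V x (y + b) - V x y).

Let boundary_split x y a b : boundary x y a b =
  boundary x y (a / 2) (b / 2) + boundary (x + a / 2) y (a / 2) (b / 2) +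
  (boundary x (y + b / 2) (a / 2) (b / 2) +
   boundary (x + a / 2) (y + b / 2) (a / 2) (b / 2)).
Proof.
rewrite /boundary -!addrA -!splitr !addrA.
by ring.
Qed.

(** The four quarters add up to the whole by [boundary_split]; if each were smaller than a fourth of
    it, the triangle inequality would fail. [p] is the corner of a quarter that is not. *)
Let boundary_quarter x y a b : 0 <= a -> 0 <= b -> exists p : R * R,
  [/\ x <= p.1, y <= p.2, p.1 + a / 2 <= x + a, p.2 + b / 2 <= y + b &
  cmod (boundary x y a b) <= 4 * cmod (boundary p.1 p.2 (a / 2) (b / 2))].
Proof.
move=> a0 b0.
have [h1|h1] := leP (cmod (boundary x y a b)) (4 * cmod (boundary x y (a / 2) (b / 2))).
  by exists (x, y); split => //=; lra.
have [h2|h2] := leP (cmod (boundary x y a b))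
    (4 * cmod (boundary (x + a / 2) y (a / 2) (b / 2))).
  by exists (x + a / 2, y); split => //=; lra.
have [h3|h3] := leP (cmod (boundary x y a b))
    (4 * cmod (boundary x (y + b / 2) (a / 2) (b / 2))).
  by exists (x, y + b / 2); split => //=; lra.
have [h4|h4] := leP (cmod (boundary x y a b))
    (4 * cmod (boundary (x + a / 2) (y + b / 2) (a / 2) (b / 2))).
  by exists (x + a / 2, y + b / 2); split => //=; lra.
exfalso; have := boundary_split x y a b.
move: h1 h2 h3 h4; move: (boundary _ _ _ _) (boundary x y (a / 2) _)
  (boundary (x + _) y _ _) (boundary x (y + _) _ _) (boundary (x + _) (y + _) _ _).
move=> z z1 z2 z3 z4 h1 h2 h3 h4 e; move: (cmodD (z1 + z2) (z3 + z4)).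
by rewrite -e; move: (cmodD z1 z2) (cmodD z3 z4); lra.
Qed.

(** The affine part [l] of [f] at [z0] has the primitive [L], so subtracting [L] leaves the boundary
    integral unchanged. Each side then carries only the error of [f] against [l], which is at most e
    (a + b), because points of the rectangle are within a + b of [z0]. *)
Let boundary_small x y (d : C) (e r a b x0 y0 : R) : 0 <= a -> 0 <= b ->
  x <= x0 <= x + a -> y <= y0 <= y + b -> a + b < r ->
  (forall h : C, cmod h < r ->
     cmod (f (Complex x0 y0 + h) - f (Complex x0 y0) - d * h) <= e * cmod h) ->
  cmod (boundary x y a b) <= 4 * (e * (a + b) * (a + b)).
Proof.
move=> a0 b0 /andP[xx0 x0x] /andP[yy0 y0y] abr fd.
set z0 := Complex x0 y0 in fd.
pose L z := f z0 * (z - z0) + d / 2 * ((z - z0) * (z - z0)).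
pose l z := f z0 + d * (z - z0).
have dLx yy t : cder (fun s => L (Complex s yy)) t (l (Complex t yy)).
  have E s : Complex s yy - z0 = (Complex 0 yy - z0) + ofR s * 1.
    by apply: complex_ext; rewrite !ReImE; ring.
  rewrite /L /l (_ : (fun s => _) = fun s => f z0 * ((Complex 0 yy - z0) + ofR s * 1) +
    d / 2 * (((Complex 0 yy - z0) + ofR s * 1) * ((Complex 0 yy - z0) + ofR s * 1))).
    have D := cder_line 1 (Complex 0 yy - z0) t.
    have := cderD (cderM (cder_cst (f z0) t) D) (cderM (cder_cst (d / 2) t) (cderM D D)).
    congr cder; rewrite (E t) [in RHS](splitr d); move: (_ + ofR t * _) (d / 2) => w d2.
    by ring.
  by apply/funext => s; rewrite (E s).
have dLy xx t : cder (fun s => L (Complex xx s)) t (Complex 0 1 * l (Complex xx t)).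
  have E s : Complex xx s - z0 = (Complex xx 0 - z0) + ofR s * Complex 0 1.
    by apply: complex_ext; rewrite !ReImE; ring.
  rewrite /L /l (_ : (fun s => _) = fun s => f z0 * ((Complex xx 0 - z0) + ofR s * Complex 0 1) +
    d / 2 * (((Complex xx 0 - z0) + ofR s * Complex 0 1) * ((Complex xx 0 - z0) + ofR s * Complex 0 1))).
    have D := cder_line (Complex 0 1) (Complex xx 0 - z0) t.
    have := cderD (cderM (cder_cst (f z0) t) D) (cderM (cder_cst (d / 2) t) (cderM D D)).
    congr cder; rewrite (E t) [in RHS](splitr d); move: (_ + ofR t * _) (d / 2) => w d2.
    by ring.
  by apply/funext => s; rewrite (E s).
have close t s : x <= t <= x + a -> y <= s <= y + b ->
    cmod (f (Complex t s) - l (Complex t s)) <= e * (a + b).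
  move=> /andP[t1 t2] /andP[s1 s2].
  have hr : cmod (Complex t s - z0) <= a + b.
    apply: (le_trans (cmod_le_ReIm _)); rewrite !ReImE lerD// ler_norml; apply/andP; split; lra.
  (* The sign of [e] follows from the differentiability bound, tested at an increment of modulus
     [r / 2]. *)
  have e0 : 0 <= e.
    have := fd (ofR (r / 2)); rewrite cmod_ofR ger0_norm; last by lra.
    have r2 : r / 2 < r by lra.
    move=> /(_ r2) /(le_trans (cmod_ge0 _)).
    by rewrite pmulr_lge0//; lra.
  have := fd _ (le_lt_trans hr abr); rewrite (_ : z0 + _ = Complex t s); last by ring.
  rewrite /l opprD addrA => /le_trans; apply.
  by rewrite ler_wpM2l.
have horizontal yy : y <= yy <= y + b ->
    cmod ((H yy (x + a) - L (Complex (x + a) yy)) - (H yy x - L (Complex x yy)))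
      <= 2 * (e * (a + b)) * a.
  move=> hyy.
  have D t := cderB (dH yy t) (dLx yy t).
  have xa : x <= x + a by rewrite lerDl.
  have := cder_MVT xa D (fun t ht => close _ _ ht hyy).
  by rewrite [x + a - x]addrC addKr.
have vertical xx : x <= xx <= x + a ->
    cmod (Complex 0 1 * (V xx (y + b) - V xx y) - (L (Complex xx (y + b)) - L (Complex xx y)))
      <= 2 * (e * (a + b)) * b.
  move=> hxx.
  have D t := cderB (cderM (cder_cst (Complex 0 1) t) (dV xx t)) (dLy xx t).
  have yb : y <= y + b by rewrite lerDl.
  have c01 : cmod (Complex 0 1 : C) = 1.
    by rewrite /cmod /sqnorm ReC ImC expr0n expr1n add0r sqrtr1.
  have M t : y <= t <= y + b -> cmod (0 * V xx t + Complex 0 1 * f (Complex xx t) -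
      Complex 0 1 * l (Complex xx t)) <= e * (a + b).
    by move=> ht; rewrite mul0r add0r -mulrBr cmodM c01 mul1r close.
  have := cder_MVT yb D M.
  rewrite [y + b - y]addrC addKr.
  by congr (cmod _ <= _); ring.
have -> : boundary x y a b =
  ((H y (x + a) - L (Complex (x + a) y)) - (H y x - L (Complex x y)))
  + (Complex 0 1 * (V (x + a) (y + b) - V (x + a) y) - (L (Complex (x + a) (y + b)) - L (Complex (x + a) y)))
  - ((H (y + b) (x + a) - L (Complex (x + a) (y + b))) - (H (y + b) x - L (Complex x (y + b))))
  - (Complex 0 1 * (V x (y + b) - V x y) - (L (Complex x (y + b)) - L (Complex x y))).
  by rewrite /boundary; ring.
apply: (le_trans (cmodB _ _)).
have hx : x <= x <= x + a by rewrite lexx lerDl.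
have hxa : x <= x + a <= x + a by rewrite lexx lerDl a0.
have hy : y <= y <= y + b by rewrite lexx lerDl.
have hyb : y <= y + b <= y + b by rewrite lexx lerDl b0.
apply: le_trans (_ : 2 * (e * (a + b)) * a + 2 * (e * (a + b)) * b +
  2 * (e * (a + b)) * a + 2 * (e * (a + b)) * b <= _); last first.
  by rewrite le_eqVlt; apply/orP; left; apply/eqP; ring.
apply: lerD; last exact: vertical.
apply: (le_trans (cmodB _ _)); apply: lerD; last exact: horizontal.
apply: (le_trans (cmodD _ _)); apply: lerD; [exact: horizontal|exact: vertical].
Qed.

Let boundary_sequence x y a b : 0 <= a -> 0 <= b -> exists u : nat -> R * R,
  [/\ forall n, (u n).1 <= (u n.+1).1, forall n, (u n).2 <= (u n.+1).2,
     forall n, (u n.+1).1 + a / 2 ^+ n.+1 <= (u n).1 + a / 2 ^+ n,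
     forall n, (u n.+1).2 + b / 2 ^+ n.+1 <= (u n).2 + b / 2 ^+ n &
     forall n, cmod (boundary x y a b) <=
       4 ^+ n * cmod (boundary (u n).1 (u n).2 (a / 2 ^+ n) (b / 2 ^+ n))].
Proof.
move=> a0 b0.
have step n (p : R * R) : exists q : R * R,
    [/\ p.1 <= q.1, p.2 <= q.2, q.1 + a / 2 ^+ n.+1 <= p.1 + a / 2 ^+ n,
      q.2 + b / 2 ^+ n.+1 <= p.2 + b / 2 ^+ n &
      cmod (boundary p.1 p.2 (a / 2 ^+ n) (b / 2 ^+ n)) <=
      4 * cmod (boundary q.1 q.2 (a / 2 ^+ n.+1) (b / 2 ^+ n.+1))].
  have p2 : 0 <= (2 ^+ n : R)^-1 by rewrite invr_ge0 exprn_ge0.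
  have [q] := @boundary_quarter p.1 p.2 _ _ (mulr_ge0 a0 p2) (mulr_ge0 b0 p2).
  by exists q; rewrite !exprSr !invfM !mulrA.
(* The bisection step depends on the level, so the choice function acts on pairs of a level and a
   corner; [u] iterates it. *)
have /choice[nxt Hn] : forall np : nat * (R * R), exists q : R * R,
    [/\ np.2.1 <= q.1, np.2.2 <= q.2, q.1 + a / 2 ^+ np.1.+1 <= np.2.1 + a / 2 ^+ np.1,
      q.2 + b / 2 ^+ np.1.+1 <= np.2.2 + b / 2 ^+ np.1 &
      cmod (boundary np.2.1 np.2.2 (a / 2 ^+ np.1) (b / 2 ^+ np.1)) <=
      4 * cmod (boundary q.1 q.2 (a / 2 ^+ np.1.+1) (b / 2 ^+ np.1.+1))].
  by move=> [n p]; exact: step.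
pose u := fix u n := if n is n'.+1 then nxt (n', u n') else (x, y).
exists u; split => n.
- by have [] := Hn (n, u n).
- by have [] := Hn (n, u n).
- by have [] := Hn (n, u n).
- by have [] := Hn (n, u n).
elim: n => [|n IH]; first by rewrite !expr0 !divr1 mul1r.
apply: (le_trans IH); rewrite exprSr -mulrA ler_wpM2l ?exprn_ge0//.
by have [] := Hn (n, u n).
Qed.

(** The nested rectangles share a point (x0, y0). After [n] bisections the factor 4^n is cancelled
    by the two factors 2^-n, from diameter and perimeter, in [boundary_small]; what remains is an
    arbitrarily small multiple of (a + b)^2. *)
Lemma goursat x y a b : 0 <= a -> 0 <= b ->
  (H y (x + a) - H y x) + Complex 0 1 * (V (x + a) (y + b) - V (x + a) y)
  - (H (y + b) (x + a) - H (y + b) x) - Complex 0 1 * (V x (y + b) - V x y) = 0.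
Proof.
move=> a0 b0; apply: cmod_eq0; apply/eqP; rewrite eq_le cmod_ge0 andbT.
rewrite -/(boundary x y a b).
have [u [u1 u2 v1 v2 uB]] := boundary_sequence x y a0 b0.
have nested (w : nat -> R) (c : R) : 0 <= c -> (forall n, w n <= w n.+1) ->
    (forall n, w n.+1 + c / 2 ^+ n.+1 <= w n + c / 2 ^+ n) ->
    exists w0, forall n, w n <= w0 <= w n + c / 2 ^+ n.
  move=> c0 w1 w2.
  have mw : {homo w : n m / (n <= m)%N >-> n <= m} by apply/nondecreasing_seqP.
  have mv : {homo (fun n => w n + c / 2 ^+ n) : n m / (n <= m)%N >-> m <= n}.
    by apply/nonincreasing_seqP.
  have c2 n : 0 <= c / 2 ^+ n by rewrite divr_ge0// exprn_ge0.
  have ub m n : w n <= w m + c / 2 ^+ m.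
    apply: (le_trans (mw _ _ (leq_maxr m n))).
    apply: le_trans (mv _ _ (leq_maxl m n)).
    by rewrite lerDl.
  have hs : has_sup (range w).
    by split; [exists (w 0), 0|exists (w 0 + c / 2 ^+ 0) => _ [n _ <-]; exact: ub].
  exists (sup (range w)) => n; apply/andP; split.
    by apply: ub_le_sup; [case: hs|exists n].
  by apply: ge_sup; [case: hs|move=> _ [m _ <-]; exact: ub].
have [x0 hx0] := nested (fst \o u) a a0 u1 v1.
have [y0 hy0] := nested (snd \o u) b b0 u2 v2.
have [d Hd] := ef (Complex x0 y0).
apply/ler_addgt0Pl => e e0; rewrite addr0.
(* The [+ 1] keeps the divisor positive for a degenerate rectangle. *)
have K0 : 0 < 4 * ((a + b) * (a + b)) + 1.
  by rewrite ltr_wpDl// !mulr_ge0// addr_ge0.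
have [r r0 Hr] := Hd _ (divr_gt0 e0 K0).
have [n hn] : exists n : nat, (a + b) / 2 ^+ n < r.
  have : (fun n => (a + b) * (2^-1) ^+ n) @ \oo --> ((a + b) * 0 : R).
    by apply: cvgM; [exact: cvg_cst|apply: cvg_expr; rewrite ger0_norm; lra].
  rewrite mulr0 => /cvgrPdist_lt /(_ _ r0) [n _ /(_ n (leqnn n))] h; exists n.
  move: h; rewrite /= sub0r normrN exprVn; exact: le_lt_trans (ler_norm _).
have p0 : 0 < (2 ^+ n : R)^-1 by rewrite invr_gt0 exprn_gt0.
have := @boundary_small (u n).1 (u n).2 d _ r (a / 2 ^+ n) (b / 2 ^+ n) x0 y0
  (mulr_ge0 a0 (ltW p0)) (mulr_ge0 b0 (ltW p0)) (hx0 n) (hy0 n) _ Hr.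
rewrite -mulrDl => /(_ hn) B.
apply: (le_trans (uB n)).
apply: le_trans (_ : 4 ^+ n * (4 * (e / (4 * ((a + b) * (a + b)) + 1) * ((a + b) / 2 ^+ n)
  * ((a + b) / 2 ^+ n))) <= _); first by rewrite ler_wpM2l ?exprn_ge0.
have E : 4 ^+ n * ((2 ^+ n)^-1 * (2 ^+ n)^-1) = 1 :> R.
  by rewrite -invfM -exprMn (_ : 2 * 2 = 4 :> R) ?divff ?expf_neq0//; ring.
rewrite (_ : 4 ^+ n * _ = (4 ^+ n * ((2 ^+ n)^-1 * (2 ^+ n)^-1)) *
  (e / (4 * ((a + b) * (a + b)) + 1) * (4 * ((a + b) * (a + b))))); last by ring.
rewrite E mul1r -[leRHS](@divfK _ (4 * ((a + b) * (a + b)) + 1)) ?gt_eqF//.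
by rewrite ler_wpM2l ?divr_ge0 ?(ltW e0) ?(ltW K0)// lerDl.
Qed.

End Rectangle.
End Goursat.

(** * The mean value property on the unit circle *)

Section MeanValue.
Context (R : realType).
Local Notation C := R[i].

(** Composing with [cexp] turns circles about 0 into vertical segments of length [2 * pi], so
    rectangles suffice. The integral along the segment at real part [- s] does not depend on [s],
    and it tends to [2 * pi * f 0] as the circles shrink. *)
Lemma mean_value_primitive (f : C -> C) : centire f -> exists V : R -> C,
  (forall t : R, cder V t (f (cexp (Complex 0 t)))) /\
  V (2 * pi) - V 0 = ofR (2 * pi) * f 0.
Proof.
move=> ef; have eh : centire (fun z => f (cexp z)) := centire_comp ef (@centire_cexp R).
have pi2 : 0 <= 2 * pi :> R by rewrite mulr_ge0// pi_ge0.
have /choice[H dH] : forall y : R, exists F : R -> C, forall t : R,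
    cder F t (f (cexp (Complex t y))).
  move=> y; have [F dF] := primitive_line (Complex 0 y) 1 eh; exists F => t.
  rewrite (_ : Complex t y = Complex 0 y + ofR t * 1); first exact: dF.
  by apply: complex_ext; rewrite !ReImE; ring.
have /choice[V dV] : forall x : R, exists F : R -> C, forall t : R,
    cder F t (f (cexp (Complex x t))).
  move=> x; have [F dF] := primitive_line (ofR x) (Complex 0 1) eh; exists F => t.
  rewrite (_ : Complex x t = ofR x + ofR t * Complex 0 1); first exact: dF.
  by apply: complex_ext; rewrite !ReImE; ring.
exists (V 0); split; first exact: dV.
(* The horizontal sides cancel since [exp] has period [2 pi i]. *)
have shift s : 0 <= s -> V (- s) (2 * pi) - V (- s) 0 = V 0 (2 * pi) - V 0 0.
  move=> s0; have := goursat eh dH dV (- s) 0 s0 pi2.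
  rewrite addNr add0r.
  have Ns : - s <= 0 by rewrite oppr_le0.
  rewrite (@cder_eq_increment R (H 0) (H (2 * pi)) _ (- s) 0 (dH 0) _ Ns); last first.
    move=> t; have := dH (2 * pi) t; congr (cder _ _ (f _)).
    by rewrite /cexp !ReC !ImC mulr_natl cos2pi sin2pi cos0 sin0.
  move=> h; have /eqP : Complex 0 1 * ((V 0 (2 * pi) - V 0 0) - (V (- s) (2 * pi) - V (- s) 0)) = 0.
    by rewrite -[RHS]h; ring.
  rewrite mulf_eq0 => /orP[|]; first by move=> /eqP [] /eqP; rewrite oner_eq0.
  by rewrite subr_eq0 eq_sym => /eqP.
apply/eqP; rewrite -subr_eq0; apply/eqP/cmod_eq0/eqP.
rewrite eq_le cmod_ge0 andbT.
apply/ler_addgt0Pl => e e0; rewrite addr0.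
have K0 : 0 < 2 * (2 * pi) + 1 :> R by rewrite ltr_wpDl// mulr_ge0.
have [r r0 Hr] := centire_cvg 0 ef (divr_gt0 e0 K0).
have [s s0 sr] : exists2 s : R, 0 <= s & expR (- s) < r.
  exists (Num.max 0 (- ln (r / 2))); first by rewrite le_max lexx.
  apply: le_lt_trans (_ : r / 2 < r); last by rewrite gtr_pMr//; lra.
  have r2 : 0 < r / 2 by rewrite divr_gt0.
  by rewrite -[leRHS]lnK ?posrE// ler_expR lerNl le_max lexx orbT.
rewrite -(shift s s0).
have D t := cderB (dV (- s) t) (cderM (cder_ofR t) (cder_cst (f 0) t)).
have M (t : R) : 0 <= t <= 2 * pi -> cmod (f (cexp (Complex (- s) t)) - (1 * f 0 + ofR t * 0))
    <= e / (2 * (2 * pi) + 1).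
  move=> _; rewrite mul1r mulr0 addr0 -[X in f X]add0r; apply/ltW/Hr.
  by rewrite cmod_cexp ReC.
have := cder_MVT pi2 D M; rewrite ofR0 mul0r !subr0.
rewrite (_ : V (- s) (2 * pi) - _ - _ = V (- s) (2 * pi) - V (- s) 0 - ofR (2 * pi) * f 0); last by ring.
move/le_trans; apply.
rewrite (_ : 2 * _ * _ = e / (2 * (2 * pi) + 1) * (2 * (2 * pi))); last by ring.
rewrite -[leRHS](@divfK _ (2 * (2 * pi) + 1)) ?gt_eqF//.
by rewrite ler_wpM2l ?divr_ge0 ?(ltW e0) ?(ltW K0)// lerDl.
Qed.

(** The indicator turns the interval into the whole line, the setting of [cintegral] and of the
    Fubini lemmas. *)
Lemma mean_value (f : C -> C) : centire f ->
  is_cintegral (@lebesgue_measure R)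
    (fun t => ofR (\1_`[0, 2 * pi] t) * f (cexp (Complex 0 t))) (ofR (2 * pi) * f 0).
Proof.
move=> ef; have [V [dV <-]] := mean_value_primitive ef.
have pi2 : 0 < 2 * pi :> R by rewrite mulr_gt0// pi_gt0.
have component (h W : R -> R) : continuous h -> (forall t : R, is_derive t 1 W (h t)) ->
    (@lebesgue_measure R).-integrable setT (EFin \o (fun t => \1_`[0, 2 * pi] t * h t)) /\
    (\int[@lebesgue_measure R]_t (\1_`[0, 2 * pi] t * h t))%R = W (2 * pi) - W 0.
  move=> ch dW.
  have -> : (fun t => \1_`[0, 2 * pi] t * h t) = h \_ `[0, 2 * pi].
    by rewrite patch_indic; apply/funext => t; rewrite mulrC.
  split.
    have : (@lebesgue_measure R).-integrable `[0, 2 * pi] (EFin \o h).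
      apply: continuous_compact_integrable; first exact: segment_compact.
      exact: continuous_subspaceT.
    rewrite -restrict_EFin; apply: (iffLR (integrable_mkcond _ _)).
    exact: measurable_itv.
  have cW : continuous W.
    move=> t; apply/differentiable_continuous/derivable1_diffP.
    by have [] := dW t.
  have wch : {within `[0, 2 * pi], continuous h} by exact: continuous_subspaceT.
  rewrite -Rintegral_mkcond /Rintegral (@continuous_FTC2 _ h W _ _ pi2 wch) //.
    split=> [t _||]; first by have [] := dW t.
      exact: cvg_at_right_filter (cW _).
    exact: cvg_at_left_filter (cW _).
  by move=> t _; rewrite derive1E; have [_ ->] := dW t.
have cc : continuous (fun t : R => complex.Re (f (cexp (Complex 0 t)))) /\
          continuous (fun t : R => complex.Im (f (cexp (Complex 0 t)))).
  have := continuous_line 0 (Complex 0 1) (centire_comp ef (@centire_cexp R)).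
  have E (t : R) : 0 + ofR t * Complex 0 1 = Complex 0 t.
    by apply: complex_ext; rewrite !ReImE; ring.
  by under eq_fun do rewrite E; under [X in _ /\ continuous X]eq_fun do rewrite E.
have [i1 v1] := component _ _ cc.1 (fun t => (dV t).1).
have [i2 v2] := component _ _ cc.2 (fun t => (dV t).2).
have R1 t : complex.Re (ofR (\1_`[0, 2 * pi] t) * f (cexp (Complex 0 t))) =
    \1_`[0, 2 * pi] t * complex.Re (f (cexp (Complex 0 t))).
  by rewrite !ReImE mul0r subr0.
have I1 t : complex.Im (ofR (\1_`[0, 2 * pi] t) * f (cexp (Complex 0 t))) =
    \1_`[0, 2 * pi] t * complex.Im (f (cexp (Complex 0 t))).
  by rewrite !ReImE mul0r addr0.
split.
  split; [under eq_fun do rewrite R1|under eq_fun do rewrite I1].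
    exact: i1.
  exact: i2.
apply: complex_ext; rewrite /cintegral ?ReC ?ImC.
  by under eq_Rintegral do rewrite R1; rewrite v1 !ReImE.
by under eq_Rintegral do rewrite I1; rewrite v2 !ReImE.
Qed.

End MeanValue.

(** * Complex-valued integrals *)

Section ComplexMeasurable.
Context (R : realType).
Local Notation C := R[i].

Section Operations.
Context (d : measure_display) (T : measurableType d).
Implicit Types (f g : T -> C).

Definition cmeasurable f :=
  measurable_fun setT (fun t => complex.Re (f t)) /\
  measurable_fun setT (fun t => complex.Im (f t)).

Lemma cmeasurable_cst (c : C) : cmeasurable (fun _ => c).
Proof. by split; exact: measurable_cst. Qed.

Lemma cmeasurableD f g : cmeasurable f -> cmeasurable g ->
  cmeasurable (fun t => f t + g t).
Proof.
move=> [f1 f2] [g1 g2]; split.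
  by under eq_fun do rewrite ReD; exact: measurable_funD.
by under eq_fun do rewrite ImD; exact: measurable_funD.
Qed.

Lemma cmeasurableM f g : cmeasurable f -> cmeasurable g ->
  cmeasurable (fun t => f t * g t).
Proof.
move=> [f1 f2] [g1 g2]; split.
  under eq_fun do rewrite ReM.
  by apply: measurable_funB; exact: measurable_funM.
under eq_fun do rewrite ImM.
by apply: measurable_funD; exact: measurable_funM.
Qed.

Lemma cmeasurableN f : cmeasurable f -> cmeasurable (fun t => - f t).
Proof.
move=> mf; under eq_fun do rewrite -mulN1r.
exact: cmeasurableM (cmeasurable_cst _) mf.
Qed.

Lemma cmeasurableB f g : cmeasurable f -> cmeasurable g ->
  cmeasurable (fun t => f t - g t).
Proof. by move=> mf mg; exact: cmeasurableD mf (cmeasurableN mg). Qed.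

Lemma cmeasurable_conj f : cmeasurable f -> cmeasurable (fun t => (f t)^*).
Proof.
move=> [f1 f2]; split; first by under eq_fun do rewrite Re_conj.
by under eq_fun do rewrite Im_conj; exact: measurable_funN.
Qed.

Lemma cmeasurableX f n : cmeasurable f -> cmeasurable (fun t => f t ^+ n).
Proof.
move=> mf; elim: n => [|n IH].
  by under eq_fun do rewrite expr0; exact: cmeasurable_cst.
by under eq_fun do rewrite exprS; exact: cmeasurableM.
Qed.

Lemma cmeasurable_sum n (F : 'I_n -> T -> C) : (forall i, cmeasurable (F i)) ->
  cmeasurable (fun t => \sum_(i < n) F i t).
Proof.
elim: n F => [F _|n IH F mF].
  by under eq_fun do rewrite big_ord0; exact: cmeasurable_cst.
under eq_fun do rewrite big_ord_recr /=.
by apply: cmeasurableD => //; exact: IH.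
Qed.

Lemma cmeasurable_ofR (h : T -> R) : measurable_fun setT h ->
  cmeasurable (fun t => ofR (h t)).
Proof. by move=> mh; split => //; exact: measurable_cst. Qed.

Lemma cmeasurable_cexp f : cmeasurable f -> cmeasurable (fun t => cexp (f t)).
Proof.
move=> [f1 f2]; split; rewrite /cexp.
  under eq_fun do rewrite ReC.
  apply: measurable_funM; first exact: (measurableT_comp (@measurable_expR R)).
  apply: (measurableT_comp (continuous_measurable_fun _)) => //.
  exact: continuous_cos.
under eq_fun do rewrite ImC.
apply: measurable_funM; first exact: (measurableT_comp (@measurable_expR R)).
apply: (measurableT_comp (continuous_measurable_fun _)) => //.
exact: continuous_sin.
Qed.

Lemma measurable_sqnorm f : cmeasurable f ->
  measurable_fun setT (fun t => sqnorm (f t)).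
Proof. by move=> [f1 f2]; apply: measurable_funD; exact: measurable_funX. Qed.

Lemma measurable_cmod f : cmeasurable f ->
  measurable_fun setT (fun t => cmod (f t)).
Proof.
move=> /measurable_sqnorm mf; apply: measurableT_comp => //.
by apply: continuous_measurable_fun; exact: sqrt_continuous.
Qed.

End Operations.

Lemma cmeasurable_comp d1 d2 (T1 : measurableType d1) (T2 : measurableType d2)
  (f : T2 -> C) (phi : T1 -> T2) : cmeasurable f -> measurable_fun setT phi ->
  cmeasurable (fun t => f (phi t)).
Proof. by move=> [f1 f2] mphi; split;
  [exact: (measurableT_comp f1 mphi)|exact: (measurableT_comp f2 mphi)]. Qed.

Lemma cmeasurable_toC : cmeasurable (@toC R).
Proof. by split; [exact: measurable_fst|exact: measurable_snd]. Qed.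

(* Approximate [F s t] by [F (k / (n + 1)) t] where [k] is the integer part of [s * (n + 1)]. *)
Lemma measurable_caratheodory d (T : measurableType d) (F : R -> T -> R) :
  (forall t, continuous (F ^~ t)) -> (forall s, measurable_fun setT (F s)) ->
  measurable_fun setT (fun z : R * T => F z.1 z.2).
Proof.
move=> cF mF.
pose q n (s : R) : R := (Num.floor (s * n.+1%:R))%:~R / n.+1%:R.
apply: (@measurable_fun_cvg _ _ _ _ (fun n (z : R * T) => F (q n z.1) z.2)); last first.
  move=> [s t] _ /=; apply: (@cvg_comp _ _ _ (q ^~ s) (F ^~ t)); last exact: cF.
  apply/cvgrPdist_lt => e e0.
  have [N _ HN] : \forall n \near \oo, (n.+1%:R : R)^-1 < e.
    by apply: near_infty_natSinv_lt (PosNum e0).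
  exists N => // n /HN /=; apply: le_lt_trans.
  have n0 : 0 < n.+1%:R :> R by rewrite ltr0n.
  rewrite /q -{1}(@mulfK _ n.+1%:R _ s) ?gt_eqF// -mulrBl normrM.
  rewrite [X in _ * X]ger0_norm ?invr_ge0 ?ler0n// -[leRHS]mul1r ler_wpM2r ?invr_ge0//.
  by rewrite ger0_norm ?subr_ge0 ?floor_le// lerBlDr addrC -intrD1 ltW// floorD1_gt.
move=> n _ B mB; rewrite setTI.
have -> : (fun z : R * T => F (q n z.1) z.2) @^-1` B =
    \bigcup_(k : int) ([set s : R | Num.floor (s * n.+1%:R) = k] `*`
      (F (k%:~R / n.+1%:R) @^-1` B)).
  apply/seteqP; split => [[s t] /= Bst|[s t] [k _] /= [<-]//].
  by exists (Num.floor (s * n.+1%:R)).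
apply: countable_bigcupT_measurable; first exact: countableP.
move=> k; apply: measurableX; last first.
  by have := mF (k%:~R / n.+1%:R) measurableT B mB; rewrite setTI.
have -> : [set s : R | Num.floor (s * n.+1%:R) = k] =
    (fun s => s * n.+1%:R) @^-1` `[k%:~R, (k + 1)%:~R[%classic.
  apply/seteqP; split => s /=; rewrite in_itv /=.
    by move=> <-; exact: floor_itv.
  exact: floor_def.
rewrite -[X in measurable X]setTI.
have mm : measurable_fun setT (fun s : R => s * n.+1%:R) by exact: measurable_funM.
by apply: mm => //; exact: measurable_itv.
Qed.

End ComplexMeasurable.

Section ComplexIntegral.
Context (R : realType) (d : measure_display) (T : measurableType d).
Context (mu : {measure set T -> \bar R}).
Local Notation C := R[i].
Implicit Types (f g : T -> C) (h k : T -> R).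

Lemma cintegrable_cmeasurable f : cintegrable mu f -> cmeasurable f.
Proof.
by move=> [/measurable_int f1 /measurable_int f2]; split; exact/measurable_EFinP.
Qed.

Lemma le_cintegrable f h : cmeasurable f -> (forall t, cmod (f t) <= h t) ->
  mu.-integrable setT (EFin \o h) -> cintegrable mu f.
Proof.
move=> [f1 f2] fh ih; split; apply: (le_integrable measurableT _ _ ih).
- exact/measurable_EFinP.
- move=> t _ /=; rewrite lee_fin (le_trans (Re_le_cmod _))// (le_trans (fh t))//.
  exact: ler_norm.
- exact/measurable_EFinP.
- move=> t _ /=; rewrite lee_fin (le_trans (Im_le_cmod _))// (le_trans (fh t))//.
  exact: ler_norm.
Qed.

Lemma le_rintegrable h k : measurable_fun setT h -> (forall t, `|h t| <= k t) ->
  mu.-integrable setT (EFin \o k) -> mu.-integrable setT (EFin \o h).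
Proof.
move=> mh hk ik; apply: (le_integrable measurableT _ _ ik).
  exact/measurable_EFinP.
by move=> t _ /=; rewrite lee_fin (le_trans (hk t)) ?ler_norm.
Qed.

Lemma cintegrable_cmod f : cintegrable mu f ->
  mu.-integrable setT (EFin \o (fun t => cmod (f t))).
Proof.
move=> cf; have mf := cintegrable_cmeasurable cf; have [f1 f2] := cf.
have := integrableD measurableT (integrable_norm f1) (integrable_norm f2).
apply: (@le_rintegrable _ (fun t => `|complex.Re (f t)| + `|complex.Im (f t)|)).
  exact: measurable_cmod.
by move=> t; rewrite ger0_norm ?cmod_ge0 ?cmod_le_ReIm.
Qed.

Lemma cintegrableP f : cintegrable mu f <->
  cmeasurable f /\ mu.-integrable setT (EFin \o (fun t => cmod (f t))).
Proof.
split=> [cf|[mf fi]]; last exact: le_cintegrable mf (fun t => lexx _) fi.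
by split; [exact: cintegrable_cmeasurable|exact: cintegrable_cmod].
Qed.

Lemma rintegrableD h k : mu.-integrable setT (EFin \o h) ->
  mu.-integrable setT (EFin \o k) -> mu.-integrable setT (EFin \o (fun t => h t + k t)).
Proof.
move=> ih ik; apply: eq_integrable (integrableD measurableT ih ik) => //.
Qed.

Lemma rintegrableZ h (c : R) : mu.-integrable setT (EFin \o h) ->
  mu.-integrable setT (EFin \o (fun t => c * h t)).
Proof. exact: integrableZl. Qed.

Lemma cintegrableD f g : cintegrable mu f -> cintegrable mu g ->
  cintegrable mu (fun t => f t + g t).
Proof.
move=> [f1 f2] [g1 g2]; split.
  under eq_fun do rewrite ReD.
  exact: rintegrableD.
under eq_fun do rewrite ImD.
exact: rintegrableD.
Qed.

Lemma cintegralD f g : cintegrable mu f -> cintegrable mu g ->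
  cintegral mu (fun t => f t + g t) = cintegral mu f + cintegral mu g.
Proof.
move=> [f1 f2] [g1 g2]; apply: complex_ext; rewrite ?ReD ?ImD /cintegral ?ReC ?ImC.
  under eq_Rintegral do rewrite ReD.
  exact: RintegralD.
under eq_Rintegral do rewrite ImD.
exact: RintegralD.
Qed.

Lemma cintegrableZ (c : C) f : cintegrable mu f -> cintegrable mu (fun t => c * f t).
Proof.
move=> /cintegrableP[mf fi]; apply: (@le_cintegrable _ (fun t => cmod c * cmod (f t))).
- by apply: cmeasurableM => //; exact: cmeasurable_cst.
- by move=> t; rewrite cmodM.
- exact: rintegrableZ.
Qed.

Lemma cintegralZ (c : C) f : cintegrable mu f ->
  cintegral mu (fun t => c * f t) = c * cintegral mu f.
Proof.
move=> [f1 f2]; apply: complex_ext; rewrite ?ReM ?ImM /cintegral ?ReC ?ImC.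
  under eq_Rintegral do rewrite ReM.
  rewrite RintegralB//; [|exact: rintegrableZ|exact: rintegrableZ].
  by rewrite !RintegralZl.
under eq_Rintegral do rewrite ImM.
rewrite RintegralD//; [|exact: rintegrableZ|exact: rintegrableZ].
by rewrite !RintegralZl.
Qed.

Lemma cintegrableN f : cintegrable mu f -> cintegrable mu (fun t => - f t).
Proof. by under [in X in _ -> X]eq_fun do rewrite -mulN1r; exact: cintegrableZ. Qed.

Lemma cintegrableB f g : cintegrable mu f -> cintegrable mu g ->
  cintegrable mu (fun t => f t - g t).
Proof. by move=> cf cg; exact: cintegrableD cf (cintegrableN cg). Qed.

Lemma cintegralB f g : cintegrable mu f -> cintegrable mu g ->
  cintegral mu (fun t => f t - g t) = cintegral mu f - cintegral mu g.
Proof.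
move=> cf cg; rewrite (cintegralD cf (cintegrableN cg)) -mulN1r -cintegralZ//.
by under [in X in _ = _ + X]eq_fun do rewrite mulN1r.
Qed.

Lemma cintegrable0 : cintegrable mu (fun _ => 0).
Proof. by split; exact: integrable0. Qed.

Lemma cintegrable_sum n (F : 'I_n -> T -> C) : (forall i, cintegrable mu (F i)) ->
  cintegrable mu (fun t => \sum_(i < n) F i t).
Proof.
elim: n F => [F _|n IH F cF].
  by under eq_fun do rewrite big_ord0; exact: cintegrable0.
under eq_fun do rewrite big_ord_recr /=.
by apply: cintegrableD => //; exact: IH.
Qed.

Lemma cintegral_sum n (F : 'I_n -> T -> C) : (forall i, cintegrable mu (F i)) ->
  cintegral mu (fun t => \sum_(i < n) F i t) = \sum_(i < n) cintegral mu (F i).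
Proof.
elim: n F => [F _|n IH F cF].
  under eq_fun do rewrite big_ord0.
  by rewrite big_ord0 /cintegral /= /Rintegral integral0.
under eq_fun do rewrite big_ord_recr /=.
by rewrite cintegralD ?IH ?big_ord_recr//; exact: cintegrable_sum.
Qed.

Lemma cintegrable_conj f : cintegrable mu f -> cintegrable mu (fun t => (f t)^*).
Proof.
move=> /cintegrableP[mf fi]; apply/cintegrableP; split; first exact: cmeasurable_conj.
by under eq_fun do rewrite cmod_conj.
Qed.

Lemma cintegral_conj f : cintegrable mu f ->
  cintegral mu (fun t => (f t)^*) = (cintegral mu f)^*.
Proof.
move=> [f1 f2]; apply: complex_ext; rewrite ?Re_conj ?Im_conj /cintegral ?ReC ?ImC.
  by under eq_Rintegral do rewrite Re_conj.
under eq_Rintegral do rewrite Im_conj -mulN1r.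
by rewrite RintegralZl// mulN1r.
Qed.

Lemma le_rintegral h k : mu.-integrable setT (EFin \o h) -> mu.-integrable setT (EFin \o k) ->
  (forall t, h t <= k t) -> (\int[mu]_t h t <= \int[mu]_t k t)%R.
Proof. by move=> ih ik hk; apply: le_Rintegral => // t _; exact: hk. Qed.

(** Real and imaginary parts are bounded separately, whence the 2; only finiteness and limits are
    drawn from this estimate. *)
Lemma cmod_cintegral_le f h : cintegrable mu f -> (forall t, cmod (f t) <= h t) ->
  mu.-integrable setT (EFin \o h) ->
  cmod (cintegral mu f) <= 2 * (\int[mu]_t h t)%R.
Proof.
move=> [f1 f2] fh ih; apply: (le_trans (cmod_le_ReIm _)).
rewrite mulr_natl mulr2n; apply: lerD.
  apply: (le_trans (le_normr_Rintegral measurableT f1)).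
  apply: le_rintegral => //; first exact: integrable_norm.
  by move=> t; exact: le_trans (Re_le_cmod _) (fh t).
apply: (le_trans (le_normr_Rintegral measurableT f2)).
apply: le_rintegral => //; first exact: integrable_norm.
by move=> t; exact: le_trans (Im_le_cmod _) (fh t).
Qed.

(* The limit is stated through [cmod] so that it can be combined with real estimates. *)
Lemma cdominated_cvg (F : nat -> T -> C) f h : (forall n, cmeasurable (F n)) ->
  (forall t, (fun n => cmod (F n t - f t)) @ \oo --> (0 : R)) ->
  (forall n t, cmod (F n t) <= h t) -> mu.-integrable setT (EFin \o h) ->
  cintegrable mu f /\
  (fun n => cmod (cintegral mu (F n) - cintegral mu f)) @ \oo --> (0 : R).
Proof.
move=> mF Ff Fh ih.
have rF t : (fun n => complex.Re (F n t)) @ \oo --> complex.Re (f t).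
  apply/cvgrPdist_lt => e e0; move/cvgrPdist_lt: (Ff t) => /(_ e e0).
  apply: filterS => n; rewrite sub0r normrN ger0_norm ?cmod_ge0//; apply: le_lt_trans.
  by rewrite -ReN -ReD cmod_distC Re_le_cmod.
have iF t : (fun n => complex.Im (F n t)) @ \oo --> complex.Im (f t).
  apply/cvgrPdist_lt => e e0; move/cvgrPdist_lt: (Ff t) => /(_ e e0).
  apply: filterS => n; rewrite sub0r normrN ger0_norm ?cmod_ge0//; apply: le_lt_trans.
  by rewrite -ImN -ImD cmod_distC Im_le_cmod.
have dct (G : nat -> T -> R) (g : T -> R) : (forall n, measurable_fun setT (G n)) ->
    (forall t, G ^~ t @ \oo --> g t) -> (forall n t, `|G n t| <= h t) ->
    mu.-integrable setT (EFin \o g) /\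
    (fun n => \int[mu]_t G n t)%R @ \oo --> (\int[mu]_t g t)%R.
  move=> mG Gg Gh.
  have mg : measurable_fun setT g by apply: (measurable_fun_cvg mG) => t _; exact: Gg.
  have mGE n : measurable_fun setT (EFin \o G n) by exact/measurable_EFinP.
  have mgE : measurable_fun setT (EFin \o g) by exact/measurable_EFinP.
  have cE : {ae mu, forall t, setT t -> (fun n => (G n t)%:E) @ \oo --> (g t)%:E}.
    by apply: aeW => t _; apply: cvg_EFin; [exact: nearW|exact: Gg].
  have bE : {ae mu, forall t n, setT t -> (`|(G n t)%:E| <= (h t)%:E)%E}.
    by apply: aeW => t n _; rewrite lee_fin.
  have [i1 _ i2] := dominated_convergence measurableT mGE mgE cE ih bE.
  split=> //; apply: fine_cvg.
  by rewrite /Rintegral fineK//; exact: integrable_fin_num.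
have [ir cr] := dct _ _ (fun n => (mF n).1) rF
  (fun n t => le_trans (Re_le_cmod _) (Fh n t)).
have [ii ci] := dct _ _ (fun n => (mF n).2) iF
  (fun n t => le_trans (Im_le_cmod _) (Fh n t)).
split=> //; apply: (@squeeze_cvgr _ _ _ _ (cst 0) (fun n =>
   `|(\int[mu]_t complex.Re (F n t) - \int[mu]_t complex.Re (f t))%R| +
   `|(\int[mu]_t complex.Im (F n t) - \int[mu]_t complex.Im (f t))%R|)).
- by apply: nearW => n; rewrite cmod_ge0 /=; exact: le_trans (cmod_le_ReIm _) _.
- exact: cvg_cst.
- rewrite -[X in _ --> X](addr0 0); apply: cvgD.
    by apply/norm_cvg0P/subr_cvg0.
  by apply/norm_cvg0P/subr_cvg0.
Qed.

End ComplexIntegral.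

(** * Fubini and Tonelli for complex integrands *)

Section ComplexFubini.
Context (R : realType) (d1 d2 : measure_display).
Context (T1 : measurableType d1) (T2 : measurableType d2).
Context (m1 : {sigma_finite_measure set T1 -> \bar R}).
Context (m2 : {sigma_finite_measure set T2 -> \bar R}).
Local Notation C := R[i].

(** The inner integral in Fubini's theorem is extended-real and finite only almost everywhere,
    whereas [cintegral] applies [fine] to it at every point. The two readings have the same
    integral. *)
Lemma integrable_fine d (T : measurableType d) (m : {measure set T -> \bar R})
    (F : T -> \bar R) : m.-integrable setT F ->
  m.-integrable setT (EFin \o (fun t => fine (F t))) /\
  (\int[m]_t fine (F t))%R = fine (\int[m]_t F t)%E.
Proof.
move=> iF; have mF := measurable_int m iF.
have mfF : measurable_fun setT (EFin \o (fun t => fine (F t))).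
  by apply/measurable_EFinP; apply: measurableT_comp => //; exact: measurable_fine.
split.
  apply: (le_integrable measurableT mfF _ iF) => t _ /=.
  by case: (F t) => [r| |] //=; rewrite normr0 leey.
congr fine; apply: ae_eq_integral => //.
have := integrable_ae measurableT iF; apply: filterS => t /(_ I) Ft _ /=.
by rewrite fineK.
Qed.

Lemma cFubini1 (f : T1 * T2 -> C) : cintegrable (m1 \x m2)%E f ->
  [/\ {ae m1, forall x, cintegrable m2 (fun y => f (x, y))},
     cintegrable m1 (fun x => cintegral m2 (fun y => f (x, y))) &
     cintegral m1 (fun x => cintegral m2 (fun y => f (x, y))) =
     cintegral (m1 \x m2)%E f].
Proof.
move=> [f1 f2].
have [i1 e1] := integrable_fine (integrable_fubini_F f1).
have [i2 e2] := integrable_fine (integrable_fubini_F f2).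
split.
- have a1 := ae_integrable1 f1; have a2 := ae_integrable1 f2.
  by apply: filterS2 a1 a2 => x h1 h2; split.
- by split; [exact: i1|exact: i2].
apply: complex_ext; rewrite /cintegral ?ReC ?ImC.
  by rewrite [RHS]/Rintegral -(integral12_prod_meas1 f1) -e1.
by rewrite [RHS]/Rintegral -(integral12_prod_meas1 f2) -e2.
Qed.

Let integrable_fubini_G (f : T1 * T2 -> \bar R) : (m1 \x m2)%E.-integrable setT f ->
  m2.-integrable setT (fubini_G m1 f).
Proof.
move=> fi; have mf := measurable_int _ fi.
apply/integrableP; split; first exact: (measurable_fubini_G fi).
apply: le_lt_trans ((integrable21ltyP m1 m2 mf).1 fi); apply: ge0_le_integral => //.
- by apply: measurableT_comp => //; exact: (measurable_fubini_G fi).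
- apply: (@measurable_fun_fubini_tonelli_G _ _ _ _ _ m1 (fun z => `|f z|%E)) => //.
  exact: measurableT_comp.
- move=> y _; apply: le_abse_integral => //.
  exact: (measurableT_comp mf).
Qed.

Lemma cFubini2 (f : T1 * T2 -> C) : cintegrable (m1 \x m2)%E f ->
  [/\ {ae m2, forall y, cintegrable m1 (fun x => f (x, y))},
     cintegrable m2 (fun y => cintegral m1 (fun x => f (x, y))) &
     cintegral m2 (fun y => cintegral m1 (fun x => f (x, y))) =
     cintegral (m1 \x m2)%E f].
Proof.
move=> [f1 f2].
have [i1 e1] := integrable_fine (integrable_fubini_G f1).
have [i2 e2] := integrable_fine (integrable_fubini_G f2).
split.
- have a1 := ae_integrable2 f1; have a2 := ae_integrable2 f2.
  by apply: filterS2 a1 a2 => x h1 h2; split.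
- by split; [exact: i1|exact: i2].
apply: complex_ext; rewrite /cintegral ?ReC ?ImC.
  by rewrite [RHS]/Rintegral -(integral21_prod_meas1 f1) -e1.
by rewrite [RHS]/Rintegral -(integral21_prod_meas1 f2) -e2.
Qed.

(** A criterion by majorant: at each use only an integrable bound on the inner integrals has to be
    supplied. *)
Lemma integrable_tonelli1 (h : T1 * T2 -> R) (k : T1 -> R) :
  measurable_fun setT h -> (forall z, 0 <= h z) ->
  (forall x, (\int[m2]_y (h (x, y))%:E <= (k x)%:E)%E) ->
  m1.-integrable setT (EFin \o k) -> (m1 \x m2)%E.-integrable setT (EFin \o h).
Proof.
move=> mh h0 hk ik; apply/integrable12ltyP; first exact/measurable_EFinP.
have k0 x : 0 <= k x.
  by rewrite -lee_fin; apply: le_trans (hk x); apply: integral_ge0 => y _; rewrite lee_fin.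
have /integrableP[mk] := ik; apply: le_lt_trans.
have mh' : measurable_fun setT (fun x => \int[m2]_y `|(h (x, y))%:E|)%E.
  apply: (@measurable_fun_fubini_tonelli_F _ _ _ _ _ m2 (fun z => `|(h z)%:E|%E)) => //.
  by apply: measurableT_comp => //; exact/measurable_EFinP.
apply: ge0_le_integral => //.
- by move=> x _; apply: integral_ge0.
- exact: measurableT_comp.
- move=> x _; rewrite /= ger0_norm//.
  by under eq_integral do rewrite ger0_norm//.
Qed.

Lemma integrable_tonelli2 (h : T1 * T2 -> R) (k : T2 -> R) :
  measurable_fun setT h -> (forall z, 0 <= h z) ->
  (forall y, (\int[m1]_x (h (x, y))%:E <= (k y)%:E)%E) ->
  m2.-integrable setT (EFin \o k) -> (m1 \x m2)%E.-integrable setT (EFin \o h).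
Proof.
move=> mh h0 hk ik; apply/integrable21ltyP; first exact/measurable_EFinP.
have k0 x : 0 <= k x.
  by rewrite -lee_fin; apply: le_trans (hk x); apply: integral_ge0 => y _; rewrite lee_fin.
have /integrableP[mk] := ik; apply: le_lt_trans.
have mh' : measurable_fun setT (fun y => \int[m1]_x `|(h (x, y))%:E|)%E.
  apply: (@measurable_fun_fubini_tonelli_G _ _ _ _ _ m1 (fun z => `|(h z)%:E|%E)) => //.
  by apply: measurableT_comp => //; exact/measurable_EFinP.
apply: ge0_le_integral => //.
- by move=> x _; apply: integral_ge0.
- exact: measurableT_comp.
- move=> x _; rewrite /= ger0_norm//.
  by under eq_integral do rewrite ger0_norm//.
Qed.

Lemma integrable_prodM (h : T1 -> R) (k : T2 -> R) :
  m1.-integrable setT (EFin \o h) -> m2.-integrable setT (EFin \o k) ->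
  (m1 \x m2)%E.-integrable setT (EFin \o (fun z => h z.1 * k z.2)) /\
  (\int[(m1 \x m2)%E]_z (h z.1 * k z.2) = (\int[m1]_x h x) * (\int[m2]_y k y))%R.
Proof.
move=> ih ik.
have mh : measurable_fun setT h by apply/measurable_EFinP; exact: measurable_int ih.
have mk : measurable_fun setT k by apply/measurable_EFinP; exact: measurable_int ik.
have mhk : measurable_fun setT (fun z : T1 * T2 => h z.1 * k z.2).
  by apply: measurable_funM; [exact: (measurableT_comp mh)|exact: (measurableT_comp mk)].
have iN := integrable_norm ik.
have i : (m1 \x m2)%E.-integrable setT (EFin \o (fun z => h z.1 * k z.2)).
  apply: (@le_rintegrable _ _ _ _ _ (fun z => `|h z.1| * `|k z.2|)) => //.
    by move=> z; rewrite normrM.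
  apply: (@integrable_tonelli1 _ (fun x => (\int[m2]_y `|k y|)%R * `|h x|)).
  - apply: measurable_funM.
      by apply: (@measurableT_comp _ _ _ _ _ _ (@Num.norm R R)) => //;
        exact: (measurableT_comp mh measurable_fst).
    by apply: (@measurableT_comp _ _ _ _ _ _ (@Num.norm R R)) => //;
      exact: (measurableT_comp mk measurable_snd).
  - by move=> z; rewrite mulr_ge0.
  - move=> x /=; under eq_integral do rewrite EFinM.
    rewrite (integralZl measurableT iN) EFinM muleC /Rintegral fineK//.
    exact: integrable_fin_num.
  - by apply: rintegrableZ; exact: integrable_norm.
split=> //.
have [_ ] := integrable_fine (integrable_fubini_F i).
rewrite (integral12_prod_meas1 i) -/(Rintegral _ _ _) => <-.
transitivity (\int[m1]_x ((\int[m2]_y k y)%R * h x))%R.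
  apply: eq_Rintegral => x _; rewrite /fubini_F /= mulrC.
  by rewrite -RintegralZl.
by rewrite RintegralZl// mulrC.
Qed.

End ComplexFubini.

(** * Measure-preserving changes of variables *)

Section MeasurePreserving.
Context (R : realType) (d : measure_display) (T : measurableType d).
Context (mu : {measure set T -> \bar R}).
Local Notation C := R[i].

Definition measure_preserving (phi : T -> T) :=
  measurable_fun setT phi /\ forall A, measurable A -> mu (phi @^-1` A) = mu A.

Lemma measure_preserving_comp (phi psi : T -> T) : measure_preserving phi ->
  measure_preserving psi -> measure_preserving (phi \o psi).
Proof.
move=> [m1 p1] [m2 p2]; split; first exact: measurableT_comp.
move=> A mA; rewrite comp_preimage p2 ?p1//.
by have := m1 measurableT A mA; rewrite setTI.
Qed.

Lemma integrable_preserving (phi : T -> T) (h : T -> R) : measure_preserving phi ->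
  mu.-integrable setT (EFin \o h) ->
  mu.-integrable setT (EFin \o (h \o phi)) /\
  (\int[mu]_t h (phi t) = \int[mu]_t h t)%R.
Proof.
move=> [mphi pphi] ih.
have mh := measurable_int _ ih.
have E (f : T -> \bar R) : (\int[pushforward mu phi]_t f t = \int[mu]_t f t)%E.
  by apply: eq_measure_integral => A mA _; exact: pphi.
have i : mu.-integrable setT (EFin \o (h \o phi)).
  apply/integrableP; split; first exact: (measurableT_comp mh mphi).
  have mah : measurable_fun setT (fun t => `|(h t)%:E|%E) by exact: measurableT_comp.
  have := ge0_integral_pushforward mphi mu measurableT mah (fun y _ => abse_ge0 _).
  rewrite E preimage_setT => /= <-.
  by have /integrableP[] := ih.
split=> //; rewrite /Rintegral; congr fine.
have := @integral_pushforward _ _ _ _ R phi mphi mu setT (EFin \o h) mh.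
by rewrite preimage_setT E => /(_ i measurableT) ->.
Qed.

Lemma cintegral_preserving (phi : T -> T) (f : T -> C) : measure_preserving phi ->
  cintegrable mu f -> cintegrable mu (fun t => f (phi t)) /\
  cintegral mu (fun t => f (phi t)) = cintegral mu f.
Proof.
move=> p [f1 f2].
have [i1 e1] := integrable_preserving p f1; have [i2 e2] := integrable_preserving p f2.
by split; [split; [exact: i1|exact: i2]|rewrite /cintegral e1 e2].
Qed.

End MeasurePreserving.

(** * Lebesgue measure on the plane: translations, rotations, Gaussians *)

Section Plane.
Context (R : realType).
Local Notation C := R[i].
Local Notation leb := (@lebesgue_measure R).
Local Notation leb1 := (@leb1 R).

Section Translate.
Context (a : R).
Let t (x : measurableTypeR R) : measurableTypeR R := x + a.
Let mt : measurable_fun setT t. Proof. exact: measurable_funD. Qed.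

(** Lebesgue measure is determined by its values on half-open intervals, and there the pushforward
    by a translation agrees with it. *)
Lemma lebesgue_measure_translate (A : set R) : measurable A ->
  leb ((fun x => x + a) @^-1` A) = leb A.
Proof.
move=> mA; apply/esym.
apply: (@lebesgue_measure_unique R
  (measure_function_pushforward__canonical__measure_function_Measure leb mt)) => //.
move=> _ [[b c]] _ <-.
rewrite /= /pushforward.
have -> : t @^-1` `]b, c]%classic = `]b - a, c - a]%classic.
  by apply/seteqP; split => x /=; rewrite /t !in_itv /= ltrBlDr lerBrDr.
rewrite !lebesgue_measure_itv /= !lte_fin ltrD2r; case: ifP => // _.
by rewrite -!EFinD; congr EFin; ring.
Qed.

End Translate.

Let leb1_1E (A : set (R * R)) : measurable A ->
  leb1 A = (\int[leb]_x leb (xsection A x))%E.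
Proof. by []. Qed.

Let leb1_2E (A : set (R * R)) : measurable A ->
  leb1 A = (\int[leb]_y leb (ysection A y))%E.
Proof.
move=> mA; transitivity ((leb \x^ leb)%E A) => //.
apply: product_measure_unique => // B D mB mD.
exact: product_measure2E.
Qed.

(** Each section of the preimage is a translate of a section of [A]. Constant [h] gives the
    translations and linear [h] the rotations, so that no determinant formula is involved. *)
Lemma shear1_preserving (h : R -> R) : measurable_fun setT h ->
  measure_preserving leb1 (fun z => (z.1 + h z.2, z.2)).
Proof.
move=> mh.
have mphi : measurable_fun setT (fun z : R * R => (z.1 + h z.2, z.2)).
  apply: measurable_fun_pair; last exact: measurable_snd.
  by apply: measurable_funD; [exact: measurable_fst|exact: (measurableT_comp mh measurable_snd)].
split=> // A mA.
have mA' : measurable ((fun z : R * R => (z.1 + h z.2, z.2)) @^-1` A).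
  by rewrite -[X in measurable X]setTI; exact: mphi.
apply: etrans (leb1_2E mA') _; apply: etrans _ (esym (leb1_2E mA)).
apply: eq_integral => y _.
apply: etrans _ (lebesgue_measure_translate (h y) (measurable_ysection y mA)).
by congr (leb _); apply/seteqP; split => x; rewrite /ysection /= ?inE.
Qed.

Lemma shear2_preserving (h : R -> R) : measurable_fun setT h ->
  measure_preserving leb1 (fun z => (z.1, z.2 + h z.1)).
Proof.
move=> mh.
have mphi : measurable_fun setT (fun z : R * R => (z.1, z.2 + h z.1)).
  apply: measurable_fun_pair; first exact: measurable_fst.
  by apply: measurable_funD; [exact: measurable_snd|exact: (measurableT_comp mh measurable_fst)].
split=> // A mA.
have mA' : measurable ((fun z : R * R => (z.1, z.2 + h z.1)) @^-1` A).
  by rewrite -[X in measurable X]setTI; exact: mphi.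
apply: etrans (leb1_1E mA') _; apply: etrans _ (esym (leb1_1E mA)).
apply: eq_integral => x _.
apply: etrans _ (lebesgue_measure_translate (h x) (measurable_xsection x mA)).
by congr (leb _); apply/seteqP; split => y; rewrite /xsection /= ?inE.
Qed.

Lemma translate_preserving (a b : R) :
  measure_preserving leb1 (fun z => (z.1 + a, z.2 + b)).
Proof.
have h := measure_preserving_comp (shear1_preserving (@measurable_cst _ _ _ _ setT a))
  (shear2_preserving (@measurable_cst _ _ _ _ setT b)).
exact: h.
Qed.

(* A rotation other than [-1] is a product of three shears. *)
Let rotate_shears (c s : R) : c ^+ 2 + s ^+ 2 = 1 -> 1 + c != 0 ->
  measure_preserving leb1 (fun z => (c * z.1 - s * z.2, s * z.1 + c * z.2)).
Proof.
move=> cs c1.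
have ms (r : R) : measurable_fun setT (fun x : R => r * x) by exact: measurable_funM.
(* For the angle theta the slopes are - tan (theta/2), sin theta and - tan (theta/2), with tan
   (theta/2) = s / (1 + c). *)
have h := measure_preserving_comp (shear1_preserving (ms (- (s / (1 + c)))))
  (measure_preserving_comp (shear2_preserving (ms s)) (shear1_preserving (ms (- (s / (1 + c)))))).
rewrite (_ : (fun z => _) = (fun z : R * R => (z.1 + - (s / (1 + c)) * z.2, z.2)) \o
  ((fun z : R * R => (z.1, z.2 + s * z.1)) \o
   (fun z : R * R => (z.1 + - (s / (1 + c)) * z.2, z.2)))); first exact: h.
have E : s * s = (1 - c) * (1 + c) by rewrite -expr2; lra.
have E2 : s / (1 + c) * s = 1 - c by rewrite mulrAC E mulfK.
apply/funext => -[x y] /=; congr pair.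
  rewrite [RHS](_ : _ = (1 - s / (1 + c) * s) * x -
    (2 - s / (1 + c) * s) * (s / (1 + c)) * y); last by ring.
  have E3 : (1 + c) * (s / (1 + c)) = s by rewrite mulrCA divff// mulr1.
  by rewrite E2 (_ : 2 - (1 - c) = 1 + c); [rewrite E3; ring|ring].
rewrite [RHS](_ : _ = (1 - s / (1 + c) * s) * y + s * x); last by ring.
by rewrite E2; ring.
Qed.

(** The half turn, for which 1 + c = 0, is the square of a quarter turn. *)
Lemma rotate_preserving (c s : R) : c ^+ 2 + s ^+ 2 = 1 ->
  measure_preserving leb1 (fun z => (c * z.1 - s * z.2, s * z.1 + c * z.2)).
Proof.
move=> cs; have [c1|] := eqVneq (1 + c) 0; last exact: rotate_shears.
have quarter : measure_preserving leb1 (fun z => (0 * z.1 - 1 * z.2, 1 * z.1 + 0 * z.2)).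
  by apply: rotate_shears; rewrite ?addr0 ?oner_neq0//; lra.
have -> : c = -1 by lra.
have -> : s = 0 by apply/eqP; rewrite -sqrf_eq0; apply/eqP; rewrite (_ : c = -1) in cs; lra.
have h := measure_preserving_comp quarter quarter.
rewrite (_ : (fun z => _) = (fun z : R * R => (0 * z.1 - 1 * z.2, 1 * z.1 + 0 * z.2)) \o
  (fun z : R * R => (0 * z.1 - 1 * z.2, 1 * z.1 + 0 * z.2))); first exact: h.
by apply/funext => -[x y] /=; congr pair; ring.
Qed.

Lemma cintegral_translate (f : R * R -> C) (a : C) : cintegrable leb1 f ->
  cintegrable leb1 (fun z => f (z.1 + complex.Re a, z.2 + complex.Im a)) /\
  cintegral leb1 (fun z => f (z.1 + complex.Re a, z.2 + complex.Im a)) = cintegral leb1 f.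
Proof. by move=> cf; exact: cintegral_preserving (translate_preserving _ _) cf. Qed.

Lemma integrable_translate (f : R * R -> R) (a : C) : leb1.-integrable setT (EFin \o f) ->
  leb1.-integrable setT (EFin \o (fun z => f (z.1 + complex.Re a, z.2 + complex.Im a))) /\
  (\int[leb1]_z f (z.1 + complex.Re a, z.2 + complex.Im a) = \int[leb1]_z f z)%R.
Proof. by move=> cf; exact: integrable_preserving (translate_preserving _ _) cf. Qed.

Lemma integral_gauss_line (k : R) : 0 < k ->
  leb.-integrable setT (EFin \o (fun x => expR (- (k * x ^+ 2)))) /\
  (\int[leb]_x expR (- (k * x ^+ 2)) = Num.sqrt (pi / k))%R.
Proof.
move=> k0; pose s := Num.sqrt ((2 * k)^-1).
have s2 : s ^+ 2 = (2 * k)^-1 by rewrite sqr_sqrtr// invr_ge0 mulr_ge0// ltW.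
have s0 : s != 0 by rewrite -sqrf_eq0 s2 invr_eq0 mulf_neq0 ?gt_eqF.
have E x : expR (- (k * x ^+ 2)) = (normal_peak s)^-1 * normal_pdf 0 s x.
  rewrite normal_pdfE// mulrA mulVf ?gt_eqF ?normal_peak_gt0// mul1r /normal_fun subr0 s2.
  by congr expR; field; rewrite gt_eqF.
have i := integrable_normal_pdf (0 : R) s.
split.
  rewrite (_ : (fun x => _) = (fun x => (normal_peak s)^-1 * normal_pdf 0 s x)); last first.
    by apply/funext => x; exact: E.
  exact: rintegrableZ.
under eq_Rintegral do rewrite E.
rewrite RintegralZl// /Rintegral integral_normal_pdf mulr1 /normal_peak invrK s2.
by congr Num.sqrt; field; rewrite gt_eqF.
Qed.

(** The Gaussian probability density on the plane. [k = 1] is the weight of one degree of freedom;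
    large [k] gives an approximate identity. *)
Definition gauss1 (k : R) (z : R * R) : R := k / pi * expR (- (k * sqnorm (toC z))).

Lemma gauss1_ge0 k z : 0 <= k -> 0 <= gauss1 k z.
Proof. by move=> k0; rewrite /gauss1 mulr_ge0 ?expR_ge0// divr_ge0// pi_ge0. Qed.

Lemma integral_gauss_plane (k : R) : 0 < k ->
  leb1.-integrable setT (EFin \o gauss1 k) /\ (\int[leb1]_z gauss1 k z = 1)%R.
Proof.
move=> k0; have [i e] := integral_gauss_line k0.
have [i2 e2] := integrable_prodM i i.
have E z : gauss1 k z = k / pi * (expR (- (k * z.1 ^+ 2)) * expR (- (k * z.2 ^+ 2))).
  by rewrite /gauss1 -expRD; congr (_ * expR _); rewrite /sqnorm /toC ReC ImC; ring.
have -> : gauss1 k = (fun z => k / pi * (expR (- (k * z.1 ^+ 2)) * expR (- (k * z.2 ^+ 2)))).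
  by apply/funext => z; exact: E.
split; first exact: rintegrableZ.
rewrite RintegralZl// [X in _ * X](_ : _ = pi / k).
  by rewrite mulrA divfK ?gt_eqF ?pi_gt0// divff ?gt_eqF.
apply: etrans e2 _; rewrite e -expr2 sqr_sqrtr// divr_ge0 ?pi_ge0 ?ltW//.
Qed.

Let integral_oneDV2 : (\int[leb]_(x in `[0%R, +oo[) ((1 + x) ^- 2)%:E = 1)%E.
Proof.
have p x : 0 <= x -> 0 < 1 + x :> R by move=> x0; lra.
have c1 (x : R) : 0 <= x -> {for x, continuous (fun x : R => (1 + x)^-1)}.
  move=> x0; apply: cvgV; first by rewrite gt_eqF// p.
  by apply: cvgD; [exact: cvg_cst|exact: cvg_id].
have d1 (x : R) : 0 <= x -> is_derive x 1 (fun x : R => - (1 + x)^-1) ((1 + x) ^- 2).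
  move=> x0; have dx : is_derive x 1 (fun x : R => 1 + x) (1 : R).
    by have := is_deriveD (is_derive_cst (1 : R) x (1 : R)) (is_derive_id x (1 : R)); rewrite add0r.
  have n0 : 1 + x != 0 by rewrite gt_eqF// p.
  have := is_deriveN (@is_deriveV R (fun x : R => 1 + x) x 1 1 n0 dx).
  by move=> h; apply: is_derive_eq h _; rewrite /GRing.scale /= mulr1 opprK.
rewrite (@ge0_continuous_FTC2y R (fun x => (1 + x) ^- 2) (fun x => - (1 + x)^-1) 0 0).
- by rewrite addr0 invr1 -EFinD opprK add0r.
- by move=> x x0; rewrite invr_ge0 sqr_ge0.
- have : {in `[0, +oo[%classic, continuous (fun x : R => (1 + x)^- 2)}.
    move=> x; rewrite inE /= in_itv /= andbT => x0.
    rewrite (_ : (fun x => _) = (fun x : R => (1 + x)^-1) \* (fun x : R => (1 + x)^-1)).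
      by apply: cvgM; exact: c1.
    by apply/funext => y /=; rewrite expr2 invfM.
  by move=> h; apply: continuous_in_subspaceT.
- rewrite -oppr0; apply: cvgN; apply/gtr0_cvgV0.
    by near=> x; apply: p; near: x; exact: nbhs_pinfty_ge.
  by apply: cvg_addrl; exact: cvg_id.
- by move=> x x0; have [] := d1 x (ltW x0).
- by apply: cvgN; apply: cvg_at_right_filter; exact: c1.
- move=> x; rewrite in_itv /= andbT => x0; rewrite derive1E.
  by have [_ ->] := d1 x (ltW x0).
Unshelve. all: by end_near. Qed.

Let measurable_oneDV2 (c : R) :
  measurable_fun ([set` `[0, +oo[] : set R) (fun x : R => c * (1 + x) ^- 2).
Proof.
have cf : continuous (fun x : R => c * (1 + `|x|) ^- 2).
  move=> x; apply: cvgM; first exact: cvg_cst.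
  apply: cvgV; first by rewrite expf_neq0// gt_eqF// ltr_pwDl.
  apply: (@continuous_comp _ _ _ (fun x : R => 1 + `|x|) (fun y => y ^+ 2)); last exact: exprn_continuous.
  by apply: cvgD; [exact: cvg_cst|exact: norm_continuous].
have := measurable_funS measurableT (@subsetT _ ([set` `[0, +oo[] : set R)) (continuous_measurable_fun cf).
apply: eq_measurable_fun => x; rewrite inE /= in_itv /= andbT => x0.
by rewrite ger0_norm.
Qed.

(** By symmetry the half-line is enough. There the function is at most 2 / (1 + x)^2, which has a
    rational primitive. *)
Lemma integrable_oneDsqrV : leb.-integrable setT (EFin \o (fun x => (1 + x ^+ 2)^-1)).
Proof.
have cf : continuous (fun x : R => (1 + x ^+ 2)^-1).
  by move=> x; apply: cvgV; [rewrite gt_eqF// ltr_pwDl// sqr_ge0|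
    apply: cvgD; [exact: cvg_cst|exact: exprn_continuous]].
have mf := continuous_measurable_fun cf.
have f0 (x : R) : 0 <= (1 + x ^+ 2)^-1 by rewrite invr_ge0 addr_ge0 ?sqr_ge0.
apply/integrableP; split; first exact/measurable_EFinP.
under eq_integral do rewrite /= ger0_norm//.
rewrite ge0_symfun_integralT//; last by move=> x /=; rewrite sqrrN.
rewrite (_ : [set x : R | (0 <= x)%R] = `[0, +oo[%classic); last first.
  by apply/seteqP; split => x /=; rewrite in_itv /= andbT.
apply: lte_mul_pinfty => //.
apply: (@le_lt_trans _ _ (\int[leb]_(x in `[0%R, +oo[) (2 * (1 + x) ^- 2)%:E)%E).
  apply: ge0_le_integral => //.
  - by move=> x _; rewrite lee_fin.
  - by apply/measurable_EFinP; exact: measurable_funS mf.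
  - by apply/measurable_EFinP; exact: measurable_oneDV2.
  - move=> x; rewrite /= in_itv /= andbT => x0; rewrite lee_fin.
    have p1 : 0 < 1 + x ^+ 2 by rewrite ltr_pwDl// sqr_ge0.
    rewrite ler_pdivlMr ?exprn_gt0 ?ltr_pwDl// mulrC ler_pdivrMr//.
    by have := sqr_ge0 (x - 1); rewrite !expr2; lra.
under eq_integral do rewrite EFinM.
rewrite ge0_integralZl ?integral_oneDV2 ?mule1 ?ltry//.
- apply/measurable_EFinP; have := measurable_oneDV2 1.
  by apply: eq_measurable_fun => x _; rewrite mul1r.
- by move=> x _; rewrite lee_fin invr_ge0 sqr_ge0.
Qed.

Lemma integrable_plane_weight : leb1.-integrable setT
  (EFin \o (fun z : R * R => (1 + z.1 ^+ 2)^-1 * (1 + z.2 ^+ 2)^-1)).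
Proof. by have [] := integrable_prodM integrable_oneDsqrV integrable_oneDsqrV. Qed.

End Plane.

(** * The reproducing formula *)

Section Reproducing.
Context (R : realType).
Local Notation C := R[i].
Local Notation leb := (@lebesgue_measure R).
Local Notation leb1 := (@leb1 R).
Implicit Types (f : C -> C) (k : R).

Lemma cmeasurable_centire f : centire f -> cmeasurable (fun z : R * R => f (toC z)).
Proof.
move=> ef.
have c1 (x y : R) : Complex x y = Complex 0 y + ofR x * 1 :> C.
  by apply: complex_ext; rewrite !ReImE; ring.
have c2 (x y : R) : Complex x y = ofR x + ofR y * Complex 0 1 :> C.
  by apply: complex_ext; rewrite !ReImE; ring.
split.
  apply: (@measurable_caratheodory R _ _ (fun s t => complex.Re (f (Complex s t)))) => [t|s].
    by under eq_fun do rewrite c1; exact: (continuous_line _ _ ef).1.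
  by apply: continuous_measurable_fun; under eq_fun do rewrite c2; exact: (continuous_line _ _ ef).1.
apply: (@measurable_caratheodory R _ _ (fun s t => complex.Im (f (Complex s t)))) => [t|s].
  by under eq_fun do rewrite c1; exact: (continuous_line _ _ ef).2.
by apply: continuous_measurable_fun; under eq_fun do rewrite c2; exact: (continuous_line _ _ ef).2.
Qed.

Lemma cmeasurable_toC_conj : cmeasurable (fun z : R * R => (toC z)^*).
Proof. exact: cmeasurable_conj (cmeasurable_toC R). Qed.

Lemma cmeasurable_centire_comp d (T : measurableType d) (phi : T -> C) f :
  centire f -> cmeasurable phi -> cmeasurable (fun t => f (phi t)).
Proof.
move=> /cmeasurable_centire ef [m1 m2].
have -> : (fun t => f (phi t)) = (fun t => f (toC (complex.Re (phi t), complex.Im (phi t)))).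
  by apply/funext => t; rewrite /toC /=; case: (phi t).
apply: (cmeasurable_comp (phi := fun t => (complex.Re (phi t), complex.Im (phi t))) ef).
exact: measurable_fun_pair.
Qed.

Lemma measurable_gauss1 k : measurable_fun setT (@gauss1 R k).
Proof.
apply: measurable_funM => //; apply: (measurableT_comp (@measurable_expR R)).
apply: measurable_funN; apply: measurable_funM => //.
exact: measurable_sqnorm (cmeasurable_toC R).
Qed.

(** A rotation by [- t]: the integrand depends on the conjugate variable, which is then turned by
    [t]. *)
Let rot (t : R) (z : R * R) : R * R :=
  (cos t * z.1 - - sin t * z.2, - sin t * z.1 + cos t * z.2).

Let rot_preserving t : measure_preserving leb1 (rot t).
Proof. by apply: rotate_preserving; rewrite sqrrN cos2Dsin2. Qed.

Let toC_rot t z : (toC (rot t z))^* = cexp (Complex 0 t) * (toC z)^*.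
Proof.
by apply: complex_ext; rewrite /cexp /toC /rot !ReImE expR0; cbn [fst snd]; ring.
Qed.

Let gauss1_rot k t z : gauss1 k (rot t z) = gauss1 k z.
Proof.
rewrite /gauss1; congr (_ * expR (- (_ * _))).
by rewrite -sqnorm_conj toC_rot sqnormM sqnorm_conj -[sqnorm (cexp _)]cmod2 cmod_cexp
  ReC expR0 expr1n mul1r.
Qed.

(* Average the integral, which is invariant under rotations, over all rotations. *)
Lemma gauss_mean_value f k : centire f -> 0 < k ->
  cintegrable leb1 (fun z => f (toC z)^* * ofR (gauss1 k z)) ->
  cintegral leb1 (fun z => f (toC z)^* * ofR (gauss1 k z)) = f 0.
Proof.
move=> ef k0 cf; set I := cintegral _ _.
have [ig eg] := integral_gauss_plane k0.
pose G (p : R * (R * R)) : C := ofR (\1_`[0, 2 * pi] p.1) *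
  (f (cexp (Complex 0 p.1) * (toC p.2)^*) * ofR (gauss1 k p.2)).
have pi2 : 0 <= 2 * pi :> R by rewrite mulr_ge0// pi_ge0.
have rotE t z : f (cexp (Complex 0 t) * (toC z)^*) * ofR (gauss1 k z) =
    f (toC (rot t z))^* * ofR (gauss1 k (rot t z)).
  by rewrite gauss1_rot toC_rot.
have mI : measurable_fun setT (fun p : R * (R * R) => \1_`[0, 2 * pi] p.1 : R).
  exact: (measurableT_comp (@measurable_indic _ _ _ _ _ _) measurable_fst).
have mG : cmeasurable G.
  apply: cmeasurableM; first exact: cmeasurable_ofR.
  apply: cmeasurableM; last first.
    by apply: cmeasurable_ofR; exact: (measurableT_comp (measurable_gauss1 k) measurable_snd).
  apply: cmeasurable_centire_comp => //; apply: cmeasurableM.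
    by apply: cmeasurable_cexp; split; [exact: measurable_cst|exact: measurable_fst].
  exact: (cmeasurable_comp cmeasurable_toC_conj measurable_snd).
have iG : cintegrable (leb \x leb1)%E G.
  apply/cintegrableP; split => //.
  have ci := cintegrable_cmod cf; set h := (fun t => cmod _) in ci.
  apply: (@integrable_tonelli1 R _ _ _ _ leb leb1 (fun p => cmod (G p))
    (fun t => (\int[leb1]_z h z)%R * \1_`[0, 2 * pi] t)).
  - exact: measurable_cmod.
  - by move=> z; exact: cmod_ge0.
  - move=> t; have [i e] := integrable_preserving (rot_preserving t) ci.
    have t0 : 0 <= \1_`[0, 2 * pi] t :> R by rewrite indicE ler0n.
    have -> : (fun z => (cmod (G (t, z)))%:E) =
        (fun z => (\1_`[0, 2 * pi] t)%:E * (EFin \o (h \o rot t)) z)%E.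
      by apply/funext => z; rewrite /G cmodM rotE cmod_ofR (ger0_norm t0) EFinM.
    have F : ((\int[leb1]_z h (rot t z))%R%:E = \int[leb1]_z (EFin \o (h \o rot t)) z)%E.
      exact: (fineK (integrable_fin_num measurableT i)).
    by rewrite (integralZl measurableT i) -e EFinM muleC F.
  - by apply: rintegrableZ; exact: integrable_indic_itv.
(* Integrating over the plane first gives [I] for each angle, hence [2 * pi * I]; integrating over
   the angle first gives [2 * pi * f 0] at each point, by the mean value property. *)
have [_ _ e1] := cFubini1 iG; have [_ _ e2] := cFubini2 iG.
have p0 : ofR (2 * pi) != 0 :> C.
  by apply/eqP => -[] /eqP; rewrite mulf_eq0 pnatr_eq0 /= gt_eqF// pi_gt0.
apply: (mulfI p0).
have mv1 := mean_value (@centire_cst R 1).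
transitivity (cintegral (leb \x leb1)%E G).
  rewrite -e1 -[ofR (2 * pi)]mulr1 -mv1.2 [LHS]mulrC -cintegralZ; last exact: mv1.1.
  congr (cintegral _ _); apply/funext => t.
  have [i e] := cintegral_preserving (rot_preserving t) cf.
  have E : (fun z => G (t, z)) = (fun z => ofR (\1_`[0, 2 * pi] t) *
      (f (toC (rot t z))^* * ofR (gauss1 k (rot t z)))).
    by apply/funext => z; rewrite /G rotE.
  by rewrite E (cintegralZ _ i) e mulr1 mulrC.
rewrite -e2.
transitivity (cintegral leb1 (fun z : R * R => (ofR (2 * pi) * f 0) * ofR (gauss1 k z))).
  congr (cintegral _ _); apply/funext => z.
  have ec : centire (fun w => f (w * (toC z)^*)).
    apply: (centire_comp ef); exact: centireM (@centire_id R) (centire_cst _).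
  have [mvi mve] := mean_value ec; rewrite mul0r in mve.
  rewrite -mve mulrC -cintegralZ//.
  by congr (cintegral _ _); apply/funext => t; rewrite /G /=; ring.
have icg : cintegrable leb1 (fun z => ofR (gauss1 k z)).
  apply: (le_cintegrable _ _ ig).
    by apply: cmeasurable_ofR; exact: measurable_gauss1.
  by move=> z; rewrite cmod_ofR ger0_norm// gauss1_ge0// ltW.
rewrite cintegralZ// [X in _ * X = _](_ : _ = 1) ?mulr1//.
by apply: complex_ext; rewrite /cintegral ?ReC ?ImC //= /Rintegral integral0.
Qed.

Lemma gauss1_translate k (a : C) z : gauss1 k (z.1 + complex.Re a^*, z.2 + complex.Im a^*) =
  expR (- (k * (sqnorm a + 2 * complex.Re (a * toC z)))) * gauss1 k z.
Proof.
rewrite /gauss1 mulrCA -expRD; congr (_ * expR _).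
by rewrite /sqnorm /toC !ReImE; cbn [fst snd]; ring.
Qed.

(** The translation by a^* recentres the Gaussian. Its cross terms absorb the factor exp (k a z) and
    leave the entire function [h] of the conjugate variable, whose Gaussian mean is [h 0], that is
    [f a]. *)
Lemma reproducing f k (a : C) : centire f -> 0 < k ->
  cintegrable leb1 (fun z => cexp (ofR k * a * toC z) * f (toC z)^* * ofR (gauss1 k z)) ->
  cintegral leb1 (fun z => cexp (ofR k * a * toC z) * f (toC z)^* * ofR (gauss1 k z)) = f a.
Proof.
move=> ef k0 cf; have [i e] := cintegral_translate a^* cf.
pose h w := f (a + w) * cexp (- (ofR k * a^*) * w).
have eh : centire h.
  apply: centireM.
    by apply: (centire_comp ef); exact: centireD (centire_cst _) (@centire_id R).
  by apply: (centire_comp (@centire_cexp R)); exact: centireMl (@centire_id R).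
have E : (fun z : R * R => cexp (ofR k * a * toC (z.1 + complex.Re a^*, z.2 + complex.Im a^*)) *
    f (toC (z.1 + complex.Re a^*, z.2 + complex.Im a^*))^* *
    ofR (gauss1 k (z.1 + complex.Re a^*, z.2 + complex.Im a^*))) =
  (fun z => h (toC z)^* * ofR (gauss1 k z)).
  apply/funext => z; rewrite gauss1_translate ofRM -cexp_ofR.
  have -> : toC (z.1 + complex.Re a^*, z.2 + complex.Im a^*) = toC z + a^*.
    by apply: complex_ext; rewrite /toC !ReImE.
  rewrite /h (_ : (toC z + a^*)^* = a + (toC z)^*); last first.
    by rewrite rmorphD /= conjCK addrC.
  have <- : cexp (ofR k * a * (toC z + a^*)) *
      cexp (ofR (- (k * (sqnorm a + 2 * complex.Re (a * toC z))))) =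
      cexp (- (ofR k * a^*) * (toC z)^*).
    rewrite -cexpD; congr cexp.
    by apply: complex_ext; rewrite !ReImE /sqnorm; ring.
  by ring.
rewrite E in i e; rewrite -e (gauss_mean_value eh k0 i).
by rewrite /h addr0 mulr0 cexp0 mulr1.
Qed.

(** Completing the square: half of the Gaussian absorbs any exponential of the modulus. *)
Lemma expR_gauss1_le k (M : R) z : 0 < k -> expR (M * cmod (toC z)) * gauss1 k z <=
  2 * expR (M ^+ 2 / (2 * k)) * gauss1 (k / 2) z.
Proof.
move=> k0; rewrite /gauss1.
rewrite (_ : _ * (k / pi * _) =
  k / pi * (expR (M * cmod (toC z)) * expR (- (k * sqnorm (toC z))))); last by ring.
rewrite (_ : 2 * _ * _ = k / pi * (expR (M ^+ 2 / (2 * k)) * expR (- (k / 2 * sqnorm (toC z))))); last first.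
  by rewrite [X in _ = X / _ * _](splitr k); ring.
rewrite ler_wpM2l ?divr_ge0 ?pi_ge0 ?(ltW k0)// -!expRD ler_expR -cmod2.
have h : 0 <= (M - k * cmod (toC z)) ^+ 2 / (2 * k).
  by rewrite divr_ge0 ?sqr_ge0// mulr_ge0// ltW.
suff : (M - k * cmod (toC z)) ^+ 2 / (2 * k) = M ^+ 2 / (2 * k) - M * cmod (toC z) +
  k / 2 * cmod (toC z) ^+ 2 by lra.
by field; rewrite gt_eqF.
Qed.

Lemma integrable_expR_gauss1 k (M : R) : 0 < k ->
  leb1.-integrable setT (EFin \o (fun z => expR (M * cmod (toC z)) * gauss1 k z)).
Proof.
move=> k0; have k2 : 0 < k / 2 by rewrite divr_gt0.
apply: (le_rintegrable _ _ (rintegrableZ (2 * expR (M ^+ 2 / (2 * k))) (integral_gauss_plane k2).1)).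
  apply: measurable_funM; last exact: measurable_gauss1.
  apply: (measurableT_comp (@measurable_expR R)); apply: measurable_funM => //.
  exact: measurable_cmod (cmeasurable_toC R).
move=> z; rewrite ger0_norm; first exact: expR_gauss1_le.
by rewrite mulr_ge0 ?expR_ge0 ?gauss1_ge0// ltW.
Qed.

Lemma cmod_cexpM_le (s z : C) : cmod (cexp (s * z)) <= expR (cmod s * cmod z).
Proof.
rewrite cmod_cexp ler_expR -cmodM.
exact: le_trans (ler_norm _) (Re_le_cmod _).
Qed.

(** This is [reproducing] for the function exp (t w) at the point s / k. The later Gaussian
    integrals of exponentials are instances of it. *)
Lemma gauss_exponential (k : R) (s t : C) : 0 < k ->
  is_cintegral leb1 (fun z => cexp (s * toC z) * cexp (t * (toC z)^*) * ofR (gauss1 k z))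
    (cexp (s * t / ofR k)).
Proof.
move=> k0; have kC : ofR k != 0 :> C by apply/eqP => -[] /eqP; rewrite gt_eqF.
have i : cintegrable leb1 (fun z => cexp (s * toC z) * cexp (t * (toC z)^*) * ofR (gauss1 k z)).
  apply: (le_cintegrable _ _ (integrable_expR_gauss1 (cmod s + cmod t) k0)).
    apply: cmeasurableM; last exact: cmeasurable_ofR (measurable_gauss1 k).
    apply: cmeasurableM; apply: cmeasurable_cexp; apply: cmeasurableM;
      first [exact: cmeasurable_cst|exact: cmeasurable_toC|exact: cmeasurable_toC_conj].
  move=> z; rewrite !cmodM cmod_ofR ger0_norm ?gauss1_ge0 ?(ltW k0)//.
  rewrite ler_wpM2r ?gauss1_ge0 ?(ltW k0)// mulrDl expRD.
  by rewrite ler_pM ?cmod_ge0 ?cmod_cexpM_le// -[cmod (toC z)]cmod_conj cmod_cexpM_le.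
split=> //.
have E : ofR k * (s / ofR k) = s by rewrite mulrC divfK.
have et : centire (fun w => cexp (t * w)).
  by apply: (centire_comp (@centire_cexp R)); exact: centireMl (@centire_id R).
have := @reproducing _ k (s / ofR k) et k0; rewrite E => /(_ i) ->.
by congr cexp; rewrite mulrA [t * s]mulrC.
Qed.

End Reproducing.

(** * Two degrees of freedom *)

Section TwoVariables.
Context (R : realType).
Local Notation C := R[i].
Local Notation leb1 := (@leb1 R).
Local Notation leb2 := (@leb2 R).
Implicit Types (f : C -> C -> C).

(** Measurability and the reproducing formula are both obtained one variable at a time, so this is
    the form in which holomorphy is used from here on. *)
Definition separately_entire f :=
  (forall w1, centire (fun w0 => f w0 w1)) /\ (forall w0, centire (f w0)).

Let cderivable_at_line f (z v : C^o * C^o) : differentiable ((fun w => f w.1 w.2) : C^o * C^o -> C^o) z ->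
  exists d, cderivable_at (fun h => f (h * v.1 + z.1) (h * v.2 + z.2)) 0 d.
Proof.
move=> /(@diff_derivable _ _ _ _ _ v) /cvg_ex [d /cvgrPdist_lt Hd]; exists d => e e0.
have eC : 0 < ofR e :> C by rewrite ltcE /= eqxx.
move: (Hd _ eC); rewrite /dnbhs /within /= => /nbhs_ballP [r /= r0 Hr].
have [r' [rE r'0]] : exists r' : R, r = ofR r' /\ 0 < r'.
  by move: r0; rewrite ltcE; case: r {Hr} => a b /= /andP[/eqP -> ?]; exists a.
exists r' => // h hr; rewrite add0r !mul0r !add0r.
have [->|h0] := eqVneq h 0.
  by rewrite !mul0r !add0r subrr mulr0 subr0 cmod0 mulr0.
have bh : `|0 - h| < r.
  by rewrite sub0r normrN normc_def rE ltcE /= eqxx.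
have := Hr h bh h0; rewrite /= normc_def ltcE /= => /andP[_ H].
have -> : f (h * v.1 + z.1) (h * v.2 + z.2) - f z.1 z.2 - d * h =
    - (d - h^-1 *: (f (h *: v.1 + z.1) (h *: v.2 + z.2) - f z.1 z.2)) * h.
  rewrite /GRing.scale /= opprB mulrBl mulrAC mulVf ?mul1r// mulrC.
by rewrite cmodM cmodN ler_wpM2r ?cmod_ge0// ltW.
Qed.

Lemma entire2_separately f : entire2 f -> separately_entire f.
Proof.
move=> ef; split=> w z.
  have [d Hd] := cderivable_at_line (1, 0) (ef (z, w)); exists d => e e0.
  have [r r0 H] := Hd _ e0; exists r => // h /H /=.
  by rewrite add0r !mul0r !mulr0 !mulr1 !add0r (addrC h z).
have [d Hd] := cderivable_at_line (0, 1) (ef (w, z)); exists d => e e0.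
have [r r0 H] := Hd _ e0; exists r => // h /H /=.
by rewrite add0r !mul0r !mulr0 !mulr1 !add0r (addrC h z).
Qed.

(** For a fixed second argument the function is continuous in each real coordinate of the first one;
    [measurable_caratheodory] adds these two coordinates in turn. *)
Lemma cmeasurable_separately d (T : measurableType d) (phi psi : T -> C) f :
  separately_entire f -> cmeasurable phi -> cmeasurable psi ->
  cmeasurable (fun t => f (phi t) (psi t)).
Proof.
move=> [f1 f2] [m1 m2] m3.
have c1 (x y : R) : Complex x y = Complex 0 y + ofR x * 1 :> C.
  by apply: complex_ext; rewrite !ReImE; ring.
have c2 (x y : R) : Complex x y = ofR x + ofR y * Complex 0 1 :> C.
  by apply: complex_ext; rewrite !ReImE; ring.
have mphi : measurable_fun setT (fun t => (complex.Re (phi t), (complex.Im (phi t), t))).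
  by apply: measurable_fun_pair => //; exact: measurable_fun_pair.
have E t : phi t = Complex (complex.Re (phi t)) (complex.Im (phi t)) by case: (phi t).
split.
  have mm : measurable_fun setT (fun z : R * (R * T) => complex.Re (f (Complex z.1 z.2.1) (psi z.2.2))).
    apply: (@measurable_caratheodory R _ _ (fun s w => complex.Re (f (Complex s w.1) (psi w.2)))) => [w|s].
      by under eq_fun do rewrite c1; exact: (continuous_line _ _ (f1 _)).1.
    apply: (@measurable_caratheodory R _ _ (fun y t => complex.Re (f (Complex s y) (psi t)))) => [t|y].
      by under eq_fun do rewrite c2; exact: (continuous_line _ _ (f1 _)).1.
    exact: (cmeasurable_centire_comp (f2 _) m3).1.
  by have := measurableT_comp mm mphi; apply: eq_measurable_fun => t _ /=; rewrite -E.
have mm : measurable_fun setT (fun z : R * (R * T) => complex.Im (f (Complex z.1 z.2.1) (psi z.2.2))).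
  apply: (@measurable_caratheodory R _ _ (fun s w => complex.Im (f (Complex s w.1) (psi w.2)))) => [w|s].
    by under eq_fun do rewrite c1; exact: (continuous_line _ _ (f1 _)).2.
  apply: (@measurable_caratheodory R _ _ (fun y t => complex.Im (f (Complex s y) (psi t)))) => [t|y].
    by under eq_fun do rewrite c2; exact: (continuous_line _ _ (f1 _)).2.
  exact: (cmeasurable_centire_comp (f2 _) m3).2.
by have := measurableT_comp mm mphi; apply: eq_measurable_fun => t _ /=; rewrite -E.
Qed.

Definition u0 (u : (R * R) * (R * R)) : C := toC u.1.
Definition u1 (u : (R * R) * (R * R)) : C := toC u.2.

Lemma cmeasurable_u0 : cmeasurable u0.
Proof. exact: (cmeasurable_comp (cmeasurable_toC R) measurable_fst). Qed.

Lemma cmeasurable_u1 : cmeasurable u1.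
Proof. exact: (cmeasurable_comp (cmeasurable_toC R) measurable_snd). Qed.

Lemma gaussE (u : (R * R) * (R * R)) : gauss (u0 u) (u1 u) = gauss1 1 u.1 * gauss1 1 u.2.
Proof. by rewrite /gauss /gauss1 !mul1r. Qed.

Lemma gauss_ge0 (z w : C) : 0 <= gauss z w.
Proof. by rewrite /gauss !mulr_ge0 ?expR_ge0 ?invr_ge0 ?pi_ge0. Qed.

Lemma measurable_gauss : measurable_fun setT (fun u => gauss (u0 u) (u1 u)).
Proof.
under eq_fun do rewrite gaussE.
by apply: measurable_funM; [exact: (measurableT_comp (measurable_gauss1 1) measurable_fst)|
  exact: (measurableT_comp (measurable_gauss1 1) measurable_snd)].
Qed.

Lemma cmeasurable_conj_separately f : separately_entire f ->
  cmeasurable (fun u => f (u0 u)^* (u1 u)^*).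
Proof.
move=> sf; apply: cmeasurable_separately => //; apply: cmeasurable_conj.
  exact: cmeasurable_u0.
exact: cmeasurable_u1.
Qed.

Lemma Hspace_integrable f : Hspace f ->
  leb2.-integrable setT (EFin \o (fun u => sqnorm (f (u0 u)^* (u1 u)^*) * gauss (u0 u) (u1 u))).
Proof.
move=> [_ [i _]]; move: i; congr (leb2.-integrable setT (EFin \o _)).
by apply/funext => u; rewrite /mu_integrand !ReImE mul0r subr0.
Qed.

Lemma integrable_expR_gauss (M0 M1 : R) : leb2.-integrable setT (EFin \o
  (fun u => expR (M0 * cmod (u0 u)) * expR (M1 * cmod (u1 u)) * gauss (u0 u) (u1 u))).
Proof.
have [i _] := integrable_prodM (integrable_expR_gauss1 M0 (@ltr01 R)) (integrable_expR_gauss1 M1 (@ltr01 R)).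
move: i; congr (leb2.-integrable setT (EFin \o _)).
by apply/funext => u; rewrite gaussE /u0 /u1; ring.
Qed.

(** By AM-GM the product is bounded by the squared exponentials, integrable against the Gaussian,
    plus |f|^2, integrable because [f] has finite norm. *)
Lemma Hspace_expR_integrable f (M0 M1 : R) : Hspace f -> leb2.-integrable setT (EFin \o
  (fun u => expR (M0 * cmod (u0 u)) * expR (M1 * cmod (u1 u)) *
     cmod (f (u0 u)^* (u1 u)^*) * gauss (u0 u) (u1 u))).
Proof.
move=> Hf; have sf := entire2_separately Hf.1.
have i := rintegrableD (integrable_expR_gauss (2 * M0) (2 * M1)) (Hspace_integrable Hf).
apply: (le_rintegrable _ _ i).
  apply: measurable_funM; last exact: measurable_gauss.
  apply: measurable_funM; last exact: measurable_cmod (cmeasurable_conj_separately sf).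
  by apply: measurable_funM; apply: (measurableT_comp (@measurable_expR R));
    apply: measurable_funM => //; apply: measurable_cmod;
    first [exact: cmeasurable_u0|exact: cmeasurable_u1].
move=> u; have g0 := gauss_ge0 (u0 u) (u1 u).
rewrite ger0_norm; last by apply: mulr_ge0 => //; rewrite !mulr_ge0 ?expR_ge0 ?cmod_ge0.
rewrite -mulrDl ler_wpM2r// -cmod2 -!mulrA ![2 * (_ * _)]mulrC -!mulrA.
have E (x : R) : expR (x * 2) = expR x * expR x by rewrite -expRD; congr expR; ring.
rewrite !mulrA !E.
move: (expR_ge0 (M0 * cmod (u0 u))) (expR_ge0 (M1 * cmod (u1 u))) (cmod_ge0 (f (u0 u)^* (u1 u)^*)).
move: (expR _) (expR _) (cmod (f _ _)) => a b c a0 b0 c0.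
have := sqr_ge0 (a * b - c); rewrite !expr2.
have : 0 <= a * b * c by rewrite !mulr_ge0.
by have := sqr_ge0 (a * b); have := sqr_ge0 c; rewrite !expr2; lra.
Qed.

End TwoVariables.

Section AeEq.
Context (R : realType) (d : measure_display) (T : measurableType d).
Context (mu : {measure set T -> \bar R}).

Lemma integrable_ae_eq (F G : T -> R) : mu.-integrable setT (EFin \o F) ->
  measurable_fun setT G -> {ae mu, forall t, F t = G t} ->
  mu.-integrable setT (EFin \o G) /\ (\int[mu]_t G t = \int[mu]_t F t)%R.
Proof.
move=> iF mG FG; have mF := measurable_int _ iF.
have mGE : measurable_fun setT (EFin \o G) by exact/measurable_EFinP.
split.
  apply/integrableP; split => //.
  have /integrableP[_] := iF; apply: le_lt_trans; rewrite le_eqVlt; apply/orP; left; apply/eqP.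
  apply: ae_eq_integral => //; [exact: measurableT_comp|exact: measurableT_comp|].
  by move: FG; apply: filterS => t /= ->.
congr fine; apply: ae_eq_integral => //.
by move: FG; apply: filterS => t /= ->.
Qed.

Lemma cintegral_ae_eq (F G : T -> R[i]) : cintegrable mu F -> cmeasurable G ->
  {ae mu, forall t, F t = G t} -> cintegrable mu G /\ cintegral mu G = cintegral mu F.
Proof.
move=> [F1 F2] [G1 G2] FG.
have [i1 e1] := integrable_ae_eq F1 G1 (filterS (fun t (h : F t = G t) => congr1 (@complex.Re R) h) FG).
have [i2 e2] := integrable_ae_eq F2 G2 (filterS (fun t (h : F t = G t) => congr1 (@complex.Im R) h) FG).
by split; [split|rewrite /cintegral e1 e2].
Qed.

End AeEq.

(** * The reproducing formula in two variables and the Taylor expansion *)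

Section Expansion.
Context (R : realType).
Local Notation C := R[i].
Local Notation leb1 := (@leb1 R).
Local Notation leb2 := (@leb2 R).
Implicit Types (f : C -> C -> C).

(** Fubini makes the inner section integrable only for almost every value of the first variable, so
    the inner reproducing formula is an equality almost everywhere. The everywhere defined [G] then
    carries the outer one. *)
Lemma reproducing2 f (a b : C) : separately_entire f ->
  cintegrable leb2 (fun u => cexp (a * u0 u) * cexp (b * u1 u) *
    f (u0 u)^* (u1 u)^* * ofR (gauss (u0 u) (u1 u))) ->
  cintegral leb2 (fun u => cexp (a * u0 u) * cexp (b * u1 u) *
    f (u0 u)^* (u1 u)^* * ofR (gauss (u0 u) (u1 u))) = f a b.
Proof.
move=> sf; set P := (fun u => _) => iP.
have [ae1 i1 e1] := @cFubini1 R _ _ _ _ leb1 leb1 P iP.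
pose c (x : R * R) : C := cexp (a * toC x) * ofR (gauss1 1 x).
pose Q (x y : R * R) : C := cexp (ofR 1 * b * toC y) * f (toC x)^* (toC y)^* * ofR (gauss1 1 y).
have PE x y : P (x, y) = c x * Q x y.
  by rewrite /P /c /Q gaussE /u0 /u1 ofRM ofR1 mul1r; ring.
(* Dividing by [c x] transfers integrability from the section of [P] to [Q x]. *)
have c0 x : c x != 0.
  apply/eqP => h; have : cmod (c x) = 0 by rewrite h cmod0.
  rewrite /c cmodM cmod_cexp cmod_ofR => /eqP; rewrite mulf_eq0 gt_eqF ?expR_gt0//= normr_eq0.
  by rewrite /gauss1 mulf_eq0 [expR _ == 0]gt_eqF ?expR_gt0// orbF mul1r invr_eq0 gt_eqF ?pi_gt0.
pose G (x : R * R) : C := cexp (ofR 1 * a * toC x) * f (toC x)^* b * ofR (gauss1 1 x).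
have mG : cmeasurable G.
  apply: cmeasurableM; last exact: cmeasurable_ofR (measurable_gauss1 1).
  apply: cmeasurableM.
    apply: cmeasurable_cexp; apply: cmeasurableM; last exact: cmeasurable_toC.
    exact: cmeasurable_cst.
  by apply: (cmeasurable_centire_comp (sf.1 b)); exact: cmeasurable_toC_conj.
have FG : {ae leb1, forall x, cintegral leb1 (fun y => P (x, y)) = G x}.
  move: ae1; apply: filterS => x ix.
  have PQ : (fun y => P (x, y)) = (fun y => c x * Q x y) by apply/funext => y; exact: PE.
  have iQ : cintegrable leb1 (Q x).
    rewrite PQ in ix; have := cintegrableZ (c x)^-1 ix.
    congr cintegrable; apply/funext => y.
    by rewrite mulrA mulVf// mul1r.
  rewrite PQ (cintegralZ _ iQ) (reproducing (sf.2 _) ltr01 iQ) /c /G ofR1 mul1r.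
  by ring.
have [iG eG] := cintegral_ae_eq i1 mG FG.
have := reproducing (sf.1 b) ltr01 iG => <-.
by rewrite eG e1.
Qed.

Lemma Hspace_weighted_integrable f (E : (R * R) * (R * R) -> C) (M0 M1 K : R) :
  Hspace f -> cmeasurable E ->
  (forall u, cmod (E u) <= K * (expR (M0 * cmod (u0 u)) * expR (M1 * cmod (u1 u)))) ->
  cintegrable leb2 (fun u => E u * f (u0 u)^* (u1 u)^* * ofR (gauss (u0 u) (u1 u))).
Proof.
move=> Hf mE EK; have sf := entire2_separately Hf.1.
apply: (le_cintegrable _ _ (rintegrableZ K (Hspace_expR_integrable M0 M1 Hf))).
  apply: cmeasurableM; last exact: cmeasurable_ofR (@measurable_gauss R).
  by apply: cmeasurableM => //; exact: cmeasurable_conj_separately.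
move=> u; rewrite !cmodM cmod_ofR (ger0_norm (gauss_ge0 _ _)).
rewrite (mulrA K _ (gauss _ _)) (mulrA K _ (cmod _)).
by rewrite ler_wpM2r ?gauss_ge0// ler_wpM2r ?cmod_ge0.
Qed.

Lemma cmod_cexp2_le (a b : C) u : cmod (cexp (a * u0 u) * cexp (b * u1 u)) <=
  1 * (expR (cmod a * cmod (@u0 R u)) * expR (cmod b * cmod (u1 u))).
Proof. by rewrite cmodM mul1r ler_pM ?cmod_ge0// cmod_cexpM_le. Qed.

Lemma cmeasurable_cexp2 (a b : C) : cmeasurable (fun u => cexp (a * u0 u) * cexp (b * u1 u)).
Proof.
by apply: cmeasurableM; apply: cmeasurable_cexp; apply: cmeasurableM;
  first [exact: cmeasurable_cst|exact: cmeasurable_u0|exact: cmeasurable_u1].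
Qed.

Lemma id_has_kernel : has_kernel (@id (C -> C -> C))
  (fun w0 w1 v0 v1 => cexp (w0 * v0) * cexp (w1 * v1)).
Proof.
move=> g Hg a b; have i := Hspace_weighted_integrable Hg (cmeasurable_cexp2 a^* b^*)
  (cmod_cexp2_le a^* b^*).
split; first exact: i.
exact: reproducing2 (entire2_separately Hg.1) i.
Qed.

Definition coef f m n : C := braket (tensor (ket m) (ket n)) f.

Lemma ket_conj m (z : C) : (ket m z)^* = ket m z^*.
Proof. by rewrite /ket rmorphM rmorphXn fmorphV /= conj_ofR. Qed.

Lemma cmod_ket m (z : C) : cmod (ket m z) = cmod z ^+ m / Num.sqrt m`!%:R.
Proof.
by rewrite /ket cmodM cmodX -ofRV cmod_ofR ger0_norm// invr_ge0 sqrtr_ge0.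
Qed.

Lemma expf_fact_le m (x : R) : 0 <= x -> x ^+ m / m`!%:R <= expR x.
Proof.
case: m => [|m] x0; first by rewrite expr0 fact0 divr1 -expR0 ler_expR.
by apply: le_trans (expR_ge1Dxn m x0); rewrite lerDr.
Qed.

Lemma cmod_ket_le m (z : C) : cmod (ket m z) <= m`!%:R * expR (cmod z).
Proof.
have f1 : 1 <= m`!%:R :> R by rewrite ler1n fact_gt0.
have f0 : 0 < m`!%:R :> R by rewrite ltr0n fact_gt0.
rewrite cmod_ket; apply: le_trans (_ : cmod z ^+ m <= _).
  rewrite ler_pdivrMr ?sqrtr_gt0// ler_peMr ?exprn_ge0 ?cmod_ge0//.
  by rewrite -[leLHS]sqrtr1 ler_wsqrtr.
by rewrite -ler_pdivrMl// mulrC; exact: expf_fact_le (cmod_ge0 z).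
Qed.

Lemma cmeasurable_ket d (T : measurableType d) (phi : T -> C) m : cmeasurable phi ->
  cmeasurable (fun t => ket m (phi t)).
Proof.
by move=> mp; apply: cmeasurableM; [exact: cmeasurableX|exact: cmeasurable_cst].
Qed.

Lemma coef_integrable f m n : Hspace f ->
  cintegrable leb2 (fun u => (ket m (u0 u) * ket n (u1 u)) *
    f (u0 u)^* (u1 u)^* * ofR (gauss (u0 u) (u1 u))).
Proof.
move=> Hf; apply: (@Hspace_weighted_integrable _ _ 1 1 (m`!%:R * n`!%:R)) => //.
  by apply: cmeasurableM; apply: cmeasurable_ket; [exact: cmeasurable_u0|exact: cmeasurable_u1].
move=> u; rewrite cmodM !mul1r mulrACA.
by apply: ler_pM; rewrite ?cmod_ge0 ?cmod_ket_le.
Qed.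

Lemma braket_ketE f m n : mu_integrand (braket_integrand (tensor (ket m) (ket n)) f) =
  (fun u => (ket m (u0 u) * ket n (u1 u)) * f (u0 u)^* (u1 u)^* * ofR (gauss (u0 u) (u1 u))).
Proof.
apply/funext => u; rewrite /mu_integrand /braket_integrand /tensor.
by rewrite rmorphM /= !ket_conj !conjCK.
Qed.

Definition coef_sum f N (w0 w1 : C) : C :=
  \sum_(m < N) \sum_(n < N) ket m w0 * ket n w1 * coef f m n.

Lemma exp_sum_ket N (w v : C) : exp_sum N (w * v) = \sum_(m < N) ket m w * ket m v.
Proof.
apply: eq_bigr => m _; rewrite /ket exprMn.
rewrite (_ : ofR m`!%:R = ofR (Num.sqrt m`!%:R) * ofR (Num.sqrt m`!%:R)).
  by rewrite invfM; ring.
by rewrite -ofRM -expr2 sqr_sqrtr.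
Qed.

Lemma coef_sumE f N (w0 w1 : C) : Hspace f ->
  cintegral leb2 (fun u => (exp_sum N (w0 * u0 u) * exp_sum N (w1 * u1 u)) *
    f (u0 u)^* (u1 u)^* * ofR (gauss (u0 u) (u1 u))) = coef_sum f N w0 w1.
Proof.
move=> Hf.
pose P m n u := (ket m (u0 u) * ket n (u1 u)) * f (u0 u)^* (u1 u)^* * ofR (gauss (u0 u) (u1 u)).
have -> : (fun u => (exp_sum N (w0 * u0 u) * exp_sum N (w1 * u1 u)) *
    f (u0 u)^* (u1 u)^* * ofR (gauss (u0 u) (u1 u))) =
  (fun u => \sum_(m < N) \sum_(n < N) (ket m w0 * ket n w1) * P m n u).
  apply/funext => u; rewrite !exp_sum_ket !mulr_suml; apply: eq_bigr => m _.
  rewrite mulr_sumr !mulr_suml; apply: eq_bigr => n _.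
  by rewrite /P; ring.
have iP m n : cintegrable leb2 (fun u => (ket m w0 * ket n w1) * P m n u).
  by apply: cintegrableZ; exact: coef_integrable.
rewrite cintegral_sum; last by move=> m; apply: cintegrable_sum => n; exact: iP.
apply: eq_bigr => m _; rewrite cintegral_sum; last by move=> n; exact: iP.
apply: eq_bigr => n _; rewrite (cintegralZ _ (coef_integrable m n Hf)); congr (_ * _).
by rewrite /coef /braket /mu_integral braket_ketE.
Qed.

Lemma cmeasurable_exp_sum d (T : measurableType d) (phi : T -> C) N : cmeasurable phi ->
  cmeasurable (fun t => exp_sum N (phi t)).
Proof.
move=> mp; apply: cmeasurable_sum => i.
by apply: cmeasurableM; [exact: cmeasurableX|exact: cmeasurable_cst].
Qed.

(** Truncating both exponentials in the reproducing formula produces [coef_sum]. Since |exp_sum N z|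
    <= exp |z|, a single integrable majorant serves for all [N]. *)
Lemma coef_sum_cvg f (w0 w1 : C) : Hspace f ->
  (fun N => cmod (coef_sum f N w0 w1 - f w0 w1)) @ \oo --> (0 : R).
Proof.
move=> Hf; have sf := entire2_separately Hf.1.
have i := Hspace_weighted_integrable Hf (cmeasurable_cexp2 w0 w1) (cmod_cexp2_le w0 w1).
have mw (w : C) (v : _ -> C) : cmeasurable v -> cmeasurable (fun u : (R * R) * (R * R) => w * v u).
  by move=> mv; apply: cmeasurableM => //; exact: cmeasurable_cst.
have := @cdominated_cvg R _ _ leb2 (fun N u => (exp_sum N (w0 * u0 u) * exp_sum N (w1 * u1 u)) *
    f (u0 u)^* (u1 u)^* * ofR (gauss (u0 u) (u1 u)))
  (fun u => cexp (w0 * u0 u) * cexp (w1 * u1 u) * f (u0 u)^* (u1 u)^* * ofR (gauss (u0 u) (u1 u)))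
  (fun u => expR (cmod w0 * cmod (u0 u)) * expR (cmod w1 * cmod (u1 u)) *
     cmod (f (u0 u)^* (u1 u)^*) * gauss (u0 u) (u1 u)).
rewrite (reproducing2 sf i); case.
- move=> N; apply: cmeasurableM; last exact: cmeasurable_ofR (@measurable_gauss R).
  apply: cmeasurableM; last exact: cmeasurable_conj_separately.
  by apply: cmeasurableM; apply: cmeasurable_exp_sum; apply: mw;
    [exact: cmeasurable_u0|exact: cmeasurable_u1].
- move=> u; set A := f _ _; set g := ofR _.
  have h : (fun N => (cmod (exp_sum N (w0 * u0 u) - cexp (w0 * u0 u)) * expR (cmod (w1 * u1 u)) +
      cmod (cexp (w0 * u0 u)) * cmod (exp_sum N (w1 * u1 u) - cexp (w1 * u1 u))) *
      cmod A * cmod g) @ \oo --> ((0 * expR (cmod (w1 * u1 u)) + cmod (cexp (w0 * u0 u)) * 0) * cmod A * cmod g : R).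
    apply: cvgM; last exact: cvg_cst.
    apply: cvgM; last exact: cvg_cst.
    by apply: cvgD; apply: cvgM; first [exact: cvg_exp_sum|exact: cvg_cst].
  rewrite mul0r mulr0 addr0 !mul0r in h.
  apply: (squeeze_cvgr _ (cvg_cst 0) h); apply: nearW => N; rewrite cmod_ge0 /=.
  rewrite -!mulrBl !cmodM ler_wpM2r ?cmod_ge0// ler_wpM2r ?cmod_ge0//.
  rewrite (_ : _ - _ = (exp_sum N (w0 * u0 u) - cexp (w0 * u0 u)) * exp_sum N (w1 * u1 u) +
    cexp (w0 * u0 u) * (exp_sum N (w1 * u1 u) - cexp (w1 * u1 u))); last by ring.
  apply: (le_trans (cmodD _ _)); rewrite !cmodM lerD// ler_wpM2l ?cmod_ge0//.
  by rewrite -cmodM cmod_exp_sum_le.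
- move=> N u; rewrite !cmodM cmod_ofR (ger0_norm (gauss_ge0 _ _)).
  rewrite ler_wpM2r ?gauss_ge0// ler_wpM2r ?cmod_ge0//.
  by apply: ler_pM; rewrite ?cmod_ge0// -cmodM cmod_exp_sum_le.
- exact: Hspace_expR_integrable.
move=> _; apply: cvg_trans; apply: near_eq_cvg; apply: nearW => N.
by rewrite coef_sumE.
Qed.

End Expansion.

(** * Decay of vectors in [Phi] *)

Section Poisson.
Context (R : realType).
Implicit Types (x : R) (m j : nat).

(** The Poisson probability of [m] with mean [x]. At x = |w|^2 it is the squared modulus of the ket
    [m] times exp (- |w|^2), see [damped_ket2]; decay in [w] and decay in [m] both come from it. *)
Definition poisson m x : R := x ^+ m / m`!%:R * expR (- x).

Lemma poisson_ge0 m x : 0 <= x -> 0 <= poisson m x.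
Proof. by move=> x0; rewrite /poisson !mulr_ge0 ?expR_ge0 ?exprn_ge0. Qed.

Lemma poisson_le1 m x : 0 <= x -> poisson m x <= 1.
Proof.
by move=> x0; rewrite /poisson expRN ler_pdivrMr ?expR_gt0// mul1r expf_fact_le.
Qed.

Lemma poissonS m x : x * poisson m x = m.+1%:R * poisson m.+1 x.
Proof.
have m1 : m.+1%:R != 0 :> R by rewrite pnatr_eq0.
have E : x ^+ m.+1 / (m.+1)`!%:R = m.+1%:R^-1 * (x * (x ^+ m / m`!%:R)).
  by rewrite factS natrM exprS invfM; ring.
by rewrite /poisson E !mulrA mulfV// mul1r.
Qed.

(** [poissonS] trades each factor [x] for a step in [m]. Four steps give the factors m + 1, ..., m +
    4, each at most m + 4. *)
Lemma poisson_moment_le m x : 0 <= x -> x ^+ 4 * poisson m x <= (m%:R + 4) ^+ 4.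
Proof.
move=> x0; rewrite (_ : x ^+ 4 * _ = x * (x * (x * (x * poisson m x)))); last by ring.
have e n c : x * (c * poisson n x) = (c * n.+1%:R) * poisson n.+1 x.
  by rewrite mulrCA poissonS mulrA.
rewrite poissonS !e.
have p1 := poisson_le1 m.+4 x0; have p0 := poisson_ge0 m.+4 x0.
apply: le_trans (_ : m.+1%:R * m.+2%:R * m.+3%:R * m.+4%:R * 1 <= _).
  by rewrite ler_wpM2l.
rewrite mulr1 -!natr1 !exprS expr0 mulr1 !mulrA.
have m0 : 0 <= m%:R :> R by rewrite ler0n.
by rewrite !ler_pM ?mulr_ge0 ?addr_ge0//; lra.
Qed.

(** The opposite trade, of powers of [m] for powers of [x]: induction on [j] from (m + 2) p_{m+1}(x)
    = p_{m+1}(x) + x p_m(x). *)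
Lemma poisson_tail_le j : exists2 c : R, 0 <= c &
  forall m x, 0 <= x -> m.+1%:R ^+ j * poisson m x <= c * (1 + x) ^+ j.
Proof.
elim: j => [|j [c c0 IH]].
  by exists 1 => // m x x0; rewrite !expr0 !mul1r poisson_le1.
exists (2 ^+ j * c + 1); first by rewrite addr_ge0 ?mulr_ge0 ?exprn_ge0.
move=> [|m] x x0.
  rewrite expr1n mul1r; apply: (le_trans (poisson_le1 0 x0)).
  have h : 1 <= (1 + x) ^+ j.+1 by rewrite exprn_ege1// lerDl.
  by apply: (le_trans h); rewrite ler_peMl ?(le_trans ler01 h)// lerDr mulr_ge0 ?exprn_ge0.
have h1 := IH m.+1 _ x0; have h2 := IH m _ x0.
(* From m + 2 <= 2 (m + 1): it brings the power to the base [m.+1], for which the induction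
   hypothesis at [m] is stated. *)
have h3 : m.+2%:R ^+ j <= 2 ^+ j * m.+1%:R ^+ j :> R.
  rewrite -exprMn lerXn2r ?nnegrE ?mulr_ge0//.
  by have := ler0n R m; rewrite -!natr1; lra.
have x1 : 0 <= (1 + x) ^+ j by rewrite exprn_ge0// addr_ge0.
have two : 1 <= 2 ^+ j :> R by rewrite exprn_ege1// ler1n.
have -> : m.+2%:R ^+ j.+1 * poisson m.+1 x =
    m.+2%:R ^+ j * poisson m.+1 x + m.+2%:R ^+ j * (x * poisson m x).
  have e2 : m.+2%:R = m.+1%:R + 1 :> R by rewrite natr1.
  rewrite poissonS exprS {1}e2; move: (m.+2%:R ^+ j) (m.+1%:R : R) (poisson _ _) => A B p.
  by ring.
have h4 : m.+2%:R ^+ j * (x * poisson m x) <= 2 ^+ j * (x * (c * (1 + x) ^+ j)).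
  apply: le_trans (_ : 2 ^+ j * m.+1%:R ^+ j * (x * poisson m x) <= _).
    by apply: ler_wpM2r => //; apply: mulr_ge0 => //; exact: poisson_ge0.
  by rewrite -mulrA ler_wpM2l ?exprn_ge0// mulrCA ler_wpM2l.
apply: le_trans (lerD h1 h4) _; rewrite exprS.
have h5 : c * (1 + x) ^+ j <= 2 ^+ j * (c * (1 + x) ^+ j).
  by rewrite ler_peMl// mulr_ge0.
have h6 : 0 <= (1 + x) * (1 + x) ^+ j by rewrite mulr_ge0// addr_ge0.
move: h5 h6; move: ((1 + x) ^+ j) (2 ^+ j) => A B; lra.
Qed.

End Poisson.

Section Decay.
Context (R : realType).
Local Notation C := R[i].
Local Notation leb1 := (@leb1 R).
Local Notation leb2 := (@leb2 R).
Implicit Types (f : C -> C -> C).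

(** An integrable function on the plane that splits into factors of one real variable. It dominates
    (1 + |w|^2)^-2, which is how bounds are converted to it in [weight_le]. *)
Definition weight (w : C) : R :=
  (1 + complex.Re w ^+ 2)^-1 * (1 + complex.Im w ^+ 2)^-1.

Lemma weight_gt0 w : 0 < weight w.
Proof. by rewrite mulr_gt0 ?invr_gt0 ?ltr_pwDl ?sqr_ge0. Qed.

Lemma weight_le w (a c : R) : 0 <= a -> a * (1 + sqnorm w) ^+ 2 <= c -> a <= c * weight w.
Proof.
move=> a0 h; rewrite /weight -invfM ler_pdivlMr; last by rewrite mulr_gt0 ?ltr_pwDl ?sqr_ge0.
apply: le_trans h; rewrite ler_wpM2l// /sqnorm expr2.
have x0 := sqr_ge0 (complex.Re w); have y0 := sqr_ge0 (complex.Im w).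
by rewrite ler_pM ?addr_ge0//; lra.
Qed.

Lemma weight_conj w : weight w^* = weight w.
Proof. by rewrite /weight Re_conj Im_conj sqrrN. Qed.

Definition damped_ket m (w : C) : R := cmod (ket m w) * expR (- (sqnorm w / 2)).

Lemma damped_ket_ge0 m w : 0 <= damped_ket m w.
Proof. by rewrite mulr_ge0 ?cmod_ge0 ?expR_ge0. Qed.

Lemma damped_ket2 m w : damped_ket m w ^+ 2 = poisson m (sqnorm w).
Proof.
rewrite /damped_ket exprMn cmod_ket expr_div_n sqr_sqrtr// -expRM_natl /poisson.
rewrite -exprM mulnC exprM cmod2; congr (_ * expR _).
by rewrite mulrN mulrC divfK// pnatr_eq0.
Qed.

Lemma damped_ket_le1 m w : damped_ket m w <= 1.
Proof.
rewrite -(@ler_pXn2r _ 2) ?nnegrE ?damped_ket_ge0// expr1n damped_ket2.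
exact: poisson_le1 (sqnorm_ge0 w).
Qed.

(** With x = |w|^2 the damped ket is at most 1 and, times x^2, at most (m + 4)^2 <= 2 m^2 + 32. As
    (1 + x)^2 <= 2 + 2 x^2, times (1 + x)^2 it is at most 66 + 4 m^2, whence the 66. *)
Lemma damped_ket_le m w : damped_ket m w <= 66 * (1 + m%:R ^+ 2) * weight w.
Proof.
apply: weight_le (damped_ket_ge0 _ _) _.
have h : damped_ket m w * sqnorm w ^+ 2 <= (m%:R + 4) ^+ 2.
  have an := mulr_ge0 (damped_ket_ge0 m w) (sqr_ge0 (sqnorm w)).
  rewrite -(@ler_pXn2r _ 2) ?nnegrE ?sqr_ge0//.
  rewrite exprMn damped_ket2 -!exprM mulrC; exact: poisson_moment_le (sqnorm_ge0 w).
have a1 := damped_ket_le1 m w; have a0 := damped_ket_ge0 m w.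
have m0 : 0 <= m%:R :> R by rewrite ler0n.
have h2 := mulr_ge0 a0 (sqr_ge0 (1 - sqnorm w)).
move: h h2; rewrite !expr2; move: (damped_ket m w) (sqnorm w) a0 a1 => a x a0 a1 h h2.
have h3 := sqr_ge0 (m%:R - 4 : R); rewrite expr2 in h3.
by nra.
Qed.

(** The induction runs on the sharper bound 3 - 2 / (n + 1), whose increments telescope. *)
Lemma sum_oneDsqrV_le N : \sum_(m < N) (1 + m%:R ^+ 2)^-1 <= 3 :> R.
Proof.
suff h n : \sum_(m < n.+1) (1 + m%:R ^+ 2)^-1 <= 3 - 2 / n.+1%:R :> R.
  case: N => [|n]; first by rewrite big_ord0.
  by apply: le_trans (h n) _; rewrite gerBl divr_ge0.
elim: n => [|n IH]; first by rewrite big_ord1 expr0n addr0 invr1; lra.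
rewrite big_ord_recr /=; apply: le_trans (lerD IH (lexx _)) _.
have n0 : 0 <= n%:R :> R by rewrite ler0n.
rewrite -!natr1; set x : R := n%:R in n0 *.
have x1 : 0 < x + 1 by lra.
have x2 : 0 < x + 1 + 1 by lra.
have h : (1 + (x + 1) ^+ 2)^-1 <= 2 / (x + 1) - 2 / (x + 1 + 1).
  have -> : 2 / (x + 1) - 2 / (x + 1 + 1) = 2 / ((x + 1) * (x + 1 + 1)).
    by field; rewrite !gt_eqF.
  rewrite ler_pdivlMr ?mulr_gt0// mulrC ler_pdivrMr; last by rewrite ltr_pwDl ?sqr_ge0.
  by rewrite expr2; nra.
lra.
Qed.

Definition damping (w : C) : R := expR (- (sqnorm w / 2)).

Lemma damping_ge0 w : 0 <= damping w. Proof. exact: expR_ge0. Qed.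

Definition Phi_weight r m n : R := ((1 + m%:R ^+ 2) * (1 + n%:R ^+ 2)) ^+ r.

(* [|c| q <= (t |c|^2 q^4 + q^-2 / t) / 2] by AM-GM, where [q] is the weight. *)
Lemma coef_sum_damped_le f (t p : R) N (w0 w1 : C) : 0 < t ->
  \sum_(m < N) \sum_(n < N) Phi_weight 4 m n * sqnorm (coef f m n) <= p ->
  cmod (coef_sum f N w0 w1) * (damping w0 * damping w1) <=
  66 * 66 * (t * p + 9 / t) * (weight w0 * weight w1).
Proof.
move=> t0 hp.
have term m n : cmod (ket m w0 * ket n w1 * coef f m n) * (damping w0 * damping w1) <=
    66 * 66 * (weight w0 * weight w1) * (t * (Phi_weight 4 m n * sqnorm (coef f m n)) +
      t^-1 * ((1 + m%:R ^+ 2)^-1 * (1 + n%:R ^+ 2)^-1)).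
  rewrite (cmodM _ (coef f m n)) (cmodM (ket m w0)) (_ : _ * _ = damped_ket m w0 * damped_ket n w1 * cmod (coef f m n)); last first.
    by rewrite /damped_ket /damping; ring.
  have w00 := weight_gt0 w0; have w10 := weight_gt0 w1.
  have m1 : 1 <= 1 + m%:R ^+ 2 :> R by rewrite lerDl sqr_ge0.
  have n1 : 1 <= 1 + n%:R ^+ 2 :> R by rewrite lerDl sqr_ge0.
  apply: le_trans (_ : (66 * (1 + m%:R ^+ 2) * weight w0) * (66 * (1 + n%:R ^+ 2) * weight w1) *
      cmod (coef f m n) <= _).
    rewrite ler_wpM2r ?cmod_ge0//.
    by apply: ler_pM; rewrite ?damped_ket_ge0 ?damped_ket_le.
  rewrite (_ : _ * cmod _ = 66 * 66 * (weight w0 * weight w1) *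
    ((1 + m%:R ^+ 2) * (1 + n%:R ^+ 2) * cmod (coef f m n))); last by ring.
  have ww : 0 <= weight w0 * weight w1 := ltW (mulr_gt0 w00 w10).
  apply: ler_wpM2l; first by apply: mulr_ge0 => //; lra.
  rewrite /Phi_weight -cmod2 -invfM.
  have q1 : 1 <= (1 + m%:R ^+ 2) * (1 + n%:R ^+ 2) :> R by rewrite mulr_ege1.
  move: ((1 + m%:R ^+ 2) * (1 + n%:R ^+ 2)) q1 (cmod_ge0 (coef f m n)) => q q1.
  move: (cmod _) => c c0.
  have q0 : 0 < q by lra.
  have h1 : q^-1 ^+ 2 <= q^-1 by rewrite expr2 ler_piMl ?invr_ge0 ?invf_le1// ltW.
  have h2 : 0 <= t^-1 * (t * (c * q ^+ 2) - q^-1) ^+ 2 by rewrite mulr_ge0 ?invr_ge0 ?sqr_ge0// ltW.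
  have E : t^-1 * (t * (c * q ^+ 2) - q^-1) ^+ 2 =
      t * (q ^+ 4 * c ^+ 2) + t^-1 * q^-1 ^+ 2 - 2 * (q * c).
    by field; rewrite !gt_eqF.
  rewrite E in h2.
  have h3 : t^-1 * q^-1 ^+ 2 <= t^-1 * q^-1 by rewrite ler_wpM2l ?invr_ge0 ?(ltW t0).
  have h4 : 0 <= q * c by rewrite mulr_ge0// ltW.
  by lra.
have d0 : 0 <= damping w0 * damping w1 by rewrite mulr_ge0 ?damping_ge0.
apply: le_trans (_ : \sum_(m < N) \sum_(n < N) 66 * 66 * (weight w0 * weight w1) *
    (t * (Phi_weight 4 m n * sqnorm (coef f m n)) +
      t^-1 * ((1 + m%:R ^+ 2)^-1 * (1 + n%:R ^+ 2)^-1)) <= _).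
  apply: le_trans (ler_wpM2r d0 (cmod_sum _ _ _)) _; rewrite mulr_suml; apply: ler_sum => m _.
  apply: le_trans (ler_wpM2r d0 (cmod_sum _ _ _)) _; rewrite mulr_suml; apply: ler_sum => n _.
  exact: term.
under eq_bigr do rewrite -mulr_sumr big_split /= -!mulr_sumr.
rewrite -mulr_sumr big_split /= -!mulr_sumr -mulr_suml.
have ww : 0 <= weight w0 * weight w1 by rewrite ltW// mulr_gt0 ?weight_gt0.
rewrite [leRHS]mulrAC; apply: ler_wpM2l; first by apply: mulr_ge0 => //; lra.
have s0 : 0 <= \sum_(m < N) (1 + m%:R ^+ 2)^-1 :> R.
  by apply: sumr_ge0 => m _; rewrite invr_ge0 addr_ge0 ?sqr_ge0.
rewrite lerD ?ler_wpM2l ?(ltW t0)// mulrC ler_wpM2r ?invr_ge0 ?(ltW t0)//.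
(* Each of the two sums of 1 / (1 + m^2) is at most 3. *)
rewrite (_ : 9 = 3 * 3 :> R); last by ring.
by rewrite ler_pM ?sum_oneDsqrV_le.
Qed.

(** [t] is kept free: in the proof of continuity on [Phi] it is chosen large and [p] correspondingly
    small, so that both terms become small. *)
Lemma Hspace_damped_le f (t p : R) (w0 w1 : C) : Hspace f -> 0 < t ->
  (forall N, \sum_(m < N) \sum_(n < N) Phi_weight 4 m n * sqnorm (coef f m n) <= p) ->
  cmod (f w0 w1) * (damping w0 * damping w1) <=
  66 * 66 * (t * p + 9 / t) * (weight w0 * weight w1).
Proof.
move=> Hf t0 hp; set K := (X in _ <= X).
have d0 : 0 <= damping w0 * damping w1 by rewrite mulr_ge0 ?damping_ge0.
have h : (fun N => K + cmod (coef_sum f N w0 w1 - f w0 w1) * (damping w0 * damping w1)) @ \oo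
    --> K + 0 * (damping w0 * damping w1).
  apply: cvgD; first exact: cvg_cst.
  by apply: cvgM; [exact: coef_sum_cvg|exact: cvg_cst].
rewrite mul0r addr0 in h; rewrite -[leRHS](cvg_lim _ h)//.
apply: limr_ge; first by apply/cvg_ex; exists K.
apply: nearW => N.
apply: le_trans (_ : (cmod (coef_sum f N w0 w1) + cmod (coef_sum f N w0 w1 - f w0 w1)) *
  (damping w0 * damping w1) <= _).
  rewrite ler_wpM2r//; rewrite {1}(_ : f w0 w1 = coef_sum f N w0 w1 - (coef_sum f N w0 w1 - f w0 w1)).
    exact: cmodB.
  by ring.
by rewrite mulrDl lerD2r; exact: coef_sum_damped_le.
Qed.

Lemma Phi_norm2_ge r f (c : R) N : (Phi_norm2 r f <= c%:E)%E ->
  \sum_(m < N) \sum_(n < N) Phi_weight r m n * sqnorm (coef f m n) <= c.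
Proof.
move=> h; rewrite -lee_fin; apply: le_trans h.
have t0 m n : (0 <= (Phi_weight r m n * sqnorm (coef f m n))%:E)%E.
  by rewrite lee_fin mulr_ge0 ?sqnorm_ge0// exprn_ge0// mulr_ge0 ?addr_ge0 ?sqr_ge0.
rewrite -sumEFin -(big_mkord xpredT (fun m => (\sum_(n < N) Phi_weight r m n * sqnorm (coef f m n))%:E)).
apply: le_trans (_ : (\sum_(0 <= m < N) \sum_(0 <= n <oo) (Phi_weight r m n * sqnorm (coef f m n))%:E <= _)%E).
  apply: lee_sum => m _; rewrite -sumEFin -(big_mkord xpredT (fun n => (Phi_weight r m n * sqnorm (coef f m n))%:E)).
  by apply: nneseries_lim_ge => n _ _; exact: t0.
by apply: nneseries_lim_ge => m _ _; apply: nneseries_ge0 => n _ _; exact: t0.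
Qed.

End Decay.

(** * Tempered functions and the Bell vectors *)

Section Tempered.
Context (R : realType).
Local Notation C := R[i].
Local Notation leb1 := (@leb1 R).
Local Notation leb2 := (@leb2 R).
Implicit Types (f g B : C -> C -> C).

Definition damp2 (w0 w1 : C) : R := damping w0 * damping w1.

Lemma damp2_ge0 w0 w1 : 0 <= damp2 w0 w1.
Proof. by rewrite mulr_ge0 ?damping_ge0. Qed.

Lemma damp2_conj w0 w1 : damp2 w0^* w1^* = damp2 w0 w1.
Proof. by rewrite /damp2 /damping !sqnorm_conj. Qed.

Lemma gauss_damp2 w0 w1 : gauss w0 w1 = (pi^-1 * pi^-1) * (damp2 w0 w1 * damp2 w0 w1).
Proof.
have E w : expR (- sqnorm w) = damping w * damping w.
  by rewrite /damping -expRD; congr expR; rewrite -opprD -splitr.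
by rewrite /gauss /damp2 !E; ring.
Qed.

Definition wave f (u : (R * R) * (R * R)) : C := f (u0 u)^* (u1 u)^*.

Definition damped f (u : (R * R) * (R * R)) : R := cmod (wave f u) * damp2 (u0 u) (u1 u).

(** The vectors that pair absolutely with every [B] of bounded damped modulus: [gauss] is pi^-2
    times the square of [damp2], one factor for each vector. *)
Definition tempered f := cmeasurable (wave f) /\ leb2.-integrable setT (EFin \o damped f).

Lemma damped_ge0 f u : 0 <= damped f u.
Proof. by rewrite mulr_ge0 ?cmod_ge0 ?damp2_ge0. Qed.

Lemma measurable_damp2 : measurable_fun setT (fun u => damp2 (@u0 R u) (u1 u)).
Proof.
have h (v : (R * R) * (R * R) -> C) : cmeasurable v -> measurable_fun setT (fun u => damping (v u)).
  move=> mv; apply: (measurableT_comp (@measurable_expR R)); apply: measurable_funN.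
  by apply: measurable_funM => //; exact: measurable_sqnorm.
by apply: measurable_funM; apply: h; [exact: cmeasurable_u0|exact: cmeasurable_u1].
Qed.

Lemma measurable_damped f : cmeasurable (wave f) -> measurable_fun setT (damped f).
Proof.
by move=> mf; apply: measurable_funM; [exact: measurable_cmod|exact: measurable_damp2].
Qed.

Lemma braket_integrandE f B : mu_integrand (braket_integrand f B) =
  (fun u => (wave f u)^* * wave B u * ofR (gauss (u0 u) (u1 u))).
Proof. by []. Qed.

Lemma braket_bound f B (c : R) : tempered f -> cmeasurable (wave B) ->
  (forall u, damped B u <= c) ->
  mu_integrable (braket_integrand f B) /\
  cmod (braket f B) <= 2 * (pi^-1 * pi^-1 * c * (\int[leb2]_u damped f u)%R).
Proof.
move=> [mf tf] mB Bc.
have p0 : 0 <= pi^-1 * pi^-1 :> R by rewrite mulr_ge0// invr_ge0 pi_ge0.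
have b u : cmod (mu_integrand (braket_integrand f B) u) <= pi^-1 * pi^-1 * c * damped f u.
  rewrite braket_integrandE !cmodM cmod_conj cmod_ofR (ger0_norm (gauss_ge0 _ _)).
  rewrite gauss_damp2 [leLHS](_ : _ = (pi^-1 * pi^-1) * damped f u * damped B u).
    rewrite [leRHS]mulrAC; apply: ler_wpM2l => //.
    by apply: mulr_ge0 => //; exact: damped_ge0.
  by rewrite /damped; ring.
have i := rintegrableZ (pi^-1 * pi^-1 * c) tf.
have m : cmeasurable (mu_integrand (braket_integrand f B)).
  rewrite braket_integrandE; apply: cmeasurableM.
    by apply: cmeasurableM => //; exact: cmeasurable_conj.
  exact: cmeasurable_ofR (@measurable_gauss R).
have ic : mu_integrable (braket_integrand f B) by apply: (le_cintegrable _ _ i).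
split=> //.
have <- : (\int[leb2]_u (pi^-1 * pi^-1 * c * damped f u) =
  pi^-1 * pi^-1 * c * \int[leb2]_u damped f u)%R by apply: RintegralZl.
by apply: (cmod_cintegral_le _ _ i).
Qed.

Definition weight2 (u : (R * R) * (R * R)) : R := weight (u0 u) * weight (u1 u).

Lemma integrable_weight2 : leb2.-integrable setT (EFin \o weight2).
Proof.
by have [] := integrable_prodM (@integrable_plane_weight R) (@integrable_plane_weight R).
Qed.

Lemma Hspace_damped_weight f (t p : R) u : Hspace f -> 0 < t ->
  (forall N, \sum_(m < N) \sum_(n < N) Phi_weight R 4 m n * sqnorm (coef f m n) <= p) ->
  damped f u <= 66 * 66 * (t * p + 9 / t) * weight2 u.
Proof.
move=> Hf t0 hp; have := Hspace_damped_le (u0 u)^* (u1 u)^* Hf t0 hp.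
by rewrite !weight_conj -/(damp2 _ _) damp2_conj.
Qed.

Lemma Hspace_tempered f (t p : R) : Hspace f -> 0 < t ->
  (forall N, \sum_(m < N) \sum_(n < N) Phi_weight R 4 m n * sqnorm (coef f m n) <= p) ->
  tempered f /\ (\int[leb2]_u damped f u <=
    66 * 66 * (t * p + 9 / t) * \int[leb2]_u weight2 u)%R.
Proof.
move=> Hf t0 hp.
have mf : cmeasurable (wave f) by exact: cmeasurable_conj_separately (entire2_separately Hf.1).
have i := rintegrableZ (66 * 66 * (t * p + 9 / t)) integrable_weight2.
have b u : `|damped f u| <= 66 * 66 * (t * p + 9 / t) * weight2 u.
  by rewrite (ger0_norm (damped_ge0 _ _)); exact: Hspace_damped_weight.
have tf : tempered f.
  by split=> //; apply: (le_rintegrable _ _ i) => //; exact: measurable_damped.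
split=> //.
have <- : (\int[leb2]_u (66 * 66 * (t * p + 9 / t) * weight2 u) =
  66 * 66 * (t * p + 9 / t) * \int[leb2]_u weight2 u)%R.
  by apply: RintegralZl => //; exact: integrable_weight2.
apply: le_rintegral => //; first exact: tf.2.
by move=> u; apply: le_trans (ler_norm _) (b u).
Qed.

Lemma Phi_tempered f : Phi f -> tempered f.
Proof.
move=> [Hf /(_ 4%N) oo].
have n0 : (0 <= Phi_norm2 4 f)%E.
  apply: nneseries_ge0 => m _ _; apply: nneseries_ge0 => n _ _.
  by rewrite lee_fin mulr_ge0 ?sqnorm_ge0// exprn_ge0// mulr_ge0 ?addr_ge0 ?sqr_ge0.
have := @Hspace_tempered f 1 (fine (Phi_norm2 4 f)) Hf ltr01.
move=> h; apply: (h _).1 => N; apply: Phi_norm2_ge.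
by rewrite fineK// ge0_fin_numE.
Qed.

Lemma HspaceB f g : Hspace f -> Hspace g -> Hspace (fun w0 w1 => f w0 w1 - g w0 w1).
Proof.
move=> Hf Hg; split.
  by move=> z; apply: differentiableB; [exact: Hf.1|exact: Hg.1].
have sf := entire2_separately Hf.1; have sg := entire2_separately Hg.1.
have i := rintegrableD (rintegrableZ 2 (Hspace_integrable Hf)) (rintegrableZ 2 (Hspace_integrable Hg)).
apply: (le_cintegrable _ _ i).
  apply: cmeasurableM; last exact: cmeasurable_ofR (@measurable_gauss R).
  apply: cmeasurable_ofR; apply: measurable_sqnorm.
  exact: cmeasurableB (cmeasurable_conj_separately sf) (cmeasurable_conj_separately sg).
move=> u; rewrite /mu_integrand -ofRM cmod_ofR ger0_norm; last first.
  by apply: mulr_ge0; [exact: sqnorm_ge0|exact: gauss_ge0].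
rewrite !(mulrA 2) -mulrDl; apply: ler_wpM2r; first exact: gauss_ge0.
rewrite -!cmod2; have h := cmodB (f (toC u.1)^* (toC u.2)^*) (g (toC u.1)^* (toC u.2)^*).
move: h (cmod_ge0 (f (toC u.1)^* (toC u.2)^* - g (toC u.1)^* (toC u.2)^*)).
rewrite /u0 /u1; move: (cmod _) (cmod _) (cmod _) => a b c h a0.
have h2 : c ^+ 2 <= (b + a) ^+ 2 by rewrite lerXn2r ?nnegrE// (le_trans a0).
by have := sqr_ge0 (b - a); move: h2; rewrite !expr2; lra.
Qed.

Lemma bounded_generalized_vector B (c : R) : cmeasurable (wave B) -> 0 <= c ->
  (forall u, damped B u <= c) -> generalized_vector B.
Proof.
move=> mB c0 Bc.
have ib f : Phi f -> mu_integrable (braket_integrand f B).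
  by move=> /Phi_tempered tf; have [] := braket_bound tf mB Bc.
split; first exact: ib.
split.
  move=> a f g Pf Pg; rewrite /braket /mu_integral -(cintegralZ _ (ib f Pf)).
  rewrite -(cintegralD (cintegrableZ _ (ib f Pf)) (ib g Pg)).
  congr (cintegral _ _); apply/funext => u.
  by rewrite !braket_integrandE /wave rmorphD rmorphM /=; ring.
move=> f Pf e e0.
set S := (\int[leb2]_u weight2 u)%R.
have S0 : 0 <= S.
  apply: Rintegral_ge0 => u _; rewrite mulr_ge0// ltW//; exact: weight_gt0.
pose K := 2 * (pi^-1 * pi^-1 * c * (66 * 66 * (S + 1))) + 1 : R.
have K1 : 1 <= K.
  rewrite lerDr !mulr_ge0 ?invr_ge0 ?pi_ge0// addr_ge0//.
have K0 : 0 < K := lt_le_trans ltr01 K1.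
(* The pairing is at most K (t p + 9 / t) with p = delta^2. This [t] makes the second term e / (2
   K), and p = e / (4 K t) makes the first e / (4 K); the total is 3 e / 4. *)
pose t := 18 * K / e : R.
have t0 : 0 < t by apply: divr_gt0 => //; apply: mulr_gt0.
have d0 : 0 < e / (4 * K * t) by apply: divr_gt0 => //; apply: mulr_gt0 => //; apply: mulr_gt0.
exists 4%N, (Num.sqrt (e / (4 * K * t))); rewrite sqrtr_gt0; split=> // g Pg.
rewrite sqr_sqrtr ?(ltW d0)// => /ltW gf.
have H := HspaceB Pg.1 Pf.1.
have [tgf hgf] := Hspace_tempered H t0 (fun N => Phi_norm2_ge N gf).
have [_ hb] := braket_bound tgf mB Bc.
have E : braket (fun w0 w1 => g w0 w1 - f w0 w1) B = braket g B - braket f B.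
  rewrite /braket /mu_integral -(cintegralB (ib g Pg) (ib f Pf)).
  congr (cintegral _ _); apply/funext => u.
  by rewrite !braket_integrandE /wave rmorphB /=; ring.
rewrite -E -cmod2 ltr_pXn2r ?nnegrE ?cmod_ge0 ?(ltW e0)//.
apply: le_lt_trans hb _.
have q0 : 0 <= pi^-1 * pi^-1 * c :> R by rewrite !mulr_ge0 ?invr_ge0 ?pi_ge0.
set A := t * (e / (4 * K * t)) + 9 / t.
have AE : A = 3 / 4 * (e / K).
  by rewrite /A /t; move: K0; clearbody K => K0; field; rewrite !gt_eqF.
apply: le_lt_trans (_ : 2 * (pi^-1 * pi^-1 * c * (66 * 66 * A * S)) < _).
  by rewrite ler_wpM2l// ler_wpM2l.
have A0 : 0 < A by rewrite AE; apply: mulr_gt0; [lra|exact: divr_gt0].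
apply: le_lt_trans (_ : K * A < e); last first.
  rewrite AE mulrCA [K * _]mulrC divfK ?gt_eqF//.
  by lra.
rewrite (_ : 2 * _ = 2 * (pi^-1 * pi^-1 * c * (66 * 66 * S)) * A); last by ring.
apply: ler_wpM2r; first exact: ltW.
rewrite /K; have : pi^-1 * pi^-1 * c * (66 * 66 * S) <= pi^-1 * pi^-1 * c * (66 * 66 * (S + 1)).
  by rewrite ler_wpM2l// ler_wpM2l// lerDl.
lra.
Qed.

End Tempered.

(** For Fubini on the product of the plane of [alpha] with the space of the two modes. *)
Lemma leb2_sigma_finite (R : realType) : sigma_finite setT (@leb2 R).
Proof.
have /sigma_finiteP[F [TF ndF Foo]] := @leb1_sigma_finite R.
exists (fun n => F n `*` F n).
  rewrite -setXTT TF predeqE => -[x y]; split.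
    move=> [/= [n _ Fnx] [k _ Gky]]; exists (maxn n k) => //; split.
    - by move: x Fnx; exact/subsetPset/ndF/leq_maxl.
    - by move: y Gky; exact/subsetPset/ndF/leq_maxr.
  by move=> [n _ []/= ? ?]; split; exists n.
move=> k; have [mF Fk] := Foo k; split; first exact: measurableX.
by rewrite /leb2 product_measure1E// lte_mul_pinfty// ge0_fin_numE.
Qed.

HB.instance Definition _ (R : realType) :=
  Measure_isSigmaFinite.Build _ _ _ (@leb2 R) (@leb2_sigma_finite R).

(** * Pairings with Bell vectors and their superpositions *)

Section Bell.
Context (R : realType).
Local Notation C := R[i].
Local Notation leb1 := (@leb1 R).
Local Notation leb2 := (@leb2 R).
Implicit Types (f g B : C -> C -> C) (a : C) (E : C -> C).

(* [bell_series E a] is [D(a) \otimes 1] applied to [E (w0 w1)]. *)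
Definition bell_series E a : C -> C -> C := fun w0 w1 =>
  ofR (expR (- sqnorm a / 2)) * cexp (a * w0) * E ((w0 - a^*) * w1).

Lemma bell_sumE N a : bell_sum N a = bell_series (exp_sum N) a.
Proof.
apply/funext => w0; apply/funext => w1; rewrite /bell_sum /bell_series exp_sum_ket mulr_sumr.
by apply: eq_bigr => n _; rewrite /tensor /displacement mulrA.
Qed.

Lemma bellE a w0 w1 : bell a w0 w1 = ofR (Num.sqrt pi)^-1 * bell_series (@cexp R) a w0 w1.
Proof.
rewrite /bell /bell_series mulrBl cexpD -!mulrA; congr (_ * (_ * _)).
rewrite [RHS]mulrC mulrA mulNr; congr (_ * _).
Qed.

(** Completing the square moves the displacement into the Gaussian, after which all bounds are
    uniform in [a]. *)
Lemma damped_bell_series E a u : damped (bell_series E a) u =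
  damping (u0 u - a) * damping (u1 u) * cmod (E ((u0 u - a)^* * (u1 u)^*)).
Proof.
rewrite /damped /wave /bell_series !cmodM cmod_ofR cmod_cexp (ger0_norm (expR_ge0 _)).
rewrite rmorphB /=.
have -> : damping (u0 u - a) = expR (- sqnorm a / 2) * expR (complex.Re (a * (u0 u)^*)) *
    damping (u0 u).
  by rewrite /damping -!expRD; congr expR; rewrite /sqnorm !ReImE; field.
by rewrite /damp2; ring.
Qed.

(** From |w0| |w1| <= (|w0|^2 + |w1|^2) / 2. A fraction 1 - k of the Gaussian survives: integrable
    for [k < 1], merely bounded for [k = 1]. *)
Lemma damping_mul_le (k : R) w0 w1 : k <= 1 -> 0 <= k ->
  damping w0 * damping w1 * expR (k * cmod (w0 * w1)) <=
  expR (- ((1 - k) / 2 * sqnorm w0)) * expR (- ((1 - k) / 2 * sqnorm w1)).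
Proof.
move=> k1 k0; rewrite /damping -!expRD ler_expR -!cmod2 cmodM.
have h : 0 <= k * (cmod w0 - cmod w1) ^+ 2 by rewrite mulr_ge0 ?sqr_ge0.
by move: h; rewrite !expr2; lra.
Qed.

Lemma damped_bell_series_le E a (k K : R) u : 0 <= k <= 1 -> 0 <= K ->
  (forall z, cmod (E z) <= K * expR (k * cmod z)) -> damped (bell_series E a) u <=
  K * (expR (- ((1 - k) / 2 * sqnorm (u0 u - a))) * expR (- ((1 - k) / 2 * sqnorm (u1 u)))).
Proof.
move=> /andP[k0 k1] K0 EK; rewrite damped_bell_series.
apply: le_trans (_ : K * (damping (u0 u - a) * damping (u1 u) *
    expR (k * cmod ((u0 u - a) * (u1 u)))) <= _).
  rewrite mulrCA; apply: ler_wpM2l; first by rewrite mulr_ge0 ?damping_ge0.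
  by apply: le_trans (EK _) _; rewrite !cmodM !cmod_conj.
by rewrite ler_wpM2l// damping_mul_le.
Qed.

Lemma damped_bell_series_le1 E a u : (forall z, cmod (E z) <= expR (cmod z)) ->
  damped (bell_series E a) u <= 1.
Proof.
move=> EK; have k1 : (0 <= 1 :> R) && (1 <= 1 :> R) by rewrite ler01 lexx.
have := @damped_bell_series_le E a 1 1 u k1 ler01.
rewrite subrr !mul0r oppr0 expR0 !mul1r; apply => z.
by rewrite !mul1r.
Qed.

Lemma cmeasurable_bell_series d (T : measurableType d) (al w0 w1 : T -> C) E :
  centire E -> cmeasurable al -> cmeasurable w0 -> cmeasurable w1 ->
  cmeasurable (fun t => bell_series E (al t) (w0 t) (w1 t)).
Proof.
move=> eE ma m0 m1; apply: cmeasurableM.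
  apply: cmeasurableM; last by apply: cmeasurable_cexp; exact: cmeasurableM.
  apply: cmeasurable_ofR; apply: (measurableT_comp (@measurable_expR R)).
  by apply: measurable_funM => //; apply: measurable_funN; exact: measurable_sqnorm.
apply: cmeasurable_centire_comp => //; apply: cmeasurableM => //.
by apply: cmeasurableB => //; exact: cmeasurable_conj.
Qed.

Lemma cmeasurable_wave_bell_series E a : centire E -> cmeasurable (wave (bell_series E a)).
Proof.
move=> eE; apply: (cmeasurable_bell_series eE (cmeasurable_cst _ a)).
  by apply: cmeasurable_conj; exact: cmeasurable_u0.
by apply: cmeasurable_conj; exact: cmeasurable_u1.
Qed.

Lemma tempered_bell_series E a (k K : R) : centire E -> 0 <= k < 1 -> 0 <= K ->
  (forall z, cmod (E z) <= K * expR (k * cmod z)) -> tempered (bell_series E a).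
Proof.
move=> eE /andP[k0 k1] K0 EK.
have mE := cmeasurable_wave_bell_series a eE.
split=> //; have kk : 0 < (1 - k) / 2 by lra.
have [ig _] := integral_gauss_plane kk; have [ia _] := integrable_translate (- a) ig.
have [i _] := integrable_prodM ia ig.
have pk : 0 < pi / ((1 - k) / 2) by rewrite divr_gt0 ?pi_gt0.
have iK := rintegrableZ (K * (pi / ((1 - k) / 2) * (pi / ((1 - k) / 2)))) i.
apply: (le_rintegrable _ _ iK); first exact: measurable_damped.
move=> u; rewrite (ger0_norm (damped_ge0 _ _)).
have k1' : 0 <= k <= 1 by rewrite k0 ltW.
apply: le_trans (damped_bell_series_le a u k1' K0 EK) _.
rewrite le_eqVlt; apply/orP; left; apply/eqP; rewrite -(mulrA K); congr (K * _).
rewrite /gauss1 (_ : toC (u.1.1 + complex.Re (- a), u.1.2 + complex.Im (- a)) = u0 u - a); last first.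
  by apply: complex_ext; rewrite /u0 /toC !ReImE.
rewrite -[toC u.2]/(u1 u); move: (expR _) (expR _) => x y.
have q0 : (1 - k) / 2 != 0 by rewrite gt_eqF.
move: q0; move: ((1 - k) / 2) => q q0.
have p0 : pi != 0 :> R by rewrite gt_eqF// pi_gt0.
by move: p0; move: (pi : R) => p p0; field; rewrite p0 q0.
Qed.

Lemma braketZr f B (c : C) : mu_integrable (braket_integrand f B) ->
  mu_integrable (braket_integrand f (fun w0 w1 => c * B w0 w1)) /\
  braket f (fun w0 w1 => c * B w0 w1) = c * braket f B.
Proof.
move=> i.
have e : mu_integrand (braket_integrand f (fun w0 w1 => c * B w0 w1)) =
    (fun u => c * mu_integrand (braket_integrand f B) u).
  by apply/funext => u; rewrite !braket_integrandE /wave; ring.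
rewrite /mu_integrable /braket /mu_integral e; split.
  exact: (cintegrableZ c i).
exact: (cintegralZ c i).
Qed.

Lemma braket_conj f g : mu_integrable (braket_integrand f g) ->
  mu_integrable (braket_integrand g f) /\ braket g f = (braket f g)^*.
Proof.
move=> i.
have e : mu_integrand (braket_integrand g f) =
    (fun u => (mu_integrand (braket_integrand f g) u)^*).
  apply/funext => u; rewrite !braket_integrandE !rmorphM /= conjCK conj_ofR.
  by rewrite [(wave g u)^* * _]mulrC.
rewrite /mu_integrable /braket /mu_integral e; split.
  exact: (cintegrable_conj i).
exact: (cintegral_conj i).
Qed.

Lemma damped_bell_le1 a u : damped (bell a) u <= (Num.sqrt pi)^-1.
Proof.
rewrite /damped /wave bellE cmodM cmod_ofR (ger0_norm _); last by rewrite invr_ge0 sqrtr_ge0.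
rewrite -mulrA -[leRHS]mulr1 ler_wpM2l ?invr_ge0 ?sqrtr_ge0//.
apply: (@damped_bell_series_le1 (@cexp R) a u) => z.
by rewrite cmod_cexp ler_expR (le_trans (ler_norm _)) ?Re_le_cmod.
Qed.

Lemma cmeasurable_bell d (T : measurableType d) (al w0 w1 : T -> C) :
  cmeasurable al -> cmeasurable w0 -> cmeasurable w1 ->
  cmeasurable (fun t => bell (al t) (w0 t) (w1 t)).
Proof.
move=> ma m0 m1; under eq_fun do rewrite bellE.
apply: cmeasurableM; first exact: cmeasurable_cst.
exact: cmeasurable_bell_series (@centire_cexp R) ma m0 m1.
Qed.

Lemma cmeasurable_wave_bell a : cmeasurable (wave (bell a)).
Proof.
apply: (cmeasurable_bell (cmeasurable_cst _ a)).
  by apply: cmeasurable_conj; exact: cmeasurable_u0.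
by apply: cmeasurable_conj; exact: cmeasurable_u1.
Qed.

Lemma bell_generalized_vector a : generalized_vector (bell a).
Proof.
apply: (@bounded_generalized_vector _ _ (Num.sqrt pi)^-1).
- exact: cmeasurable_wave_bell.
- by rewrite invr_ge0 sqrtr_ge0.
- exact: damped_bell_le1.
Qed.

Lemma braket_bell_integrable f a : tempered f -> mu_integrable (braket_integrand f (bell a)).
Proof.
by move=> tf; have [] := braket_bound tf (cmeasurable_wave_bell a) (damped_bell_le1 a).
Qed.

(** Every damped modulus is at most 1, so the damped [f] is a majorant, up to a constant. Applied to
    the partial sums of exp and to exp (t z) as [t] tends to 1. *)
Lemma braket_series_cvg f a (E : nat -> C -> C) (E0 : C -> C) : tempered f ->
  (forall n, centire (E n)) -> (forall n z, cmod (E n z) <= expR (cmod z)) ->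
  (forall z, (fun n => cmod (E n z - E0 z)) @ \oo --> (0 : R)) ->
  (fun n => cmod (braket f (bell_series (E n) a) - braket f (bell_series E0 a))) @ \oo --> (0 : R).
Proof.
move=> tf eE bE cE; have [mf itf] := tf.
have p0 : 0 <= pi^-1 * pi^-1 :> R by rewrite mulr_ge0// invr_ge0 pi_ge0.
have [] := @cdominated_cvg R _ _ leb2
  (fun n => mu_integrand (braket_integrand f (bell_series (E n) a)))
  (mu_integrand (braket_integrand f (bell_series E0 a)))
  (fun u => pi^-1 * pi^-1 * damped f u).
- move=> n; rewrite braket_integrandE; apply: cmeasurableM.
    apply: cmeasurableM; first exact: cmeasurable_conj mf.
    exact: cmeasurable_wave_bell_series.
  exact: cmeasurable_ofR (@measurable_gauss R).
- move=> u; rewrite !braket_integrandE.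
  set z := ((u0 u)^* - a^*) * (u1 u)^*.
  set c := cmod ((wave f u)^*) * (expR (- sqnorm a / 2) * cmod (cexp (a * (u0 u)^*))) *
    gauss (u0 u) (u1 u).
  have h : (fun n => c * cmod (E n z - E0 z)) @ \oo --> (c * 0 : R).
    by apply: cvgM; [exact: cvg_cst|exact: cE].
  rewrite mulr0 in h; move: h; apply: cvg_trans; apply: near_eq_cvg; apply: nearW => n.
  rewrite -mulrBl -mulrBr /wave /bell_series -/z -mulrBr !cmodM !cmod_ofR.
  by rewrite (ger0_norm (gauss_ge0 _ _)) (ger0_norm (expR_ge0 _)) /c; ring.
- move=> n u; rewrite braket_integrandE cmodM cmodM cmod_conj cmod_ofR (ger0_norm (gauss_ge0 _ _)).
  have h := damped_bell_series_le1 a u (bE n).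
  rewrite gauss_damp2 [leLHS](_ : _ = (pi^-1 * pi^-1) * damped f u * damped (bell_series (E n) a) u).
    rewrite -[leRHS]mulr1; apply: ler_wpM2l => //.
    by apply: mulr_ge0 => //; exact: damped_ge0.
  by rewrite /damped; ring.
- exact: rintegrableZ.
by move=> _.
Qed.

(** With the conjugate Bell coefficients of a vector as [k] it is the expansion of completeness;
    with a test function as [k] it is the vector of orthonormality. *)
Definition smear (k : R * R -> C) : C -> C -> C := fun w0 w1 =>
  cintegral leb1 (fun x => k x * bell (toC x) w0 w1).

Lemma bell_le a w0 w1 : cmod (bell a w0 w1) <= (Num.sqrt pi)^-1 / damp2 w0 w1.
Proof.
have d0 : 0 < damp2 w0 w1 by rewrite mulr_gt0 ?expR_gt0.
rewrite ler_pdivlMr//.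
have := damped_bell_le1 a ((complex.Re w0^*, complex.Im w0^*), (complex.Re w1^*, complex.Im w1^*)).
rewrite /damped /wave /u0 /u1 /toC /=.
have E w : Complex (complex.Re w) (complex.Im w) = w :> C by case: w.
by rewrite !E !conjCK damp2_conj.
Qed.

Lemma smear_integrable k w0 w1 : cintegrable leb1 k ->
  cintegrable leb1 (fun x => k x * bell (toC x) w0 w1).
Proof.
move=> /cintegrableP[mk ik].
apply: (le_cintegrable _ _ (rintegrableZ ((Num.sqrt pi)^-1 / damp2 w0 w1) ik)).
  apply: cmeasurableM => //; apply: cmeasurable_bell; first exact: cmeasurable_toC.
    exact: cmeasurable_cst.
  exact: cmeasurable_cst.
by move=> x; rewrite cmodM mulrC ler_wpM2r ?cmod_ge0 ?bell_le.
Qed.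

(** Fubini: as the damped Bell vectors are uniformly bounded, |k| times the damped [f] is an
    integrable majorant on the product space. *)
Lemma smear_braket k f : cintegrable leb1 k -> tempered f ->
  is_cintegral leb1 (fun x => k x * braket f (bell (toC x))) (braket f (smear k)) /\
  mu_integrable (braket_integrand f (smear k)).
Proof.
move=> ck tf; have [mk ik] := (cintegrableP _ _).1 ck; have [mf itf] := tf.
pose P (p : (R * R) * ((R * R) * (R * R))) : C :=
  k p.1 * mu_integrand (braket_integrand f (bell (toC p.1))) p.2.
have mP : cmeasurable P.
  apply: cmeasurableM; first exact: (cmeasurable_comp mk measurable_fst).
  apply: cmeasurableM; last first.
    apply: cmeasurable_ofR.
    exact: (measurableT_comp (@measurable_gauss R) measurable_snd).
  apply: cmeasurableM.
    by apply: cmeasurable_conj; exact: (cmeasurable_comp mf measurable_snd).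
  apply: cmeasurable_bell.
  - exact: (cmeasurable_comp (cmeasurable_toC R) measurable_fst).
  - by apply: cmeasurable_conj; exact: (cmeasurable_comp (@cmeasurable_u0 R) measurable_snd).
  - by apply: cmeasurable_conj; exact: (cmeasurable_comp (@cmeasurable_u1 R) measurable_snd).
have p0 : 0 <= pi^-1 * pi^-1 :> R by rewrite mulr_ge0// invr_ge0 pi_ge0.
have s0 : 0 <= (Num.sqrt pi)^-1 :> R by rewrite invr_ge0 sqrtr_ge0.
have [i0 _] := @integrable_prodM R _ _ _ _ leb1 leb2 _ _ ik itf.
have iP : cintegrable (leb1 \x leb2)%E P.
  apply: (le_cintegrable _ _ (rintegrableZ (pi^-1 * pi^-1 * (Num.sqrt pi)^-1) i0)) => //.
  move=> [x u]; rewrite /P /= cmodM braket_integrandE cmodM cmodM cmod_conj cmod_ofR.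
  rewrite (ger0_norm (gauss_ge0 _ _)) gauss_damp2.
  rewrite [leLHS](_ : _ = (pi^-1 * pi^-1 * (cmod (k x) * damped f u)) * damped (bell (toC x)) u).
    rewrite [leRHS]mulrAC; apply: ler_wpM2l; last exact: damped_bell_le1.
    by rewrite mulr_ge0// mulr_ge0 ?cmod_ge0 ?damped_ge0.
  by rewrite /damped; ring.
have [_ i1 e1] := cFubini1 iP; have [_ i2 e2] := cFubini2 iP.
have E1 : (fun x => cintegral leb2 (fun u => P (x, u))) =
    (fun x => k x * braket f (bell (toC x))).
  apply/funext => x; rewrite /P /=; exact: cintegralZ (braket_bell_integrable (toC x) tf).
have E2 : (fun u => cintegral leb1 (fun x => P (x, u))) =
    mu_integrand (braket_integrand f (smear k)).
  apply/funext => u; rewrite /P /= braket_integrandE.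
  transitivity (cintegral leb1 (fun x => ((wave f u)^* * ofR (gauss (u0 u) (u1 u))) *
      (k x * wave (bell (toC x)) u))).
    by congr (cintegral _ _); apply/funext => x; rewrite braket_integrandE; ring.
  rewrite (cintegralZ _ (smear_integrable (u0 u)^* (u1 u)^* ck)) /wave /smear.
  by ring.
rewrite E1 in i1 e1; rewrite E2 in i2 e2.
split; last exact: i2.
by split; [exact: i1|rewrite e1 -e2].
Qed.

End Bell.

(** * Completeness *)

Section Completeness.
Context (R : realType).
Local Notation C := R[i].
Local Notation leb1 := (@leb1 R).
Local Notation leb2 := (@leb2 R).
Implicit Types (f g : C -> C -> C) (a : C).

Lemma centire_exp_sum N : centire (@exp_sum R N).
Proof.
elim: N => [|N IH].
  rewrite (_ : exp_sum 0 = fun=> 0); first exact: centire_cst.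
  by apply/funext => z; rewrite /exp_sum big_ord0.
rewrite (_ : exp_sum N.+1 = fun z => exp_sum N z + (ofR N`!%:R)^-1 * z ^+ N).
  exact: centireD IH (centireMl _ (@centireX R N)).
by apply/funext => z; rewrite exp_sumS [_ / _]mulrC.
Qed.

Lemma bell_sum_cvg a (w0 w1 : C) :
  (fun N => ofR (Num.sqrt pi)^-1 * bell_sum N a w0 w1 : C^o) @ \oo --> (bell a w0 w1 : C^o).
Proof.
apply: cvg_cmod.
set c := ofR (Num.sqrt pi)^-1 * (ofR (expR (- sqnorm a / 2)) * cexp (a * w0)).
have h : (fun N => cmod c * cmod (exp_sum N ((w0 - a^*) * w1) - cexp ((w0 - a^*) * w1)))
    @ \oo --> (cmod c * 0 : R).
  by apply: cvgM; [exact: cvg_cst|exact: cvg_exp_sum].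
rewrite mulr0 in h; move: h; apply: cvg_trans; apply: near_eq_cvg; apply: nearW => N.
rewrite bell_sumE bellE /bell_series -cmodM; congr cmod.
by rewrite /c -!mulrA -mulrBr -mulrBr -mulrBr.
Qed.

Lemma cmod_cexp_le (z : C) : cmod (cexp z) <= expR (cmod z).
Proof. by rewrite cmod_cexp ler_expR (le_trans (ler_norm _)) ?Re_le_cmod. Qed.

Lemma braket_bell_series f a : tempered f ->
  mu_integrable (braket_integrand f (bell_series (@cexp R) a)) /\
  braket f (bell a) = ofR (Num.sqrt pi)^-1 * braket f (bell_series (@cexp R) a).
Proof.
move=> tf.
have [i _] := braket_bound tf (cmeasurable_wave_bell_series a (@centire_cexp R))
  (fun u => damped_bell_series_le1 a u cmod_cexp_le).
split=> //.
have [_ <-] := braketZr (ofR (Num.sqrt pi)^-1) i.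
by congr (braket f _); apply/funext => w0; apply/funext => w1; rewrite bellE.
Qed.

Lemma braket_bell_sum_cvg f a : tempered f ->
  (fun N => braket f (fun w0 w1 => ofR (Num.sqrt pi)^-1 * bell_sum N a w0 w1) : C^o)
    @ \oo --> (braket f (bell a) : C^o).
Proof.
move=> tf; apply: cvg_cmod.
have h := braket_series_cvg a tf centire_exp_sum (@cmod_exp_sum_le R) (@cvg_exp_sum R).
have {}h : (fun N => cmod (ofR (Num.sqrt pi)^-1 : C) * cmod (braket f (bell_series (exp_sum N) a) -
    braket f (bell_series (@cexp R) a))) @ \oo --> (cmod (ofR (Num.sqrt pi)^-1 : C) * 0 : R).
  by apply: cvgM; [exact: cvg_cst|exact: h].
rewrite mulr0 in h; move: h; apply: cvg_trans; apply: near_eq_cvg; apply: nearW => N.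
rewrite (braket_bell_series a tf).2 -cmodM mulrBr.
have [i _] := braket_bound tf (cmeasurable_wave_bell_series a (centire_exp_sum N))
  (fun u => damped_bell_series_le1 a u (@cmod_exp_sum_le R N)).
by rewrite bell_sumE (braketZr (ofR (Num.sqrt pi)^-1) i).2.
Qed.

Lemma bell_kernelE (u0 u1 v0 v1 a : C) : bell a u0^* u1^* * (bell a v0^* v1^*)^* =
  ofR pi^-1 * (cexp (- (a^* * a)) * cexp (u0^* * u1^*) * cexp (- a^* * u1^*) * cexp (a * u0^*)
    * cexp (v0 * v1) * cexp (- a * v1) * cexp (a^* * v0)).
Proof.
have -> : cexp (- (a^* * a)) = ofR (expR (- sqnorm a / 2)) * ofR (expR (- sqnorm a / 2)).
  rewrite -ofRM -expRD -cexp_ofR; congr cexp.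
  by apply: complex_ext; rewrite /sqnorm !ReImE; field.
have -> : ofR pi^-1 = ofR (Num.sqrt pi)^-1 * ofR (Num.sqrt pi)^-1 :> C.
  by rewrite -ofRM -invfM -expr2 sqr_sqrtr// pi_ge0.
have nE : (- a^*)^* = - a by apply: complex_ext; rewrite !ReImE ?opprK.
rewrite /bell !rmorphM /= !conj_ofR -!cexp_conj !rmorphM /= nE !conjCK.
by ring.
Qed.

Lemma bell_kernel_integral (u0 u1 v0 v1 : C) : is_cintegral leb1
  (fun x => let a := toC x in
     ofR pi^-1 * (cexp (- (a^* * a)) * cexp (u0^* * u1^*) * cexp (- a^* * u1^*)
       * cexp (a * u0^*) * cexp (v0 * v1) * cexp (- a * v1) * cexp (a^* * v0)))
  (cexp (u0^* * v0) * cexp (u1^* * v1)).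
Proof.
have [i e] := @gauss_exponential R 1 (u0^* - v1) (v0 - u1^*) ltr01.
pose c := cexp (u0^* * u1^*) * cexp (v0 * v1).
have E : (fun x : R * R => let a := toC x in
     ofR pi^-1 * (cexp (- (a^* * a)) * cexp (u0^* * u1^*) * cexp (- a^* * u1^*)
       * cexp (a * u0^*) * cexp (v0 * v1) * cexp (- a * v1) * cexp (a^* * v0))) =
  (fun x => c * (cexp ((u0^* - v1) * toC x) * cexp ((v0 - u1^*) * (toC x)^*) *
    ofR (gauss1 1 x))).
  apply/funext => x; cbv zeta; rewrite /gauss1; move: (toC x) => a.
  have -> : ofR (1 / pi * expR (- (1 * sqnorm a))) = ofR pi^-1 * cexp (- (a^* * a)).
    rewrite !mul1r ofRM -cexp_ofR; congr (_ * cexp _).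
    by apply: complex_ext; rewrite /sqnorm !ReImE; ring.
  have -> : cexp ((u0^* - v1) * a) = cexp (a * u0^*) * cexp (- a * v1).
    by rewrite -cexpD; congr cexp; ring.
  have -> : cexp ((v0 - u1^*) * a^*) = cexp (a^* * v0) * cexp (- a^* * u1^*).
    by rewrite -cexpD; congr cexp; ring.
  by rewrite /c; ring.
rewrite E; split; first exact: (cintegrableZ c i).
rewrite (cintegralZ c i) e ofR1 divr1 /c -!cexpD; congr cexp.
by ring.
Qed.

Lemma damped_bell a u : damped (bell a) u =
  (Num.sqrt pi)^-1 * damping (u0 u - (u1 u)^* - a).
Proof.
have s0 : 0 <= (Num.sqrt pi)^-1 :> R by rewrite invr_ge0 sqrtr_ge0.
have -> : damped (bell a) u = (Num.sqrt pi)^-1 * damped (bell_series (@cexp R) a) u.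
  by rewrite /damped /wave bellE cmodM cmod_ofR (ger0_norm s0) -mulrA.
rewrite damped_bell_series cmod_cexp; congr (_ * _).
rewrite /damping -!expRD; congr expR.
by rewrite /sqnorm !ReImE; field.
Qed.

Lemma integrable_damping (p : C) :
  leb1.-integrable setT (EFin \o (fun x => damping (p - toC x))) /\
  (\int[leb1]_x damping (p - toC x) = 2 * pi)%R.
Proof.
have k0 : 0 < 2^-1 :> R by rewrite invr_gt0.
have [i e] := integral_gauss_plane k0; have [it et] := integrable_translate (- p) i.
have E : (fun x => damping (p - toC x)) = (fun x : R * R => 2 * pi *
    gauss1 2^-1 (x.1 + complex.Re (- p), x.2 + complex.Im (- p))).
  apply/funext => x; rewrite /gauss1 /damping.
  have -> : 2 * pi * (2^-1 / pi * expR (- (2^-1 *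
      sqnorm (toC (x.1 + complex.Re (- p), x.2 + complex.Im (- p)))))) =
      expR (- (2^-1 * sqnorm (toC (x.1 + complex.Re (- p), x.2 + complex.Im (- p))))).
    have p0 : pi != 0 :> R by rewrite gt_eqF// pi_gt0.
    by move: (expR _) p0; move: (pi : R) => q y q0; field.
  by congr expR; rewrite /sqnorm /toC !ReImE; cbn [fst snd]; field.
rewrite E; split; first exact: rintegrableZ.
have -> : (\int[leb1]_x (2 * pi * gauss1 2^-1 (x.1 + complex.Re (- p), x.2 + complex.Im (- p))) =
  2 * pi * \int[leb1]_x gauss1 2^-1 (x.1 + complex.Re (- p), x.2 + complex.Im (- p)))%R.
  by apply: RintegralZl.
by rewrite et e mulr1.
Qed.

(** For fixed [u] the damped Bell vector is a Gaussian in [a] whose mass does not depend on [u].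
    Tonelli with [a] inside therefore leaves a multiple of the damped [f]. *)
Lemma braket_bell_cintegrable f : tempered f ->
  cintegrable leb1 (fun x => braket f (bell (toC x))).
Proof.
move=> tf; have [mf itf] := tf.
pose c := pi^-1 * pi^-1 * (Num.sqrt pi)^-1 : R.
have c0 : 0 <= c by rewrite !mulr_ge0// invr_ge0 ?pi_ge0// sqrtr_ge0.
pose P (p : (R * R) * ((R * R) * (R * R))) : C :=
  mu_integrand (braket_integrand f (bell (toC p.1))) p.2.
pose h (p : (R * R) * ((R * R) * (R * R))) : R :=
  damped f p.2 * damping (u0 p.2 - (u1 p.2)^* - toC p.1).
have m1 : cmeasurable (fun p : (R * R) * ((R * R) * (R * R)) => toC p.1).
  exact: (cmeasurable_comp (cmeasurable_toC R) measurable_fst).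
have mu0 : cmeasurable (fun p : (R * R) * ((R * R) * (R * R)) => u0 p.2).
  exact: (cmeasurable_comp (@cmeasurable_u0 R) measurable_snd).
have mu1 : cmeasurable (fun p : (R * R) * ((R * R) * (R * R)) => (u1 p.2)^*).
  by apply: cmeasurable_conj; exact: (cmeasurable_comp (@cmeasurable_u1 R) measurable_snd).
have mP : cmeasurable P.
  apply: cmeasurableM; last first.
    apply: cmeasurable_ofR.
    exact: (measurableT_comp (@measurable_gauss R) measurable_snd).
  apply: cmeasurableM.
    by apply: cmeasurable_conj; exact: (cmeasurable_comp mf measurable_snd).
  apply: (cmeasurable_bell m1 _ mu1); exact: cmeasurable_conj.
have mh : measurable_fun setT h.
  apply: measurable_funM.
    exact: (measurableT_comp (measurable_damped mf) measurable_snd).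
  apply: (measurableT_comp (@measurable_expR R)); apply: measurable_funN.
  apply: measurable_funM => //; apply: measurable_sqnorm.
  by apply: cmeasurableB => //; exact: cmeasurableB.
have ih : (leb1 \x leb2)%E.-integrable setT (EFin \o h).
  have hb u : (\int[leb1]_x (h (x, u))%:E <= (2 * pi * damped f u)%:E)%E.
    have [i e] := integrable_damping (u0 u - (u1 u)^*).
    rewrite /h; cbn [fst snd]; have iZ := rintegrableZ (damped f u) i.
    rewrite le_eqVlt; apply/orP; left; apply/eqP.
    rewrite -[LHS](fineK (integrable_fin_num measurableT iZ)); congr EFin.
    transitivity (\int[leb1]_x (damped f u * damping (u0 u - (u1 u)^* - toC x)))%R; first by [].
    transitivity (damped f u * \int[leb1]_x damping (u0 u - (u1 u)^* - toC x))%R.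
      by apply: RintegralZl.
    by rewrite e mulrC.
  have h0 z : 0 <= h z by rewrite mulr_ge0 ?damped_ge0 ?damping_ge0.
  apply: (@integrable_tonelli2 R _ _ _ _ leb1 leb2 h (fun u => 2 * pi * damped f u) mh h0 hb).
  exact: (rintegrableZ (2 * pi) itf).
have iP : cintegrable (leb1 \x leb2)%E P.
  apply: (le_cintegrable _ _ (rintegrableZ c ih)) => //.
  move=> [x u]; rewrite /P /h; cbn [fst snd]; rewrite braket_integrandE cmodM cmodM cmod_conj cmod_ofR.
  rewrite (ger0_norm (gauss_ge0 _ _)) gauss_damp2.
  rewrite [leLHS](_ : _ = pi^-1 * pi^-1 * damped f u * damped (bell (toC x)) u).
    by rewrite damped_bell /c le_eqVlt; apply/orP; left; apply/eqP; ring.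
  by rewrite /damped; ring.
by have [_ i1 _] := cFubini1 iP.
Qed.

Lemma bell_cintegrable (w0 w1 : C) : cintegrable leb1 (fun x => bell (toC x) w0 w1).
Proof.
have [i _] := integrable_damping (w0^* - w1).
apply: (le_cintegrable _ _ (rintegrableZ ((Num.sqrt pi)^-1 / damp2 w0 w1) i)).
  apply: cmeasurable_bell; first exact: cmeasurable_toC.
    exact: cmeasurable_cst.
  exact: cmeasurable_cst.
move=> x.
have := damped_bell (toC x) ((complex.Re w0^*, complex.Im w0^*), (complex.Re w1^*, complex.Im w1^*)).
have E w : toC (complex.Re w, complex.Im w) = w :> C by case: w.
rewrite /damped /wave /u0 /u1 !E !conjCK damp2_conj => h.
have d0 : 0 < damp2 w0 w1 by rewrite mulr_gt0 ?expR_gt0.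
rewrite -(mulrAC (Num.sqrt pi)^-1) -h; rewrite mulfK ?gt_eqF//.
Qed.

(** For fixed [w0], [w1] the conjugate of B_a at that point serves as an amplitude. Its smearing is
    the reproducing kernel at the point, by the Gaussian integral, and pairing [g] with the kernel
    gives the conjugate of [g w0 w1]. *)
Lemma smear_braketE g (w0 w1 : C) : Hspace g -> tempered g ->
  smear (fun x => (braket g (bell (toC x)))^*) w0 w1 = g w0 w1.
Proof.
move=> Hg tg.
have ik : cintegrable leb1 (fun x => (bell (toC x) w0 w1)^*).
  exact: (cintegrable_conj (bell_cintegrable w0 w1)).
have [[i e] im] := smear_braket ik tg.
have E : smear (fun x => (bell (toC x) w0 w1)^*) =
    (fun v0 v1 => cexp (v0 * w0^*) * cexp (v1 * w1^*)).
  apply/funext => v0; apply/funext => v1; rewrite /smear -[v0]conjCK -[v1]conjCK.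
  have [_ <-] := bell_kernel_integral v0^* v1^* w0^* w1^*.
  congr (cintegral _ _); apply/funext => x; cbv zeta.
  by rewrite -bell_kernelE !conjCK mulrC.
rewrite E in e im.
transitivity ((braket g (fun v0 v1 => cexp (v0 * w0^*) * cexp (v1 * w1^*)))^*).
  rewrite -e -(cintegral_conj i) /smear; congr (cintegral _ _); apply/funext => x.
  by rewrite rmorphM /= conjCK mulrC.
have [_ <-] := braket_conj im.
have [_] := id_has_kernel Hg w0^* w1^*.
rewrite /= !conjCK => <-; rewrite /braket /mu_integral; congr (cintegral _ _).
apply/funext => u; rewrite /mu_integrand /braket_integrand rmorphM /= -!cexp_conj.
by rewrite !rmorphM /= !conjCK ![_ * w0]mulrC ![_ * w1]mulrC.
Qed.

Lemma bell_completeness f g : tempered f -> Hspace g -> tempered g -> is_cintegral leb1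
  (fun x => braket f (bell (toC x)) * (braket g (bell (toC x)))^*) (braket f g).
Proof.
move=> tf Hg tg.
have [h _] := smear_braket (cintegrable_conj (braket_bell_cintegrable tg)) tf.
have E : smear (fun x => (braket g (bell (toC x)))^*) = g.
  by apply/funext => w0; apply/funext => w1; exact: smear_braketE.
rewrite E in h.
rewrite (_ : (fun x => _) = (fun x => (braket g (bell (toC x)))^* * braket f (bell (toC x))))//.
by apply/funext => x; rewrite mulrC.
Qed.

End Completeness.

(** * Overlaps of the Bell vectors *)

Section Overlap.
Context (R : realType).
Local Notation C := R[i].
Local Notation leb1 := (@leb1 R).
Local Notation leb2 := (@leb2 R).
Implicit Types (f g : C -> C -> C) (a p q : C) (E F H : C -> C).

Lemma cvg_cmodM (f : nat -> C) (l c : C) : (fun n => cmod (f n - l)) @ \oo --> (0 : R) ->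
  (fun n => cmod (f n * c - l * c)) @ \oo --> (0 : R).
Proof.
move=> h; have h2 : (fun n => cmod (f n - l) * cmod c) @ \oo --> (0 * cmod c : R).
  by apply: cvgM; [exact: h|exact: cvg_cst].
rewrite mul0r in h2; move: h2; apply: cvg_trans; apply: near_eq_cvg; apply: nearW => n.
by rewrite -mulrBl cmodM.
Qed.

Lemma cvg_cmod_unique (f : nat -> C) (l l' : C) : (fun n => cmod (f n - l)) @ \oo --> (0 : R) ->
  (fun n => cmod (f n - l')) @ \oo --> (0 : R) -> l = l'.
Proof.
move=> h h'; apply/eqP; rewrite -subr_eq0; apply/eqP; apply: cmod_eq0; apply/eqP.
rewrite eq_le cmod_ge0 andbT.
have hs : (fun n => cmod (f n - l) + cmod (f n - l')) @ \oo --> (0 + 0 : R).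
  by apply: cvgD; [exact: h|exact: h'].
rewrite addr0 in hs; rewrite -[leRHS](cvg_lim _ hs)//.
apply: limr_ge; first by apply/cvg_ex; exists 0.
apply: nearW => n; rewrite [leRHS]addrC (_ : l - l' = (f n - l') - (f n - l)); last by ring.
exact: cmodB.
Qed.

Lemma integrable_exp_pairing E F (k K : R) p q : centire E -> centire F -> 0 <= K ->
  (forall z, cmod (E z) <= K * expR (k * cmod z)) -> (forall z, cmod (F z) <= expR (cmod z)) ->
  cintegrable leb1 (fun z =>
    (E (p^* * (toC z)^*))^* * F (q * (toC z)^*) * ofR (gauss1 1 z)).
Proof.
move=> eE eF K0 EK bF.
apply: (le_cintegrable _ _ (rintegrableZ K (integrable_expR_gauss1 (k * cmod p + cmod q) ltr01))).
  apply: cmeasurableM; last exact: cmeasurable_ofR (measurable_gauss1 1).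
  have ml (c : C) : cmeasurable (fun z : R * R => c * (toC z)^*).
    by apply: cmeasurableM; [exact: cmeasurable_cst|exact: cmeasurable_toC_conj].
  apply: cmeasurableM; first apply: cmeasurable_conj.
    exact: (cmeasurable_centire_comp eE (ml p^*)).
  exact: (cmeasurable_centire_comp eF (ml q)).
move=> z; rewrite !cmodM cmod_conj cmod_ofR (ger0_norm (gauss1_ge0 z ler01)).
rewrite (mulrA K); apply: ler_wpM2r; first exact: gauss1_ge0.
apply: le_trans (ler_pM (cmod_ge0 _) (cmod_ge0 _) (EK _) (bF _)) _.
rewrite !cmodM !cmod_conj -mulrA -expRD.
by rewrite le_eqVlt; apply/orP; left; apply/eqP; congr (_ * expR _); ring.
Qed.

(** Fubini with the second mode inside: there [E] and [F] pair as functions of one variable, and the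
    result [H] depends only on the product of their coefficients. This covers the regularized
    exponential and all partial sums at once. *)
Lemma braket_bell_seriesE E F H (k K : R) a' a : centire E -> centire F -> 0 <= K -> 0 <= k < 1 ->
  (forall z, cmod (E z) <= K * expR (k * cmod z)) -> (forall z, cmod (F z) <= expR (cmod z)) ->
  (forall p q, cintegral leb1 (fun z =>
    (E (p^* * (toC z)^*))^* * F (q * (toC z)^*) * ofR (gauss1 1 z)) = H (p * q)) ->
  braket (bell_series E a') (bell_series F a) =
  cintegral leb1 (fun z => ofR (expR (- sqnorm a' / 2)) * ofR (expR (- sqnorm a / 2)) *
    (cexp (a'^* * toC z) * cexp (a * (toC z)^*) * H ((toC z - a') * ((toC z)^* - a^*)) *
      ofR (gauss1 1 z))).
Proof.
move=> eE eF K0 k01 EK bF EFH.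
have tE := tempered_bell_series a' eE k01 K0 EK.
have [iP _] := braket_bound tE (cmeasurable_wave_bell_series a eF)
  (fun u => damped_bell_series_le1 a u bF).
have [_ _] := cFubini1 iP.
rewrite /braket /mu_integral => <-; congr (cintegral _ _); apply/funext => x.
set c := (X in X * (_ * _ * _ * _)).
pose d := c * (cexp (a'^* * toC x) * cexp (a * (toC x)^*) * ofR (gauss1 1 x)).
transitivity (cintegral leb1 (fun z => d * ((E ((toC x - a')^* * (toC z)^*))^* *
    F (((toC x)^* - a^*) * (toC z)^*) * ofR (gauss1 1 z)))).
  congr (cintegral _ _); apply/funext => y; rewrite braket_integrandE gaussE ofRM.
  rewrite /wave /bell_series /u0 /u1; cbn [fst snd].
  have -> : (toC x - a')^* = (toC x)^* - a'^* by rewrite rmorphB.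
  rewrite !(rmorphM Num.conj) /= conj_ofR -cexp_conj rmorphM /= conjCK /d /c.
  by ring.
rewrite (cintegralZ d (integrable_exp_pairing _ _ eE eF K0 EK bF)) EFH /d.
by ring.
Qed.

(** Here [H] is again exp (t z), and its term exp (t |u|^2) lowers the parameter of the outer
    Gaussian from 1 to 1 - t. What remains is a Gaussian in alpha - a' whose parameter tends to
    infinity as [t] tends to 1, a phase equal to 1 at alpha = a', and a prefactor tending to pi. *)
Lemma braket_regularized (t : R) a' (x : R * R) : 0 <= t < 1 ->
  braket (bell_series (fun z => cexp (ofR t * z)) a') (bell_series (@cexp R) (toC x)) =
  ofR (2 * pi / (1 + t)) * cexp (Complex 0 (complex.Im (a'^* * toC x))) *
  ofR (gauss1 ((1 + t) / (2 * (1 - t))) (x.1 + complex.Re (- a'), x.2 + complex.Im (- a'))).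
Proof.
move=> t01; have /andP[t0 t1] := t01.
have t1' : 0 < 1 - t by rewrite subr_gt0.
have etz : centire (fun z => cexp (ofR t * z)).
  by apply: (centire_comp (@centire_cexp R)); exact: centireMl (@centire_id R).
have bE z : cmod (cexp (ofR t * z)) <= 1 * expR (t * cmod z).
  by rewrite mul1r; apply: le_trans (cmod_cexpM_le _ _) _; rewrite cmod_ofR ger0_norm.
have H p q : cintegral leb1 (fun z => (cexp (ofR t * (p^* * (toC z)^*)))^* *
    cexp (q * (toC z)^*) * ofR (gauss1 1 z)) = cexp (ofR t * (p * q)).
  have [_ e] := @gauss_exponential R 1 (ofR t * p) q ltr01.
  rewrite ofR1 divr1 in e; rewrite mulrA -e; congr (cintegral _ _); apply/funext => z.
  by rewrite -cexp_conj !rmorphM /= !conjCK conj_ofR mulrA.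
have hc z := @cmod_cexp_le R z.
apply: etrans (@braket_bell_seriesE _ _ (fun z => cexp (ofR t * z)) t 1 a' (toC x) etz (@centire_cexp R)
  ler01 t01 bE hc H) _.
set a := toC x.
pose c := ofR (expR (- sqnorm a' / 2)) * ofR (expR (- sqnorm a / 2)) *
  cexp (ofR t * a' * a^*) * ofR (1 - t)^-1.
have [i e] := gauss_exponential (a'^* - ofR t * a^*) (a - ofR t * a') t1'.
transitivity (c * cexp ((a'^* - ofR t * a^*) * (a - ofR t * a') / ofR (1 - t))).
  rewrite -e -(cintegralZ c i); congr (cintegral _ _); apply/funext => z.
  have -> : ofR (gauss1 1 z) = ofR (1 - t)^-1 * cexp (- (ofR t * (toC z * (toC z)^*))) *
      ofR (gauss1 (1 - t) z).
    rewrite mulC_conj -ofRM -ofRN cexp_ofR -!ofRM /gauss1; congr ofR.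
    have -> : expR (- (1 * sqnorm (toC z))) = expR (- (t * sqnorm (toC z))) *
        expR (- ((1 - t) * sqnorm (toC z))) by rewrite -expRD; congr expR; ring.
    move: (expR _) (expR _) => X Y; have q1 : 1 - t != 0 by rewrite gt_eqF.
    have p0 : pi != 0 :> R by rewrite gt_eqF// pi_gt0.
    by move: p0; move: (pi : R) => r r0; field; rewrite q1 r0.
  rewrite /c; set u := toC z.
  have -> : cexp ((a'^* - ofR t * a^*) * u) = cexp (a'^* * u) * cexp (- (ofR t * a^* * u)).
    by rewrite -cexpD; congr cexp; ring.
  have -> : cexp ((a - ofR t * a') * u^*) = cexp (a * u^*) * cexp (- (ofR t * a' * u^*)).
    by rewrite -cexpD; congr cexp; ring.
  have -> : cexp (ofR t * ((u - a') * (u^* - a^*))) = cexp (ofR t * a' * a^*) *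
      cexp (- (ofR t * a^* * u)) * cexp (- (ofR t * a' * u^*)) * cexp (ofR t * (u * u^*)).
    by rewrite -!cexpD; congr cexp; ring.
  have h := cexpN (ofR t * (u * u^*)).
  move: h; move: (cexp (ofR t * (u * u^*))) (cexp (- (ofR t * (u * u^*)))) => X Y h.
  rewrite -[RHS]mulr1 -[X in _ = _ * X]h.
  by ring.
have -> : ofR (2 * pi / (1 + t)) * cexp (Complex 0 (complex.Im (a'^* * a))) *
    ofR (gauss1 ((1 + t) / (2 * (1 - t))) (x.1 + complex.Re (- a'), x.2 + complex.Im (- a'))) =
  ofR (1 - t)^-1 * cexp (Complex 0 (complex.Im (a'^* * a)) +
    ofR (- ((1 + t) / (2 * (1 - t)) * sqnorm (a - a')))).
  have -> : a - a' = toC (x.1 + complex.Re (- a'), x.2 + complex.Im (- a')).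
    by apply: complex_ext; rewrite /a /toC !ReImE.
  rewrite cexpD cexp_ofR /gauss1 (ofRM ((1 + t) / (2 * (1 - t)) / pi)).
  have -> : ofR (1 - t)^-1 = ofR (2 * pi / (1 + t)) * ofR ((1 + t) / (2 * (1 - t)) / pi) :> C.
    rewrite -ofRM; congr ofR.
    have p0 : pi != 0 :> R by rewrite gt_eqF// pi_gt0.
    move: p0; move: (pi : R) => q q0.
    have q1 : 1 - t != 0 by rewrite gt_eqF.
    have q2 : 1 + t != 0 by rewrite gt_eqF// ltr_pwDl.
    by field; rewrite q0 q1 q2.
  move: (cexp _) (ofR _) (ofR _) (ofR _) => X Y Z W.
  by ring.
rewrite /c -!cexp_ofR mulrAC -!cexpD mulrC; congr (_ * cexp _).
have q1 : 1 - t != 0 by rewrite gt_eqF.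
rewrite -ofRV; clear -q1; clearbody a.
by apply: complex_ext; rewrite /sqnorm !ReImE; field.
Qed.

Definition monomial m n (z : R * R) : C := (toC z) ^+ m * (toC z)^* ^+ n * ofR (gauss1 1 z).

Lemma monomial_integrable m n : cintegrable leb1 (monomial m n).
Proof.
apply: (le_cintegrable _ _ (rintegrableZ (m`!%:R * n`!%:R) (integrable_expR_gauss1 2 ltr01))).
  apply: cmeasurableM; last exact: cmeasurable_ofR (measurable_gauss1 1).
  by apply: cmeasurableM; apply: cmeasurableX; [exact: cmeasurable_toC|exact: cmeasurable_toC_conj].
move=> z; rewrite /monomial !cmodM cmod_ofR (ger0_norm (gauss1_ge0 z ler01)) !cmodX cmod_conj.
rewrite (mulrA (_ * _)); apply: ler_wpM2r; first exact: gauss1_ge0.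
have h k : cmod (toC z) ^+ k <= k`!%:R * expR (cmod (toC z)).
  rewrite mulrC -ler_pdivrMr ?ltr0n ?fact_gt0//.
  exact: expf_fact_le (cmod_ge0 _).
apply: le_trans (ler_pM _ _ (h m) (h n)) _; rewrite ?exprn_ge0 ?cmod_ge0//.
by rewrite mulrACA -expRD [2 * _]mulr_natl mulr2n.
Qed.

Lemma cintegral_rotate (f : C -> C) (t : R) : cintegrable leb1 (fun z => f (toC z)) ->
  cintegral leb1 (fun z => f (cexp (Complex 0 t) * toC z)) = cintegral leb1 (fun z => f (toC z)).
Proof.
move=> i; have [_ <-] := cintegral_preserving (rotate_preserving (cos2Dsin2 t)) i.
congr (cintegral _ _); apply/funext => z; congr f.
by apply: complex_ext; rewrite /cexp /toC !ReImE expR0; cbn [fst snd]; ring.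
Qed.

(* Rotating by [pi / (n - m)] changes the sign of the integrand. *)
Lemma monomial_integral_lt m n : (m < n)%N -> cintegral leb1 (monomial m n) = 0.
Proof.
move=> mn; pose t : R := - (pi / (n - m)%:R).
pose f (z : C) := z ^+ m * z^* ^+ n * (ofR pi^-1 * ofR (expR (- sqnorm z))).
have E : monomial m n = (fun z => f (toC z)).
  by apply/funext => z; rewrite /monomial /f /gauss1 -ofRM !mul1r.
have := @cintegral_rotate f t; rewrite -E => /(_ (monomial_integrable m n)).
have -> : (fun z : R * R => f (cexp (Complex 0 t) * toC z)) = (fun z => -1 * monomial m n z).
  apply/funext => z; rewrite E /f; set l := cexp _.
  have ll : l * l^* = 1.
    by rewrite mulC_conj -cmod2 cmod_cexp ReC expR0 expr1n.
  have -> : sqnorm (l * toC z) = sqnorm (toC z).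
    by rewrite sqnormM -[sqnorm l]cmod2 cmod_cexp ReC expR0 expr1n mul1r.
  have ln : l^* ^+ (n - m) = -1.
    rewrite -cexp_conj -cexpMn (_ : (_ *+ _) = Complex 0 pi); last first.
      have k0 : (n - m)%:R != 0 :> R by rewrite pnatr_eq0 -lt0n subn_gt0.
      apply: complex_ext; rewrite -mulr_natr -ofR_nat !ReImE /t ?mul0r ?mulr0 ?subr0 ?add0r//.
      by rewrite opprK divfK.
    by apply: complex_ext; rewrite /cexp !ReImE expR0 mul1r ?cospi ?sinpi ?oppr0.
  rewrite !(rmorphM Num.conj) /= !exprMn -[in l^* ^+ n](subnK (ltnW mn)) exprD ln.
  have lm : l ^+ m * l^* ^+ m = 1 by rewrite -exprMn ll expr1n.
  move: lm; move: (l ^+ m) (l^* ^+ m) (toC z ^+ m) ((toC z)^* ^+ n) (ofR _) (ofR _) => a b x y g h lm.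
  rewrite -[RHS]mulr1 -[X in _ = _ * X]lm.
  by ring.
rewrite (cintegralZ (-1) (monomial_integrable m n)) => /eqP.
by rewrite mulN1r eq_sym -addr_eq0 -mulr2n mulrn_eq0 /= => /eqP.
Qed.

Lemma monomial_conj m n z : monomial m n z = (monomial n m z)^*.
Proof. by rewrite /monomial !rmorphM /= !rmorphXn /= conjCK conj_ofR [X in X * _]mulrC. Qed.

Lemma monomial_integral_neq m n : m != n -> cintegral leb1 (monomial m n) = 0.
Proof.
rewrite neq_ltn => /orP[|] mn; first exact: monomial_integral_lt.
rewrite (_ : monomial m n = (fun z => (monomial n m z)^*)); last first.
  by apply/funext => z; exact: monomial_conj.
by rewrite (cintegral_conj (monomial_integrable n m)) monomial_integral_lt// rmorph0.
Qed.

Lemma exp_sum_monomial M n z : exp_sum M (toC z) * (toC z)^* ^+ n * ofR (gauss1 1 z) =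
  \sum_(m < M) (ofR m`!%:R)^-1 * monomial m n z.
Proof.
rewrite /exp_sum -mulrA mulr_suml; apply: eq_bigr => m _.
by rewrite /monomial mulrAC mulrC !mulrA.
Qed.

(** No radial integral is computed: [reproducing] for w^m at the point 1 gives the value 1 to the
    integral of e^z times the conjugate of z^m, and in the expansion of e^z only the term of degree
    [m] contributes. *)
Lemma monomial_integral m : cintegral leb1 (monomial m m) = ofR m`!%:R.
Proof.
have f0 : ofR m`!%:R != 0 :> C.
  by apply/eqP => -[] /eqP; rewrite pnatr_eq0 eqn0Ngt fact_gt0.
have eX := @centireX R m.
have bnd z : cmod (toC z) ^+ m <= m`!%:R * expR (cmod (toC z)) :> R.
  rewrite mulrC -ler_pdivrMr ?ltr0n ?fact_gt0//.
  exact: expf_fact_le (cmod_ge0 _).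
have mes (e : C -> C) : centire e ->
    cmeasurable (fun z : R * R => e (toC z) * (toC z)^* ^+ m * ofR (gauss1 1 z)).
  move=> ee; apply: cmeasurableM; last exact: cmeasurable_ofR (measurable_gauss1 1).
  apply: cmeasurableM; first exact: cmeasurable_centire.
  by apply: cmeasurableX; exact: cmeasurable_toC_conj.
have dom (e : C -> C) z : (forall w, cmod (e w) <= expR (cmod w)) ->
    cmod (e (toC z) * (toC z)^* ^+ m * ofR (gauss1 1 z)) <=
    m`!%:R * (expR (2 * cmod (toC z)) * gauss1 1 z).
  move=> be; rewrite !cmodM cmod_ofR (ger0_norm (gauss1_ge0 z ler01)) cmodX cmod_conj.
  rewrite (mulrA m`!%:R); apply: ler_wpM2r; first exact: gauss1_ge0.
  apply: le_trans (ler_pM (cmod_ge0 _) _ (be _) (bnd z)) _; first by rewrite exprn_ge0 ?cmod_ge0.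
  by rewrite mulrCA -expRD [2 * _]mulr_natl mulr2n.
have ih := rintegrableZ m`!%:R (@integrable_expR_gauss1 R 1 2 ltr01).
have ptw z : (fun N => cmod (exp_sum N (toC z) * (toC z)^* ^+ m * ofR (gauss1 1 z) -
    cexp (toC z) * (toC z)^* ^+ m * ofR (gauss1 1 z))) @ \oo --> (0 : R).
  by apply: cvg_cmodM; apply: cvg_cmodM; exact: cvg_exp_sum.
have [ic cv] := @cdominated_cvg R _ _ leb1
  (fun N z => exp_sum N (toC z) * (toC z)^* ^+ m * ofR (gauss1 1 z))
  (fun z => cexp (toC z) * (toC z)^* ^+ m * ofR (gauss1 1 z)) _
  (fun N => mes _ (@centire_exp_sum R N)) ptw
  (fun N z => dom _ z (@cmod_exp_sum_le R N)) ih.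
have e1 : cintegral leb1 (fun z => cexp (toC z) * (toC z)^* ^+ m * ofR (gauss1 1 z)) = 1.
  have := @reproducing R _ 1 1 eX ltr01.
  by rewrite (_ : ofR 1 * 1 = 1) ?mulr1// expr1n; under eq_fun do rewrite mul1r; exact.
have cst : (fun N => cmod (cintegral leb1 (fun z => exp_sum N (toC z) * (toC z)^* ^+ m *
    ofR (gauss1 1 z)) - (ofR m`!%:R)^-1 * cintegral leb1 (monomial m m))) @ \oo --> (0 : R).
  apply: cvg_near_cst; apply: filterS (nbhs_infty_gt m) => N mN.
  have iN (k : 'I_N) := cintegrableZ (ofR k`!%:R)^-1 (monomial_integrable k m).
  under eq_fun do rewrite exp_sum_monomial.
  rewrite (cintegral_sum iN) (bigD1 (Ordinal mN))//= big1 ?addr0; last first.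
    move=> k km; rewrite (cintegralZ _ (monomial_integrable k m)) monomial_integral_neq ?mulr0//.
  by rewrite (cintegralZ _ (monomial_integrable m m)) subrr cmod0.
have := cvg_cmod_unique cst cv; rewrite e1 => /(congr1 ( *%R (ofR m`!%:R))).
by rewrite mulVKf// mulr1.
Qed.

(** Orthogonality of the monomials leaves the diagonal terms, whose index lies below both [M] and
    [N]. *)
Lemma exp_sum_pairing M N p q : cintegral leb1 (fun z =>
  (exp_sum M (p^* * (toC z)^*))^* * exp_sum N (q * (toC z)^*) * ofR (gauss1 1 z)) =
  exp_sum (minn M N) (p * q).
Proof.
pose c (m n : nat) := p ^+ m * q ^+ n / (ofR m`!%:R * ofR n`!%:R).
have E : (fun z => (exp_sum M (p^* * (toC z)^*))^* * exp_sum N (q * (toC z)^*) *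
    ofR (gauss1 1 z)) = (fun z => \sum_(m < M) \sum_(n < N) c m n * monomial m n z).
  apply/funext => z; rewrite /exp_sum rmorph_sum /= !mulr_suml.
  apply: eq_bigr => m _; rewrite mulr_sumr mulr_suml; apply: eq_bigr => n _.
  rewrite /c /monomial invfM -!ofRV rmorphM /= conj_ofR rmorphXn /= rmorphM /= !conjCK !exprMn.
  by ring.
have i m n := cintegrableZ (c m n) (monomial_integrable m n).
have i2 (m : nat) : cintegrable leb1 (fun z => \sum_(n < N) c m n * monomial m n z).
  by apply: cintegrable_sum => n.
rewrite E (cintegral_sum (fun m : 'I_M => i2 m)).
transitivity (\sum_(m < M | (m < N)%N) (p * q) ^+ m / ofR m`!%:R); last first.
  rewrite /exp_sum; have [MN|NM] := leqP M N.
    by apply: eq_bigl => m; rewrite (leq_trans (ltn_ord m) MN).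
  by rewrite (big_ord_widen M (fun m => (p * q) ^+ m / ofR m`!%:R) (ltnW NM)).
rewrite [RHS]big_mkcond; apply: eq_bigr => m _; rewrite (cintegral_sum (fun n : 'I_N => i m n)).
have f0 : ofR m`!%:R != 0 :> C.
  by apply/eqP => -[] /eqP; rewrite pnatr_eq0 eqn0Ngt fact_gt0.
case: ifPn => mN.
  rewrite (bigD1 (Ordinal mN))//= big1 ?addr0; last first.
    move=> n nm; rewrite (cintegralZ _ (monomial_integrable m n)) monomial_integral_neq ?mulr0//.
    by rewrite eq_sym.
  rewrite (cintegralZ _ (monomial_integrable m m)) monomial_integral /c exprMn.
  by field.
rewrite big1// => n _.
rewrite (cintegralZ _ (monomial_integrable m n)) monomial_integral_neq ?mulr0//.
by apply: contra mN => /eqP ->; exact: ltn_ord.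
Qed.

(** For n < K one has |z|^n <= 2^K (|z| / 2)^n. The rate 1/2 is below 1, which is what makes the
    partial sums of a Bell vector tempered. *)
Lemma exp_sum_half_le K (z : C) : cmod (exp_sum K z) <= 2 ^+ K * expR (2^-1 * cmod z).
Proof.
have z0 : 0 <= 2^-1 * cmod z by rewrite mulr_ge0 ?cmod_ge0 ?invr_ge0.
apply: (le_trans (cmod_sum _ _ _)).
apply: le_trans (_ : 2 ^+ K * cmod (exp_sum K (ofR (2^-1 * cmod z))) <= _); last first.
  rewrite ler_wpM2l ?exprn_ge0//; apply: le_trans (cmod_exp_sum_le _ _) _.
  by rewrite cmod_ofR ger0_norm.
have -> : exp_sum K (ofR (2^-1 * cmod z)) = ofR (\sum_(n < K) (2^-1 * cmod z) ^+ n / n`!%:R).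
  rewrite /exp_sum; elim/big_rec2: _ => [|n x y _ ->]; first by rewrite ofR0.
  by rewrite ofRD (ofRM _ (_^-1)) ofRX ofRV.
have s0 : 0 <= \sum_(n < K) (2^-1 * cmod z) ^+ n / n`!%:R.
  by apply: sumr_ge0 => n _; rewrite divr_ge0 ?exprn_ge0.
rewrite cmod_ofR (ger0_norm s0) mulr_sumr; apply: ler_sum => n _.
rewrite cmodM cmodX -ofRV cmod_ofR ger0_norm ?invr_ge0// mulrA ler_wpM2r ?invr_ge0//.
rewrite exprMn mulrA; rewrite -[leLHS]mul1r ler_wpM2r ?exprn_ge0 ?cmod_ge0//.
by rewrite exprVn -ler_pdivrMr ?invr_gt0 ?exprn_gt0// invrK mul1r ler_weXn2l ?ler1n// ltnW.
Qed.

Lemma exp_sum_conj K (z : C) : (exp_sum K z)^* = exp_sum K z^*.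
Proof.
rewrite /exp_sum rmorph_sum; apply: eq_bigr => n _.
by rewrite -ofRV rmorphM /= conj_ofR rmorphXn.
Qed.

Lemma tempered_bell_sum K a : tempered (bell_sum K a).
Proof.
have h0 : (0 <= 2^-1 :> R) && (2^-1 < 1 :> R) by apply/andP; split; lra.
have K0 : 0 <= 2 ^+ K :> R by rewrite exprn_ge0.
rewrite bell_sumE.
exact: (tempered_bell_series a (@centire_exp_sum R K) h0 K0 (exp_sum_half_le K)).
Qed.

Lemma bell_sum_overlap M N a' a : braket (bell_sum M a') (bell_sum N a) =
  braket (bell_sum (minn M N) a') (bell_series (@cexp R) a).
Proof.
have h0 : (0 <= 2^-1 :> R) && (2^-1 < 1 :> R) by apply/andP; split; lra.
have P0 K : 0 <= 2 ^+ K :> R by rewrite exprn_ge0.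
rewrite !bell_sumE.
apply: etrans (@braket_bell_seriesE _ _ (exp_sum (minn M N)) 2^-1 (2 ^+ M) a' a
  (@centire_exp_sum R M) (@centire_exp_sum R N) (P0 M) h0 (exp_sum_half_le M)
  (@cmod_exp_sum_le R N) (exp_sum_pairing M N)) _.
(* Against the full exponential the one-variable pairing is [exp_sum K] again, by [reproducing] for
   this polynomial; both overlaps thus have the same [H]. *)
apply: esym; set K := minn M N.
apply: (@braket_bell_seriesE _ _ (exp_sum K) 2^-1 (2 ^+ K) a' a
  (@centire_exp_sum R K) (@centire_cexp R) (P0 K) h0 (exp_sum_half_le K) (@cmod_cexp_le R)) => p q.
have i := integrable_exp_pairing p q (@centire_exp_sum R K) (@centire_cexp R) (P0 K)
  (exp_sum_half_le K) (@cmod_cexp_le R).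
have E : (fun z : R * R => ((exp_sum K (p^* * (toC z)^*))^* * cexp (q * (toC z)^*) *
    ofR (gauss1 1 z))^*) =
  (fun z => cexp (ofR 1 * q^* * toC z) * exp_sum K (p^* * (toC z)^*) * ofR (gauss1 1 z)).
  apply/funext => z; rewrite !(rmorphM Num.conj) /= !conjCK conj_ofR -cexp_conj rmorphM /= conjCK.
  by rewrite ofR1 mul1r [X in X * _]mulrC.
have eE : centire (fun z => exp_sum K (p^* * z)).
  by apply: (centire_comp (@centire_exp_sum R K)); exact: centireMl (@centire_id R).
have ic := cintegrable_conj i; rewrite E in ic.
have := reproducing eE ltr01 ic; rewrite -E (cintegral_conj i) => e.
by rewrite -[LHS]conjCK e exp_sum_conj rmorphM /= !conjCK.
Qed.

End Overlap.

(** * Smeared Bell vectors *)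

Section Differentiable.
Context (R : realType).
Local Notation C := R[i].

Lemma prod_normC (h : C^o * C^o) : `|h| = ofR (Num.max (cmod h.1) (cmod h.2)).
Proof.
have E z : `|z| = ofR (cmod z) :> C by rewrite normc_def.
by rewrite prod_normE /= (E h.1) (E h.2) /Num.max !ltcE /= eqxx /= /Num.max; case: ifP.
Qed.

Lemma flat_differentiable (K : numFieldType) (V W : normedModType K) (rho : V -> W) (x : V) :
  rho x = 0 -> (forall e : K, 0 < e -> \forall h \near (0 : V), `|rho (h + x)| <= e * `|h|) ->
  differentiable rho x.
Proof.
move=> r0 hr.
have o : rho \o shift x = cst (rho x) + \0 +o_ 0 id.
  apply/eqaddoP => e e0; apply: filterS (hr e e0) => h.
  by rewrite /GRing.add /= /GRing.opp /= /cst r0 addr0 subr0.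
have z0 : 'd rho x = \0 :> (V -> W).
  by apply: (@diff_unique _ _ _ rho \0) o; move=> ?; exact: cvg_cst.
apply/diff_locallyP; rewrite z0; split=> //.
by move=> ?; exact: cvg_cst.
Qed.

(** Subtracting the affine part leaves [rho], which vanishes to second order and has differential
    0. *)
Lemma quadratic_differentiable (f : C -> C -> C) (a b d0 d1 : C) (K : R) : 0 <= K ->
  (forall h0 h1, cmod h0 <= 1 -> cmod h1 <= 1 ->
    cmod (f (a + h0) (b + h1) - f a b - (d0 * h0 + d1 * h1)) <= K * (cmod h0 + cmod h1) ^+ 2) ->
  differentiable ((fun w => f w.1 w.2) : C^o * C^o -> C^o) ((a, b) : C^o * C^o).
Proof.
move=> K0 hf.
pose l (w : C^o * C^o) : C^o := f a b + (d0 * (w.1 - a) + d1 * (w.2 - b)).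
pose rho (w : C^o * C^o) : C^o := f w.1 w.2 - l w.
have -> : ((fun w => f w.1 w.2) : C^o * C^o -> C^o) = l + rho.
  by apply/funext => w; rewrite /GRing.add /= /rho addrC subrK.
apply: differentiableD.
  apply: differentiableD; first exact: differentiable_cst.
  have D1 : differentiable ((fun w => w.1 - a) : C^o * C^o -> C^o) ((a, b) : C^o * C^o).
    apply: differentiableB; last exact: differentiable_cst.
    by apply: (@linear_differentiable _ (C^o * C^o)%type C^o fst) => ?; exact: cvg_fst.
  have D2 : differentiable ((fun w => w.2 - b) : C^o * C^o -> C^o) ((a, b) : C^o * C^o).
    apply: differentiableB; last exact: differentiable_cst.
    by apply: (@linear_differentiable _ (C^o * C^o)%type C^o snd) => ?; exact: cvg_snd.
  by apply: differentiableD; [exact: (differentiableZ d0 D1)|exact: (differentiableZ d1 D2)].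
pose x : C^o * C^o := (a, b).
have r0 : rho x = 0 by rewrite /rho /l /= !subrr !mulr0 !addr0 subrr.
apply: (@flat_differentiable _ _ _ rho x r0).
move=> -[e i]; rewrite ltcE /= => /andP[/eqP -> e0].
(* With m the maximum norm of the increment, the remainder is at most 4 K m^2; the radius e / (4 K +
   1) turns this into at most e m, also when [K] is 0. *)
have K4 : 0 < 4 * K + 1 by rewrite ltr_wpDl ?mulr_ge0.
have d0' : 0 < ofR (Num.min 1 (e / (4 * K + 1))) :> C.
  by rewrite ltcE /= eqxx /= lt_min ltr01 divr_gt0.
apply/nbhs_ballP; exists (ofR (Num.min 1 (e / (4 * K + 1)))) => // h.
rewrite -ball_normE /= sub0r normrN !prod_normC ltcE /= eqxx /= lt_min => /andP[h1 he].
set m := Num.max _ _ in h1 he *.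
have m0 : cmod h.1 <= m by rewrite le_max lexx.
have m1 : cmod h.2 <= m by rewrite le_max lexx orbT.
have hh := hf h.1 h.2 (le_trans m0 (ltW h1)) (le_trans m1 (ltW h1)).
have -> : rho (h + x) = f (a + h.1) (b + h.2) - f a b - (d0 * h.1 + d1 * h.2) :> C.
  rewrite /rho /l /= (addrC h.1) (addrC h.2); move: (f _ _) (f _ _) => X Y.
  by ring.
rewrite normc_def lecE /= mul0r mulr0 addr0 eqxx /= mul0r subr0 /=.
apply: le_trans hh _.
have mm := le_trans (cmod_ge0 _) m0.
have h2 : (cmod h.1 + cmod h.2) ^+ 2 <= (2 * m) ^+ 2.
  by rewrite lerXn2r ?nnegrE ?addr_ge0 ?cmod_ge0 ?mulr_ge0// mulr_natl mulr2n lerD.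
apply: le_trans (ler_wpM2l K0 h2) _.
rewrite (_ : K * (2 * m) ^+ 2 = 4 * K * m * m); last by ring.
apply: ler_wpM2r => //.
move: he; rewrite ltr_pdivlMr// => he.
by apply: ltW; apply: le_lt_trans he; rewrite mulrC ler_wpM2l// lerDl.
Qed.

End Differentiable.

(** * Compactly supported amplitudes and directional derivatives *)

Section TestFunctions.
Context (R : realType).
Local Notation C := R[i].
Local Notation leb1 := (@leb1 R).
Implicit Types (h F : C -> C) (a v w : C) (r : R).

Definition ccontinuous h := continuous (fun z : R * R => complex.Re (h (toC z))) /\
  continuous (fun z : R * R => complex.Im (h (toC z))).

Definition supported r h := forall a, r < sqnorm a -> h a = 0.

Lemma ccontinuous_cmeasurable h : ccontinuous h -> cmeasurable (fun z => h (toC z)).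
Proof.
have p1 (t : R) : continuous (fun s : R => (s, t)).
  by move=> s; apply: (@cvg_pair _ _ _ _ (nbhs s) (nbhs t)) => /=; [exact: cvg_id|exact: cvg_cst].
have p2 (s : R) : continuous (fun t : R => (s, t)).
  by move=> t; apply: (@cvg_pair _ _ _ _ (nbhs s) (nbhs t)) => /=; [exact: cvg_cst|exact: cvg_id].
move=> [c1 c2]; split.
  apply: (@measurable_caratheodory R _ _ (fun s t => complex.Re (h (Complex s t)))) => [t|s].
    by move=> s; exact: (continuous_comp (p1 t s) (c1 (s, t))).
  by apply: continuous_measurable_fun => t; exact: (continuous_comp (p2 s t) (c1 (s, t))).
apply: (@measurable_caratheodory R _ _ (fun s t => complex.Im (h (Complex s t)))) => [t|s].
  by move=> s; exact: (continuous_comp (p1 t s) (c2 (s, t))).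
by apply: continuous_measurable_fun => t; exact: (continuous_comp (p2 s t) (c2 (s, t))).
Qed.

Lemma ccontinuous_bounded h r : ccontinuous h -> supported r h ->
  exists2 M : R, 0 <= M & forall a, cmod (h a) <= M.
Proof.
move=> [c1 c2] sh; pose I := `[- (1 + `|r|), 1 + `|r|]%classic : set R.
have cI : compact (I `*` I) by apply: compact_setX; exact: segment_compact.
have bnd (f : R * R -> R) : continuous f -> exists2 M : R, 0 <= M &
    forall z, (I `*` I) z -> `|f z| <= M.
  move=> cf; have /compact_bounded[M [_ HM]] : compact (f @` (I `*` I)).
    by apply: continuous_compact cI; exact: continuous_subspaceT.
  exists (`|M| + 1); first by rewrite addr_ge0.
  move=> z Iz; apply: (HM (`|M| + 1)); last by exists z.
  by rewrite ltr_pwDr// ler_norm.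
have [M1 M10 H1] := bnd _ c1; have [M2 M20 H2] := bnd _ c2.
exists (M1 + M2) => [|a]; first exact: addr_ge0.
have [ra|ar] := ltP r (sqnorm a); first by rewrite sh// cmod0 addr_ge0.
have Ia : (I `*` I) (complex.Re a, complex.Im a).
  have x2 := sqr_ge0 (complex.Re a); have y2 := sqr_ge0 (complex.Im a).
  have rr : r <= `|r| := ler_norm r.
  have hI (x : R) : x ^+ 2 <= r -> I x.
    move=> xr; rewrite /I /= in_itv /= -ler_norml.
    have := sqr_ge0 (`|x| - 1); rewrite expr2.
    rewrite -(@real_normK _ x) ?num_real// expr2 in xr.
    by have := normr_ge0 x; lra.
  by move: ar; rewrite /sqnorm => ar; split; apply: hI => /=; lra.
apply: le_trans (cmod_le_ReIm _) _; apply: lerD.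
  by have := H1 _ Ia; rewrite /toC /=; case: (a).
by have := H2 _ Ia; rewrite /toC /=; case: (a).
Qed.

(** On the disc |z|^2 <= r the Gaussian is at least exp (- r) / pi, so a multiple of it dominates
    any bounded function supported there. *)
Lemma supported_gauss1_le h r (M : R) z : supported r h -> 0 <= M -> (forall a, cmod (h a) <= M) ->
  cmod (h (toC z)) <= M * expR r * pi * gauss1 1 z.
Proof.
move=> sh M0 hM.
have [ra|ar] := ltP r (sqnorm (toC z)).
  by rewrite sh// cmod0 mulr_ge0 ?gauss1_ge0// mulr_ge0 ?pi_ge0// mulr_ge0 ?expR_ge0.
rewrite /gauss1 (_ : _ * _ * pi * _ = M * (expR r * expR (- (1 * sqnorm (toC z))))); last first.
  have p0 : pi != 0 :> R by rewrite gt_eqF// pi_gt0.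
  by move: p0 (expR _) (expR _); move: (pi : R) => p p0 x y; field.
apply: le_trans (hM _) _; rewrite -expRD mul1r ler_peMr// -[leLHS]expR0 ler_expR.
by rewrite subr_ge0.
Qed.

Lemma supported_integrable h r (M : R) : supported r h -> 0 <= M -> (forall a, cmod (h a) <= M) ->
  cmeasurable (fun z => h (toC z)) -> cintegrable leb1 (fun z => h (toC z)).
Proof.
move=> sh M0 hM mh.
apply: (le_cintegrable _ _ (rintegrableZ (M * expR r * pi) (integral_gauss_plane ltr01).1)).
  exact: mh.
by move=> z; exact: supported_gauss1_le.
Qed.

Lemma cder_quotient (G : R -> C) (d : C) : cder G 0 d ->
  (fun n => cmod (ofR n.+1%:R * (G n.+1%:R^-1 - G 0) - d)) @ \oo --> (0 : R).
Proof.
have q (g : R -> R) (e : R) : is_derive (0 : R) 1 g e ->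
    (fun n => n.+1%:R * (g n.+1%:R^-1 - g 0)) @ \oo --> e.
  move=> [dg <-].
  have := (@cvgr_dnbhsP R _ 0 _).1 dg (@harmonic R) (conj (fun n => lt0r_neq0 (harmonic_gt0 n))
    cvg_harmonic).
  apply: cvg_trans; apply: near_eq_cvg; apply: nearW => n /=.
  by rewrite invrK /GRing.scale /= mulr1 addr0.
move=> [d1 d2]; have h1 := q _ _ d1; have h2 := q _ _ d2.
apply: (@squeeze_cvgr _ _ _ _ (cst 0) (fun n =>
  `|n.+1%:R * (complex.Re (G n.+1%:R^-1) - complex.Re (G 0)) - complex.Re d| +
  `|n.+1%:R * (complex.Im (G n.+1%:R^-1) - complex.Im (G 0)) - complex.Im d|)).
- apply: nearW => n; rewrite cmod_ge0 /=; apply: le_trans (cmod_le_ReIm _) _.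
  by rewrite !ReImE !mul0r subr0 addr0.
- exact: cvg_cst.
have z1 : (fun n => `|n.+1%:R * (complex.Re (G n.+1%:R^-1) - complex.Re (G 0)) - complex.Re d|)
    @ \oo --> (0 : R).
  by apply/norm_cvg0P/subr_cvg0.
have z2 : (fun n => `|n.+1%:R * (complex.Im (G n.+1%:R^-1) - complex.Im (G 0)) - complex.Im d|)
    @ \oo --> (0 : R).
  by apply/norm_cvg0P/subr_cvg0.
by rewrite -[X in _ --> X]addr0; apply: cvgD; [exact: z1|exact: z2].
Qed.

Lemma toC_translate (z : R * R) w : toC (z.1 + complex.Re w, z.2 + complex.Im w) = toC z + w.
Proof. by apply: complex_ext; rewrite /toC !ReImE. Qed.

(* The integral of the difference quotients vanishes by translation invariance. *)
Lemma cintegral_derivative F (F' : C -> C) v r (M : R) : supported r F -> 0 <= M ->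
  (forall a, cmod (F a) <= M) -> (forall a, cmod (F' a) <= M) ->
  cmeasurable (fun z => F (toC z)) ->
  (forall a t, cder (fun s => F (a + ofR s * v)) t (F' (a + ofR t * v))) ->
  cintegrable leb1 (fun z => F' (toC z)) /\ cintegral leb1 (fun z => F' (toC z)) = 0.
Proof.
move=> sF M0 bF bF' mF dF; have iF := supported_integrable sF M0 bF mF.
pose e n : C := ofR n.+1%:R^-1 * v.
pose D n a : C := ofR n.+1%:R * (F (a + e n) - F a).
(* One disc must contain the supports of all difference quotients: |a|^2 <= 2 |a + e_n|^2 + 2
   |e_n|^2 and |e_n| <= |v|. *)
have sD n : supported (2 * r + 2 * sqnorm v) (D n).
  move=> a ra; have hv : sqnorm (e n) <= sqnorm v.
    rewrite /e sqnormM ler_piMl ?sqnorm_ge0// /sqnorm ReC ImC expr0n addr0.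
    by rewrite exprn_ile1 ?invr_ge0// invf_le1 ?ler1n// ltr0n.
  have h1 : sqnorm a <= 2 * sqnorm (a + e n) + 2 * sqnorm (e n).
    move: (e n) => u; rewrite /sqnorm !ReImE.
    have := sqr_ge0 (complex.Re a + 2 * complex.Re u).
    have := sqr_ge0 (complex.Im a + 2 * complex.Im u).
    by rewrite !expr2; lra.
  have h2 := sqnorm_ge0 v; have h3 := sqnorm_ge0 a.
  rewrite /D !sF ?subrr ?mulr0//; first by have := sqnorm_ge0 (a + e n); lra.
  by lra.
have tr n : cintegrable leb1 (fun z => F (toC z + e n)) /\
    cintegral leb1 (fun z => F (toC z + e n)) = cintegral leb1 (fun z => F (toC z)).
  have [i <-] := cintegral_translate (e n) iF.
  by under eq_fun do rewrite -toC_translate; split.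
have bD n a : cmod (D n a) <= 2 * M.
  have n0 : 0 <= n.+1%:R^-1 :> R by rewrite invr_ge0.
  have := cder_MVT n0 (dF a) (fun t _ => bF' (a + ofR t * v)).
  rewrite ofR0 mul0r addr0 subr0 -/(e n) => h.
  rewrite /D cmodM cmod_ofR ger0_norm//.
  by rewrite mulrC -ler_pdivlMr// ltr0n.
have iD n : cintegrable leb1 (fun z => D n (toC z)).
  exact: (cintegrableZ (ofR n.+1%:R) (cintegrableB (tr n).1 iF)).
have eD n : cintegral leb1 (fun z => D n (toC z)) = 0.
  rewrite (cintegralZ (ofR n.+1%:R) (cintegrableB (tr n).1 iF)) (cintegralB (tr n).1 iF).
  by rewrite (tr n).2 subrr mulr0.
have M2 : 0 <= 2 * M by rewrite mulr_ge0.
have cv z : (fun n => cmod (D n (toC z) - F' (toC z))) @ \oo --> (0 : R).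
  have := dF (toC z) 0; rewrite ofR0 mul0r addr0 => /cder_quotient.
  by rewrite ofR0 mul0r addr0.
have [i h] := @cdominated_cvg R _ _ leb1 (fun n z => D n (toC z)) (fun z => F' (toC z)) _
  (fun n => cintegrable_cmeasurable (iD n)) cv
  (fun n z => supported_gauss1_le z (sD n) M2 (bD n))
  (rintegrableZ (2 * M * expR (2 * r + 2 * sqnorm v) * pi) (integral_gauss_plane ltr01).1).
split=> //; apply: esym; apply: (cvg_cmod_unique (f := fun=> 0) _ _).
  by under eq_fun do rewrite subrr cmod0; exact: cvg_cst.
by move: h; apply: cvg_trans; apply: near_eq_cvg; apply: nearW => n; rewrite eD.
Qed.

Lemma cder_cexp_line w v t : cder (fun s => cexp (w + ofR s * v)) t (v * cexp (w + ofR t * v)).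
Proof.
have -> : (fun s => cexp (w + ofR s * v)) = (fun s => cexp w * cexp (ofR s * v)).
  by apply/funext => s; rewrite cexpD.
have := cderM (cder_cst (cexp w) t) (cder_cexp v t); rewrite mul0r add0r cexpD.
by rewrite mulrCA.
Qed.

Lemma cder_gauss_line a v t : sqnorm v = 1 ->
  cder (fun s => ofR (expR (- sqnorm (a + ofR s * v) / 2))) t
    (ofR (- complex.Re ((a + ofR t * v) * v^*)) * ofR (expR (- sqnorm (a + ofR t * v) / 2))).
Proof.
move=> v1; pose p : R := complex.Re (a * v^*).
have E s : - sqnorm (a + ofR s * v) / 2 = - sqnorm a / 2 - p * s - s * s / 2.
  have -> : s * s / 2 = s * s / 2 * sqnorm v by rewrite v1 mulr1.
  by rewrite /p /sqnorm !ReImE; field.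
have -> : (fun s => ofR (expR (- sqnorm (a + ofR s * v) / 2))) =
    (fun s => ofR (expR (- sqnorm a / 2 - p * s - s * s / 2)) : C).
  by apply/funext => s; rewrite E.
rewrite E.
have -> : complex.Re ((a + ofR t * v) * v^*) = p + t.
  have -> : p + t = p + t * sqnorm v by rewrite v1 mulr1.
  by rewrite /p /sqnorm !ReImE; ring.
rewrite -ofRM; split; last by rewrite ImofR; exact: is_derive_cst.
rewrite ReofR; set c := - sqnorm a / 2.
have D : is_derive t 1 (fun s : R => c - p * s - s * s / 2) (- (p + t)).
  by apply: is_derive_eq; rewrite /GRing.scale /=; field.
rewrite (_ : (fun s => _) = expR \o (fun s : R => c - p * s - s * s / 2))//.
by apply: is_derive_eq; rewrite /GRing.scale /= mulrC.
Qed.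

Lemma cder_bell_line a v t (w0 w1 : C) : sqnorm v = 1 ->
  cder (fun s => bell (a + ofR s * v) w0 w1) t
    ((ofR (- complex.Re ((a + ofR t * v) * v^*)) + v * w0 - v^* * w1) *
      bell (a + ofR t * v) w0 w1).
Proof.
move=> v1.
have h0 := cder_cexp_line (a * w0) (v * w0) t.
have h1 := cder_cexp_line (- a^* * w1) (- v^* * w1) t.
have E0 s : a * w0 + ofR s * (v * w0) = (a + ofR s * v) * w0 by ring.
have E1 s : - a^* * w1 + ofR s * (- v^* * w1) = - (a + ofR s * v)^* * w1.
  by rewrite rmorphD rmorphM /= conj_ofR; ring.
rewrite E0 in h0; rewrite E1 in h1.
have {}h0 : cder (fun s => cexp ((a + ofR s * v) * w0)) t
    (v * w0 * cexp ((a + ofR t * v) * w0)).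
  by move: h0; congr cder; apply/funext => s; rewrite E0.
have {}h1 : cder (fun s => cexp (- (a + ofR s * v)^* * w1)) t
    (- v^* * w1 * cexp (- (a + ofR t * v)^* * w1)).
  by move: h1; congr cder; apply/funext => s; rewrite E1.
have h := cderM (cderM (cderM (cderM (cder_cst (ofR (Num.sqrt pi)^-1) t)
  (cder_gauss_line a t v1)) (cder_cst (cexp (w0 * w1)) t)) h1) h0.
move: h; congr cder; rewrite /bell.
by ring.
Qed.

(** Iterated derivatives in the single direction [v], the form in which integration by parts
    consumes them. Continuity at each order provides boundedness and measurability. *)
Fixpoint vsmooth v n h : Prop := ccontinuous h /\
  if n is m.+1 then exists h', (forall a t, cder (fun s => h (a + ofR s * v)) t (h' (a + ofR t * v))) /\
    vsmooth v m h' else True.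

Lemma vsmooth_continuous v n h : vsmooth v n h -> ccontinuous h.
Proof. by case: n => [|n] []. Qed.

Lemma vsmoothW v n h : vsmooth v n.+1 h -> vsmooth v n h.
Proof.
elim: n h => [|n IH] h [ch [h' [dh sh']]]; first by split.
by split=> //; exists h'; split=> //; exact: IH.
Qed.

Lemma vsmooth_lin v n h k (c : C) : vsmooth v n h -> vsmooth v n k ->
  vsmooth v n (fun a => h a + c * k a).
Proof.
have cc h1 k1 : ccontinuous h1 -> ccontinuous k1 -> ccontinuous (fun a => h1 a + c * k1 a).
  move=> [c1 c2] [d1 d2]; split.
    rewrite (_ : (fun z => _) = (fun z : R * R => complex.Re (h1 (toC z)) +
      (complex.Re c * complex.Re (k1 (toC z)) - complex.Im c * complex.Im (k1 (toC z))))).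
      move=> z; apply: cvgD; first exact: c1.
      by apply: cvgB; apply: cvgM; [exact: cvg_cst|exact: d1|exact: cvg_cst|exact: d2].
    by apply/funext => z; rewrite !ReImE.
  rewrite (_ : (fun z => _) = (fun z : R * R => complex.Im (h1 (toC z)) +
    (complex.Re c * complex.Im (k1 (toC z)) + complex.Im c * complex.Re (k1 (toC z))))).
    move=> z; apply: cvgD; first exact: c2.
    by apply: cvgD; apply: cvgM; [exact: cvg_cst|exact: d2|exact: cvg_cst|exact: d1].
  by apply/funext => z; rewrite !ReImE.
elim: n h k => [|n IH] h k; first by move=> [ch _] [ck _]; split=> //; exact: cc.
move=> [ch [h' [dh sh]]] [ck [k' [dk sk]]]; split; first exact: cc.
exists (fun a => h' a + c * k' a); split; last exact: IH.
move=> a t; have := cderD (dh a t) (cderM (cder_cst c t) (dk a t)).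
by rewrite mul0r add0r.
Qed.

(** The coordinate of [a] along the unit vector [v]; it appears when the factor exp (- |a|^2 / 2) of
    B_a is differentiated in the direction [v]. *)
Definition vcoord v a : C := ofR (complex.Re (a * v^*)).

Lemma vsmooth_vcoord v n h : sqnorm v = 1 -> vsmooth v n h ->
  vsmooth v n (fun a => vcoord v a * h a).
Proof.
move=> v1.
have cl : continuous (fun z : R * R => complex.Re (toC z * v^*)).
  rewrite (_ : (fun z => _) = (fun z : R * R => z.1 * complex.Re v + z.2 * complex.Im v)).
    by move=> z; apply: cvgD; apply: cvgM; [exact: cvg_fst|exact: cvg_cst|exact: cvg_snd|exact: cvg_cst].
  by apply/funext => z; rewrite /toC !ReImE; ring.
have cc h1 : ccontinuous h1 -> ccontinuous (fun a => vcoord v a * h1 a).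
  move=> [c1 c2]; split.
    rewrite (_ : (fun z => _) = (fun z : R * R => complex.Re (toC z * v^*) * complex.Re (h1 (toC z)))).
      by move=> z; apply: cvgM; [exact: cl|exact: c1].
    by apply/funext => z; rewrite /vcoord; move: (complex.Re (_ * v^*)) => x; rewrite !ReImE mul0r subr0.
  rewrite (_ : (fun z => _) = (fun z : R * R => complex.Re (toC z * v^*) * complex.Im (h1 (toC z)))).
    by move=> z; apply: cvgM; [exact: cl|exact: c2].
  by apply/funext => z; rewrite /vcoord; move: (complex.Re (_ * v^*)) => x; rewrite !ReImE mul0r addr0.
elim: n h => [|n IH] h; first by move=> [ch _]; split=> //; exact: cc.
move=> sm; have [ch [h' [dh sh]]] := sm; split; first exact: cc.
exists (fun a => h a + 1 * (vcoord v a * h' a)); split; last first.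
  by apply: vsmooth_lin; [exact: vsmoothW|exact: IH].
move=> a t; have := cderM (cder_line 1 (vcoord v a) t) (dh a t).
have E s : vcoord v a + ofR s * 1 = vcoord v (a + ofR s * v).
  have -> : ofR s * 1 = ofR (s * sqnorm v) by rewrite v1 !mulr1.
  by rewrite /vcoord -ofRD; congr ofR; rewrite /sqnorm !ReImE; ring.
rewrite E !mul1r (_ : (fun s => (_ + _) * _) = (fun s => vcoord v (a + ofR s * v) * h (a + ofR s * v))) //.
by apply/funext => s; rewrite E.
Qed.

(** The condition r < |a|^2 is open, so [h] vanishes along the line near [a], and its derivative
    vanishes at [a]. *)
Lemma cder_supported v r h (h' : C -> C) : supported r h ->
  (forall a t, cder (fun s => h (a + ofR s * v)) t (h' (a + ofR t * v))) -> supported r h'.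
Proof.
move=> sh dh a ra; have := dh a 0; rewrite ofR0 mul0r addr0 => -[[_ d1] [_ d2]].
have [c1 c2] := cder_cvg (cder_line v a 0).
have cs : (fun s => sqnorm (a + ofR s * v)) @ (0 : R) --> sqnorm (a + ofR 0 * v).
  rewrite /sqnorm; under eq_fun do rewrite !expr2.
  by rewrite !expr2; apply: cvgD; apply: cvgM; [exact: c1|exact: c1|exact: c2|exact: c2].
have n0 : \forall s \near (0 : R), h (a + ofR s * v) = 0.
  have := cvgr_gt _ cs; rewrite ofR0 mul0r addr0 => /(_ _ _ ra).
  by apply: filterS => s; exact: sh.
apply: complex_ext.
  rewrite -d1 (@near_eq_derive _ _ _ _ (cst 0)) ?derive_cst//.
  by apply: filterS n0 => s ->.
rewrite -d2 (@near_eq_derive _ _ _ _ (cst 0)) ?derive_cst//.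
by apply: filterS n0 => s ->.
Qed.

End TestFunctions.

(** * Integration by parts and decay of smeared Bell vectors *)

Section Smearing.
Context (R : realType).
Local Notation C := R[i].
Local Notation leb1 := (@leb1 R).
Implicit Types (h F : C -> C) (a v w : C) (r : R).

Definition smeared h : C -> C -> C := smear (fun z => h (toC z)).

Lemma supported_bounded h r : ccontinuous h -> supported r h ->
  (exists2 M : R, 0 <= M & forall a, cmod (h a) <= M) /\ cintegrable leb1 (fun z => h (toC z)).
Proof.
move=> ch sh; have [M M0 hM] := ccontinuous_bounded ch sh; split; first by exists M.
exact: supported_integrable sh M0 hM (ccontinuous_cmeasurable ch).
Qed.

(* Integration by parts: [v w0 - v^* w1] acts on [bell a w0 w1] as the derivative in the
   direction [v] plus [vcoord v a]. *)
Lemma smeared_mul h (h' : C -> C) v r (w0 w1 : C) : sqnorm v = 1 -> supported r h ->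
  ccontinuous h -> ccontinuous h' -> ccontinuous (fun a => vcoord v a * h a) ->
  (forall a t, cder (fun s => h (a + ofR s * v)) t (h' (a + ofR t * v))) ->
  (v * w0 - v^* * w1) * smeared h w0 w1 = smeared (fun a => vcoord v a * h a - h' a) w0 w1.
Proof.
move=> v1 sh ch ch' cl dh.
have sh' := cder_supported sh dh.
have sl : supported r (fun a => vcoord v a * h a) by move=> a ra; rewrite sh ?mulr0.
have [[M M0 hM] ih] := supported_bounded ch sh.
have [[M' M'0 hM'] ih'] := supported_bounded ch' sh'.
have [[L L0 hL] il] := supported_bounded cl sl.
set c := v * w0 - v^* * w1.
pose B := (Num.sqrt pi)^-1 / damp2 w0 w1.
have B0 : 0 <= B by rewrite divr_ge0 ?invr_ge0 ?sqrtr_ge0 ?damp2_ge0.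
have hB a : cmod (bell a w0 w1) <= B := bell_le a w0 w1.
pose F a := h a * bell a w0 w1.
pose F' a := h' a * bell a w0 w1 + h a * ((ofR (- complex.Re (a * v^*)) + v * w0 - v^* * w1) * bell a w0 w1).
have FE a : F' a = c * (h a * bell a w0 w1) - (vcoord v a * h a - h' a) * bell a w0 w1.
  by rewrite /F' /c /vcoord ofRN; ring.
have bF' a : cmod (F' a) <= (cmod c * M + (L + M')) * B.
  rewrite FE mulrA -mulrBl cmodM; apply: ler_pM; rewrite ?cmod_ge0//.
  apply: le_trans (cmodB _ _) _; apply: lerD; first by rewrite cmodM ler_wpM2l ?cmod_ge0.
  by apply: le_trans (cmodB _ _) _; exact: lerD.
have K0 : 0 <= (cmod c * M + (L + M')) * B by rewrite mulr_ge0// !addr_ge0// mulr_ge0 ?cmod_ge0.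
have bF a : cmod (F a) <= M * B + (cmod c * M + (L + M')) * B.
  apply: le_trans (_ : M * B <= _); last by rewrite lerDl.
  by rewrite /F cmodM; apply: ler_pM; rewrite ?cmod_ge0.
have bF2 a : cmod (F' a) <= M * B + (cmod c * M + (L + M')) * B.
  by apply: le_trans (bF' a) _; rewrite lerDr mulr_ge0.
have sF : supported r F by move=> a ra; rewrite /F sh ?mul0r.
have ii := smear_integrable w0 w1 ih.
have KK0 : 0 <= M * B + (cmod c * M + (L + M')) * B by rewrite addr_ge0// mulr_ge0.
have dF a t : cder (fun s => F (a + ofR s * v)) t (F' (a + ofR t * v)).
  exact: (cderM (dh a t) (cder_bell_line a t w0 w1 v1)).
have [_] := cintegral_derivative sF KK0 bF bF2 (cintegrable_cmeasurable ii) dF.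
have i2 := smear_integrable w0 w1 (cintegrableB il ih').
have -> : (fun z => F' (toC z)) = (fun z : R * R => c * (h (toC z) * bell (toC z) w0 w1) -
    (vcoord v (toC z) * h (toC z) - h' (toC z)) * bell (toC z) w0 w1).
  by apply/funext => z; exact: FE.
rewrite (cintegralB (cintegrableZ c ii) i2) (cintegralZ c ii) => /eqP.
by rewrite subr_eq0 => /eqP.
Qed.

Lemma smeared_damped_le h : cintegrable leb1 (fun z => h (toC z)) ->
  exists2 K : R, 0 <= K & forall w0 w1, cmod (smeared h w0 w1) * damp2 w0 w1 <= K.
Proof.
move=> ih; pose I := (\int[leb1]_z cmod (h (toC z)))%R.
have I0 : 0 <= I by apply: Rintegral_ge0 => z _; exact: cmod_ge0.
have s0 : 0 <= (Num.sqrt pi)^-1 :> R by rewrite invr_ge0 sqrtr_ge0.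
exists (2 * ((Num.sqrt pi)^-1 * I)) => [|w0 w1]; first by rewrite !mulr_ge0.
have d0 : 0 < damp2 w0 w1 by rewrite mulr_gt0 ?expR_gt0.
rewrite -ler_pdivlMr//.
have ic := rintegrableZ ((Num.sqrt pi)^-1 / damp2 w0 w1) (cintegrable_cmod ih).
have b (z : R * R) : cmod (h (toC z) * bell (toC z) w0 w1) <=
    (Num.sqrt pi)^-1 / damp2 w0 w1 * cmod (h (toC z)).
  by rewrite cmodM mulrC ler_wpM2r ?cmod_ge0 ?bell_le.
apply: le_trans (cmod_cintegral_le (smear_integrable w0 w1 ih) b ic) _.
have -> : (\int[leb1]_z ((Num.sqrt pi)^-1 / damp2 w0 w1 * cmod (h (toC z))) =
  (Num.sqrt pi)^-1 / damp2 w0 w1 * I)%R by apply: RintegralZl => //; exact: cintegrable_cmod.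
by rewrite le_eqVlt; apply/orP; left; apply/eqP; ring.
Qed.

(** Each factor v w0 - v^* w1 is absorbed into the amplitude by [smeared_mul]. The new amplitude has
    the same support and one order of smoothness less, so [n] steps end at the plain bound. *)
Lemma smeared_decay v n h r : sqnorm v = 1 -> supported r h -> vsmooth v n h ->
  exists2 K : R, 0 <= K & forall w0 w1,
    cmod (v * w0 - v^* * w1) ^+ n * (cmod (smeared h w0 w1) * damp2 w0 w1) <= K.
Proof.
move=> v1; elim: n h => [|n IH] h sh sm.
  have [_ ih] := supported_bounded (vsmooth_continuous sm) sh.
  have [K K0 hK] := smeared_damped_le ih.
  by exists K => // w0 w1; rewrite expr0 mul1r.
have [ch [h' [dh sh']]] := sm.
have sl := vsmooth_vcoord v1 (vsmoothW sm).
have s' := cder_supported sh dh.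
have [||K K0 hK] := IH (fun a => vcoord v a * h a + (-1) * h' a).
- by move=> a ra; rewrite sh// s'// !mulr0 addr0.
- exact: vsmooth_lin.
have E : (fun a => vcoord v a * h a - h' a) = (fun a => vcoord v a * h a + (-1) * h' a).
  by apply/funext => a; rewrite mulN1r.
exists K => // w0 w1; apply: le_trans (hK w0 w1).
rewrite exprSr -(mulrA (_ ^+ n)) (mulrA (cmod (v * w0 - _)) (cmod (smeared h w0 w1))) -cmodM.
rewrite (smeared_mul w0 w1 v1 sh ch (vsmooth_continuous sh') (vsmooth_continuous sl) dh).
by rewrite E; exact: lexx.
Qed.

Definition rapid (f : C -> C -> C) := forall J, exists2 K : R, 0 <= K &
  forall w0 w1, ((1 + sqnorm w0) * (1 + sqnorm w1)) ^+ J * (cmod (f w0 w1) * damp2 w0 w1) <= K.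

(** The directions 1 and i give |w0 - w1| and |w0 + w1|, which together control |w0|^2 + |w1|^2 by
    the parallelogram law. The power J of (1 + |w0|^2) (1 + |w1|^2) needs 2 J powers of squared
    moduli, hence the order [2 * (2 * J)]. *)
Lemma smeared_rapid h r : supported r h -> (forall n, vsmooth 1 n h) ->
  (forall n, vsmooth (Complex 0 1) n h) -> rapid (smeared h).
Proof.
move=> sh s1 si J.
have n1 : sqnorm (1 : C) = 1 by rewrite /sqnorm /= expr1n expr0n addr0.
have ni : sqnorm (Complex 0 1 : C) = 1 by rewrite /sqnorm /= expr1n expr0n add0r.
have [K0 K00 H0] := smeared_decay n1 sh (s1 0%N).
have [K1 K10 H1] := smeared_decay n1 sh (s1 (2 * (2 * J))%N).
have [K2 K20 H2] := smeared_decay ni sh (si (2 * (2 * J))%N).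
exists (2 ^+ (2 * J) * (K0 + K1 + K2)) => [|w0 w1].
  by rewrite mulr_ge0 ?exprn_ge0// !addr_ge0.
set D := cmod _ * damp2 _ _.
have D0 : 0 <= D by rewrite mulr_ge0 ?cmod_ge0 ?damp2_ge0.
have := H2 w0 w1; have := H1 w0 w1; have := H0 w0 w1.
rewrite expr0 mul1r !(exprM _ 2 (2 * J)) !cmod2 -/D.
set P := sqnorm (1 * w0 - _); set Q := sqnorm (Complex 0 1 * w0 - _) => h0 h1 h2.
have PQ : sqnorm w0 + sqnorm w1 = (P + Q) / 2.
  by rewrite /P /Q /sqnorm !ReImE /=; field.
have P0 : 0 <= P := sqnorm_ge0 _; have Q0 : 0 <= Q := sqnorm_ge0 _.
have x0 := sqnorm_ge0 w0; have y0 := sqnorm_ge0 w1.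
(* As |w0|^2 + |w1|^2 = (P + Q) / 2 <= m, one gets 1 + |w0|^2 + |w1|^2 <= 2 m, and a power of a
   maximum is at most the sum of the powers. *)
pose m := Num.max 1 (Num.max P Q).
have m1 : 1 <= m by rewrite le_max lexx.
have m0 : 0 <= m := le_trans ler01 m1.
have mP : P <= m by rewrite !le_max lexx orbT.
have mQ : Q <= m by rewrite !le_max lexx !orbT.
have hm : m ^+ (2 * J) <= 1 + P ^+ (2 * J) + Q ^+ (2 * J).
  have p1 : 0 <= P ^+ (2 * J) by rewrite exprn_ge0.
  have q1 : 0 <= Q ^+ (2 * J) by rewrite exprn_ge0.
  rewrite /m /Num.max; case: ifP => _; last by rewrite expr1n; lra.
  by case: ifP => _; lra.
clearbody m P Q D.
have hb : ((1 + sqnorm w0) * (1 + sqnorm w1)) ^+ J <= 2 ^+ (2 * J) * m ^+ (2 * J).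
  have b1 : (1 + sqnorm w0) * (1 + sqnorm w1) <= (1 + (sqnorm w0 + sqnorm w1)) ^+ 2.
    have xy := mulr_ge0 x0 y0; have xx := mulr_ge0 x0 x0; have yy := mulr_ge0 y0 y0.
    move: xy xx yy x0 y0; move: (sqnorm w0) (sqnorm w1) => x y *.
    by rewrite expr2; lra.
  have b2 : (1 + (sqnorm w0 + sqnorm w1)) ^+ 2 <= (2 * m) ^+ 2.
    have b3 : 0 <= 1 + (sqnorm w0 + sqnorm w1) by lra.
    have b4 : 0 <= 2 * m by rewrite mulr_ge0.
    by rewrite lerXn2r//; lra.
  have b5 : 0 <= (1 + sqnorm w0) * (1 + sqnorm w1) by apply: mulr_ge0; lra.
  have b6 := le_trans b1 b2; have b7 := le_trans b5 b6.
  by rewrite -exprMn exprM lerXn2r.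
apply: le_trans (ler_wpM2r D0 hb) _; rewrite -mulrA ler_wpM2l ?exprn_ge0//.
apply: le_trans (ler_wpM2r D0 hm) _; rewrite !mulrDl mul1r; lra.
Qed.

End Smearing.

(** * Rapidly decreasing entire functions belong to Phi *)

Section Rapid.
Context (R : realType).
Local Notation C := R[i].
Local Notation leb1 := (@leb1 R).
Local Notation leb2 := (@leb2 R).
Implicit Types (f : C -> C -> C) (h : C -> C) (r : R).

Lemma bell_shift (a w0 w1 h0 h1 : C) : bell a (w0 + h0) (w1 + h1) =
  bell a w0 w1 * cexp (h0 * (w1 + a) + h1 * (w0 - a^*) + h0 * h1).
Proof.
rewrite /bell -!mulrA; congr (_ * (_ * _)); rewrite -!cexpD; congr cexp.
by ring.
Qed.

(** Differentiation under the integral. By [bell_shift] a shift of the arguments multiplies B_a by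
    an exponential, whose second-order Taylor remainder is uniform for [a] in a disc containing the
    support. [l0] and [l1] are the amplitudes of the two partial derivatives. *)
Lemma smeared_entire h r : supported r h -> cintegrable leb1 (fun z => h (toC z)) ->
  entire2 (smeared h).
Proof.
move=> sh ih [w0 w1].
(* A bound for |a| on the support, as |a|^2 <= r <= (1 + |r|)^2. *)
pose rho : R := 1 + `|r|.
have rho0 : 0 <= rho by rewrite addr_ge0.
have ra (a : C) : h a != 0 -> cmod a <= rho.
  move=> ha; have [/sh /eqP|ar] := ltP r (sqnorm a); first by rewrite (negbTE ha).
  rewrite -(@ler_pXn2r _ 2) ?nnegrE ?cmod_ge0// cmod2; apply: le_trans ar _.
  apply: le_trans (ler_norm r) _; rewrite /rho expr2.
  have := normr_ge0 r; move: (`|r|) => x x0; have := mulr_ge0 x0 x0; lra.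
pose l0 (z : R * R) := h (toC z) * (w1 + toC z).
pose l1 (z : R * R) := h (toC z) * (w0 - (toC z)^*).
have mh := cintegrable_cmeasurable ih.
have lin (w : C) (e : R * R -> C) : cmeasurable e -> (forall z, cmod (e z) = cmod (toC z)) ->
    cintegrable leb1 (fun z => h (toC z) * (w + e z)).
  move=> me he; apply: (le_cintegrable _ _ (rintegrableZ (cmod w + rho) (cintegrable_cmod ih))).
    apply: cmeasurableM => //; apply: cmeasurableD => //; exact: cmeasurable_cst.
  move=> z; rewrite cmodM mulrC; have [->|h0] := eqVneq (h (toC z)) 0.
    by rewrite cmod0 !mulr0.
  rewrite ler_wpM2r ?cmod_ge0//; apply: le_trans (cmodD _ _) _.
  by rewrite lerD2l he ra.
have i0 : cintegrable leb1 l0 by apply: lin => //; exact: cmeasurable_toC.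
have i1 : cintegrable leb1 l1.
  apply: (lin w0 (fun z => - (toC z)^*)) => [|z]; last by rewrite cmodN cmod_conj.
  exact: cmeasurableN (@cmeasurable_toC_conj R).
pose B := (Num.sqrt pi)^-1 / damp2 w0 w1.
have B0 : 0 <= B by rewrite divr_ge0 ?invr_ge0 ?sqrtr_ge0 ?damp2_ge0.
pose K1 := cmod w0 + cmod w1 + 1 + rho.
have K10 : 0 <= K1 by rewrite !addr_ge0 ?cmod_ge0.
(* With s = |h0| + |h1| <= 2 the exponent [d] of the shift is at most s K1, which gives the first
   term; the [+ 1] pays for the part h0 h1 of [d] outside the linear increment. *)
pose K2 := K1 ^+ 2 * expR (2 * K1) + 1.
have K20 : 0 <= K2 by rewrite addr_ge0 ?mulr_ge0 ?expR_ge0 ?sqr_ge0.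
pose I := (\int[leb1]_z cmod (h (toC z)))%R.
have I0 : 0 <= I by apply: Rintegral_ge0 => z _; exact: cmod_ge0.
have bnd (a h0 h1 : C) : cmod a <= rho -> cmod h0 <= 1 -> cmod h1 <= 1 ->
    cmod (bell a (w0 + h0) (w1 + h1) - bell a w0 w1 -
      (h0 * (w1 + a) + h1 * (w0 - a^*)) * bell a w0 w1) <= B * (K2 * (cmod h0 + cmod h1) ^+ 2).
  move=> ar h01 h11; rewrite bell_shift; set d := h0 * (w1 + a) + h1 * (w0 - a^*) + h0 * h1.
  rewrite (_ : _ - _ - _ = bell a w0 w1 * (cexp d - 1 - d + h0 * h1)); last first.
    by move: (cexp d) => X; rewrite /d; ring.
  rewrite cmodM; apply: ler_pM; rewrite ?cmod_ge0 ?bell_le//.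
  set s := cmod h0 + cmod h1.
  have c0 := cmod_ge0 h0; have c1 := cmod_ge0 h1; have s0 : 0 <= s by rewrite addr_ge0.
  have s2 : s <= 2 by rewrite /s; lra.
  have hd : cmod d <= s * K1.
    apply: le_trans (cmodD _ _) _; apply: le_trans (lerD (cmodD _ _) (lexx _)) _.
    rewrite !cmodM.
    have q0 : cmod h0 * cmod (w1 + a) <= cmod h0 * (cmod w1 + rho).
      by apply: ler_wpM2l => //; apply: le_trans (cmodD _ _) _; rewrite lerD2l.
    have q1 : cmod h1 * cmod (w0 - a^*) <= cmod h1 * (cmod w0 + rho).
      by apply: ler_wpM2l => //; apply: le_trans (cmodB _ _) _; rewrite cmod_conj lerD2l.
    have q2 : cmod h0 * cmod h1 <= cmod h0 * 1 by apply: ler_wpM2l.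
    have q3 := mulr_ge0 c0 (cmod_ge0 w0); have q4 := mulr_ge0 c1 (cmod_ge0 w1).
    by rewrite /s /K1; move: q0 q1 q2 q3 q4; lra.
  apply: le_trans (cmodD _ _) _; rewrite /K2 mulrDl mul1r; apply: lerD; last first.
    by rewrite cmodM /s expr2; have := mulr_ge0 c0 c1; have := mulr_ge0 c0 c0; have := mulr_ge0 c1 c1; lra.
  apply: le_trans (cexp_taylor2 d) _; rewrite [leRHS]mulrAC -exprMn.
  apply: ler_pM; rewrite ?sqr_ge0 ?expR_ge0//.
    by rewrite [K1 * s]mulrC lerXn2r ?nnegrE ?cmod_ge0 ?mulr_ge0.
  by rewrite ler_expR; apply: le_trans hd _; rewrite ler_wpM2r.
have KK : 0 <= 2 * (B * K2 * I).
  by apply: mulr_ge0 => //; apply: mulr_ge0 => //; exact: mulr_ge0.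
apply: (@quadratic_differentiable R (smeared h) w0 w1 (smear l0 w0 w1) (smear l1 w0 w1) _ KK).
move=> h0 h1 h01 h11.
have j := smear_integrable _ _ ih; have j0 := smear_integrable w0 w1 i0.
have j1 := smear_integrable w0 w1 i1.
rewrite /smeared /smear [_ * h0]mulrC [_ * h1]mulrC.
rewrite -(cintegralZ h0 j0) -(cintegralZ h1 j1).
rewrite -(cintegralD (cintegrableZ h0 j0) (cintegrableZ h1 j1)) -(cintegralB (j _ _) (j _ _)).
have jA := cintegrableB (j (w0 + h0) (w1 + h1)) (j w0 w1).
have jB := cintegrableD (cintegrableZ h0 j0) (cintegrableZ h1 j1).
rewrite -(cintegralB jA jB).
have ic := rintegrableZ (B * K2 * (cmod h0 + cmod h1) ^+ 2) (cintegrable_cmod ih).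
apply: le_trans (cmod_cintegral_le (cintegrableB jA jB) _ ic) _.
  move=> z; rewrite /l0 /l1.
  have [->|hz] := eqVneq (h (toC z)) 0.
    by rewrite !mul0r !mulr0 subrr addr0 subrr cmod0 mulr0.
  have := bnd _ h0 h1 (ra _ hz) h01 h11.
  move: (bell (toC z) (w0 + h0) (w1 + h1)) (bell (toC z) w0 w1) => X Y hb.
  rewrite (_ : _ - _ - _ = h (toC z) * (X - Y - (h0 * (w1 + toC z) + h1 * (w0 - (toC z)^*)) * Y));
    last by ring.
  by rewrite cmodM mulrC ler_wpM2r ?cmod_ge0// -mulrA.
have -> : (\int[leb1]_z (B * K2 * (cmod h0 + cmod h1) ^+ 2 * cmod (h (toC z))) =
  B * K2 * (cmod h0 + cmod h1) ^+ 2 * I)%R by apply: RintegralZl => //; exact: cintegrable_cmod.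
by rewrite le_eqVlt; apply/orP; left; apply/eqP; ring.
Qed.

Lemma nneseries_le (u : nat -> R) (c : R) : (forall n, 0 <= u n) ->
  (forall N, \sum_(n < N) u n <= c) -> (\sum_(0 <= n <oo) (u n)%:E <= c%:E)%E.
Proof.
move=> u0 uc; apply: lime_le; first by apply: is_cvg_nneseries => n _ _; rewrite lee_fin.
by apply: nearW => N; rewrite sumEFin lee_fin big_mkord.
Qed.

(** Two more powers than [J] are requested from [rapid] and spent, in each variable, on the
    integrable [weight]. *)
Lemma damped_rapid f J : rapid f -> exists2 K : R, 0 <= K & forall u,
  ((1 + sqnorm (u0 u)) * (1 + sqnorm (u1 u))) ^+ J * damped f u <= K * weight2 u.
Proof.
move=> /(_ (J + 2)%N) [K K0 hK]; exists K => // u.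
have := hK (u0 u)^* (u1 u)^*; rewrite damp2_conj !sqnorm_conj -/(wave f u) -/(damped f u).
have := damped_ge0 f u; set D := damped f u; rewrite /weight2.
have x0 := sqnorm_ge0 (u0 u); have y0 := sqnorm_ge0 (u1 u).
move=> D0 h; rewrite mulrA; set E := (X in X <= _).
have E0 : 0 <= E.
  by apply: mulr_ge0 => //; apply: exprn_ge0; apply: mulr_ge0; apply: addr_ge0.
have h' : E * (1 + sqnorm (u0 u)) ^+ 2 * (1 + sqnorm (u1 u)) ^+ 2 <= K.
  by apply: le_trans h; rewrite /E exprD !exprMn le_eqVlt; apply/orP; left; apply/eqP; ring.
clearbody E; apply: weight_le => //; apply: weight_le; first by rewrite mulr_ge0 ?sqr_ge0.
by rewrite mulrAC.
Qed.

(** Its square is [poisson_tail_le] at the exponent [2 * j]; the constant [1 + c] replaces the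
    square root of [c], since c <= (1 + c)^2. *)
Lemma damped_ket_decay j : exists2 c : R, 0 <= c & forall m (w : C),
  m.+1%:R ^+ j * damped_ket m w <= c * (1 + sqnorm w) ^+ j.
Proof.
have [c c0 hc] := @poisson_tail_le R (2 * j)%N; exists (1 + c) => [|m w]; first exact: addr_ge0.
have x0 := sqnorm_ge0 w.
have x1 : 0 <= 1 + sqnorm w by rewrite addr_ge0.
have p0 : 0 <= (1 + sqnorm w) ^+ j by rewrite exprn_ge0.
have d0 := damped_ket_ge0 m w; have c1 : 0 <= 1 + c by rewrite addr_ge0.
rewrite -(@ler_pXn2r _ 2) ?nnegrE//; [|exact: mulr_ge0|exact: mulr_ge0].
rewrite (exprMn _ (m.+1%:R ^+ j)) damped_ket2 -exprM mulnC; apply: le_trans (hc m _ x0) _.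
rewrite exprMn -exprM [(j * 2)%N]mulnC; apply: ler_wpM2r; first by rewrite exprn_ge0.
by rewrite expr2; have := mulr_ge0 c0 c0; lra.
Qed.

(** Powers of [m] and [n] are paid with powers of 1 + |u_0|^2 and 1 + |u_1|^2 by [damped_ket_decay],
    and those with the rapid decay of [f]. *)
Lemma braket_ket_decay f j : cmeasurable (wave f) -> rapid f -> exists2 S : R, 0 <= S &
  forall m n, (m.+1%:R * n.+1%:R) ^+ j * cmod (braket (tensor (ket m) (ket n)) f) <= S.
Proof.
move=> mf rf; have [c c0 hc] := damped_ket_decay j; have [K K0 hK] := damped_rapid j rf.
have iw := @integrable_weight2 R.
pose I := (\int[leb2]_u weight2 u)%R.
have I0 : 0 <= I by apply: Rintegral_ge0 => u _; rewrite mulr_ge0// ltW//; exact: weight_gt0.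
pose p : R := pi^-1 * pi^-1.
have p0 : 0 <= p by rewrite mulr_ge0// invr_ge0 pi_ge0.
exists (2 * (p * (c * c * K) * I)) => [|m n].
  by apply: mulr_ge0 => //; apply: mulr_ge0 => //; apply: mulr_ge0 => //; rewrite !mulr_ge0.
set q := m.+1%:R * n.+1%:R.
have q0 : 0 < q :> R by rewrite mulr_gt0.
have qj : 0 < q ^+ j by rewrite exprn_gt0.
rewrite mulrC -ler_pdivlMr//.
pose G := mu_integrand (braket_integrand (tensor (ket m) (ket n)) f).
have bG u : cmod (G u) <= p * (c * c * K) / q ^+ j * weight2 u.
  rewrite /G braket_integrandE cmodM cmodM cmod_conj cmod_ofR (ger0_norm (gauss_ge0 _ _)) gauss_damp2.
  rewrite [leLHS](_ : _ = p * (damped_ket m (u0 u) * damped_ket n (u1 u) * damped f u)); last first.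
    rewrite /damped_ket /damped /wave /tensor cmodM -!ket_conj !cmod_conj /damp2 /damping /p.
    by ring.
  rewrite [leRHS](_ : _ = p * (c * c * K * weight2 u / q ^+ j)); last first.
    by move: (q ^+ j)^-1 (weight2 u) => x y; ring.
  apply: ler_wpM2l => //; rewrite ler_pdivlMr//.
  have hm := hc m (u0 u); have hn := hc n (u1 u); have hf := hK u.
  have a0 := damped_ket_ge0 m (u0 u); have b0 := damped_ket_ge0 n (u1 u).
  rewrite [leLHS](_ : _ = (m.+1%:R ^+ j * damped_ket m (u0 u)) * (n.+1%:R ^+ j * damped_ket n (u1 u)) *
    damped f u); last by rewrite /q exprMn; ring.
  have D0 := damped_ge0 f u.
  have e0 (w : C) : 0 <= c * (1 + sqnorm w) ^+ j.
    by apply: mulr_ge0 => //; apply: exprn_ge0; apply: addr_ge0 => //; exact: sqnorm_ge0.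
  apply: le_trans (_ : (c * (1 + sqnorm (u0 u)) ^+ j) * (c * (1 + sqnorm (u1 u)) ^+ j) * damped f u <= _).
    by apply: ler_wpM2r => //; apply: ler_pM => //; apply: mulr_ge0 => //; rewrite exprn_ge0.
  rewrite [leLHS](_ : _ = c * c * (((1 + sqnorm (u0 u)) * (1 + sqnorm (u1 u))) ^+ j * damped f u)).
    by rewrite -(mulrA (c * c) K); apply: ler_wpM2l => //; exact: mulr_ge0.
  by rewrite exprMn; ring.
have iG := rintegrableZ (p * (c * c * K) / q ^+ j) iw.
have cG : cintegrable leb2 G.
  apply: (le_cintegrable _ _ iG); last exact: bG.
  rewrite /G braket_integrandE.
  apply: cmeasurableM; last exact: cmeasurable_ofR (@measurable_gauss R).
  apply: cmeasurableM => //; apply: cmeasurable_conj; apply: cmeasurableM; apply: cmeasurable_ket.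
    by apply: cmeasurable_conj; exact: cmeasurable_u0.
  by apply: cmeasurable_conj; exact: cmeasurable_u1.
apply: le_trans (cmod_cintegral_le cG bG iG) _.
have -> : (\int[leb2]_u (p * (c * c * K) / q ^+ j * weight2 u) = p * (c * c * K) / q ^+ j * I)%R.
  by apply: RintegralZl.
by rewrite le_eqVlt; apply/orP; left; apply/eqP; ring.
Qed.

Lemma rapid_Phi f : entire2 f -> rapid f -> Phi f.
Proof.
move=> ef rf.
have mf : cmeasurable (wave f) by exact: cmeasurable_conj_separately (entire2_separately ef).
have iw := @integrable_weight2 R.
have w0 u : 0 <= weight2 u :> R by rewrite mulr_ge0// ltW//; exact: weight_gt0.
split.
  split=> //; have [K K0 hK] := damped_rapid 0 rf; have [L L0 hL] := rf 0%N.
  have p0 : 0 <= pi^-1 * pi^-1 :> R by rewrite mulr_ge0// invr_ge0 pi_ge0.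
  apply: (le_cintegrable _ _ (rintegrableZ (pi^-1 * pi^-1 * (L * K)) iw)).
    apply: cmeasurableM; last exact: cmeasurable_ofR (@measurable_gauss R).
    by apply: cmeasurable_ofR; exact: measurable_sqnorm.
  move=> u; rewrite /mu_integrand -ofRM cmod_ofR ger0_norm; last first.
    by apply: mulr_ge0; [exact: sqnorm_ge0|exact: gauss_ge0].
  rewrite -[toC u.1]/(u0 u) -[toC u.2]/(u1 u) gauss_damp2.
  rewrite [leLHS](_ : _ = pi^-1 * pi^-1 * (damped f u * damped f u)); last first.
    by rewrite -cmod2 /damped /wave expr2; ring.
  rewrite -!(mulrA (_ * _)); apply: ler_wpM2l => //; rewrite -mulrA.
  have D0 := damped_ge0 f u.
  apply: ler_pM => //; last by have := hK u; rewrite expr0 mul1r.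
  by have := hL (u0 u)^* (u1 u)^*; rewrite expr0 mul1r damp2_conj.
(* One order beyond the norm: the surplus leaves the summable factor 1 / ((1 + m^2) (1 + n^2)). *)
move=> r; have [S S0 hS] := braket_ket_decay r.+1 mf rf.
have t0 m n : 0 <= ((1 + m%:R ^+ 2) * (1 + n%:R ^+ 2)) ^+ r *
    sqnorm (braket (tensor (ket m) (ket n)) f) :> R.
  by rewrite mulr_ge0 ?sqnorm_ge0// exprn_ge0// mulr_ge0 ?addr_ge0 ?sqr_ge0.
have a0 m : 0 < 1 + m%:R ^+ 2 :> R by rewrite ltr_pwDl ?sqr_ge0.
have tS m n : ((1 + m%:R ^+ 2) * (1 + n%:R ^+ 2)) ^+ r *
    sqnorm (braket (tensor (ket m) (ket n)) f) <=
    S ^+ 2 * ((1 + m%:R ^+ 2)^-1 * (1 + n%:R ^+ 2)^-1).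
  rewrite -invfM ler_pdivlMr; last exact: mulr_gt0.
  have h1 (k : nat) : 1 + k%:R ^+ 2 <= k.+1%:R ^+ 2 :> R.
    by rewrite -natr1 !expr2; have := ler0n R k; lra.
  rewrite mulrAC -exprSr -cmod2.
  apply: le_trans (_ : ((m.+1%:R * n.+1%:R) ^+ 2) ^+ r.+1 *
    cmod (braket (tensor (ket m) (ket n)) f) ^+ 2 <= _).
    apply: ler_wpM2r; first exact: sqr_ge0.
    have q0 : 0 <= (1 + m%:R ^+ 2) * (1 + n%:R ^+ 2) :> R by rewrite ltW// mulr_gt0.
    have q1 : (1 + m%:R ^+ 2) * (1 + n%:R ^+ 2) <= (m.+1%:R * n.+1%:R) ^+ 2 :> R.
      by rewrite exprMn ler_pM// ltW.
    by rewrite lerXn2r// nnegrE// (le_trans q0).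
  rewrite exprAC -exprMn lerXn2r ?nnegrE//.
  by rewrite mulr_ge0 ?cmod_ge0// exprn_ge0// mulr_ge0.
apply: le_lt_trans (ltry (S ^+ 2 * 3 * 3)).
have s3 N : \sum_(m < N) (1 + m%:R ^+ 2)^-1 <= 3 :> R := sum_oneDsqrV_le R N.
have i0 m : 0 <= (1 + m%:R ^+ 2)^-1 :> R by rewrite invr_ge0 ltW.
have SS : 0 <= S ^+ 2 := sqr_ge0 S.
apply: le_trans (_ : (\sum_(0 <= m <oo) (S ^+ 2 * 3 * (1 + m%:R ^+ 2)^-1)%:E <= _)%E); last first.
  apply: nneseries_le => [m|N]; first by rewrite mulr_ge0 ?mulr_ge0.
  by rewrite -mulr_sumr ler_wpM2l ?mulr_ge0.
apply: lee_nneseries => [m _ _|m _]; first by apply: nneseries_ge0 => n _ _; rewrite lee_fin.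
apply: nneseries_le => // N.
apply: le_trans (_ : \sum_(n < N) S ^+ 2 * ((1 + m%:R ^+ 2)^-1 * (1 + n%:R ^+ 2)^-1) <= _).
  exact: ler_sum.
rewrite -mulr_sumr -mulr_sumr -(mulrA (S ^+ 2)); apply: ler_wpM2l => //.
by rewrite mulrC; apply: ler_wpM2r.
Qed.

End Rapid.

(** * Orthonormality *)

Section Delta.
Context (R : realType).
Local Notation C := R[i].
Local Notation leb1 := (@leb1 R).
Implicit Types (h F g : C -> C) (a : C) (r : R).

Lemma is_derive_shift (g : R -> R) (c t : R) : derivable g (c + t) 1 ->
  is_derive t 1 (fun s => g (c + s)) (derive1 g (c + t)).
Proof.
move=> /derivableP dg; rewrite derive1E.
have D : is_derive t 1 (fun s : R => c + s) 1.
  have := @is_deriveD _ _ _ _ _ _ _ _ _ (is_derive_cst c t 1) (is_derive_id t 1).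
  by rewrite add0r; apply.
have := @is_derive1_comp _ _ _ _ _ _ dg D; rewrite mulr1; exact.
Qed.

Let real_part (f : R -> R -> R) a : C := ofR (f (complex.Re a) (complex.Im a)).

Lemma Ck_continuous n (f : R -> R -> R) : Ck n f -> ccontinuous (real_part f).
Proof.
move=> cf; split; last by move=> z; exact: cvg_cst.
by case: n cf => [|n] [].
Qed.

Lemma Ck_vsmooth1 n (f : R -> R -> R) : Ck n f -> vsmooth 1 n (real_part f).
Proof.
elim: n f => [|n IH] f cf; have cc := Ck_continuous cf; first by split.
split=> //; have [_ [d1 _ c1 _]] := cf.
exists (real_part (fun x p => derive1 (fun s => f s p) x)); split; last exact: IH.
move=> a t; split; last by rewrite ImofR; exact: is_derive_cst.
have rE s : complex.Re (a + ofR s * 1) = complex.Re a + s by rewrite !ReImE; ring.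
have iE s : complex.Im (a + ofR s * 1) = complex.Im a by rewrite !ReImE; ring.
rewrite /real_part ReofR rE iE.
have := is_derive_shift (d1 (complex.Re a + t) (complex.Im a)).
congr is_derive; apply/funext => s.
by rewrite ReofR rE iE.
Qed.

Lemma Ck_vsmoothi n (f : R -> R -> R) : Ck n f -> vsmooth (Complex 0 1) n (real_part f).
Proof.
elim: n f => [|n IH] f cf; have cc := Ck_continuous cf; first by split.
split=> //; have [_ [_ d2 _ c2]] := cf.
exists (real_part (fun x p => derive1 (fun s => f x s) p)); split; last exact: IH.
move=> a t; split; last by rewrite ImofR; exact: is_derive_cst.
have rE s : complex.Re (a + ofR s * Complex 0 1) = complex.Re a by rewrite !ReImE; ring.
have iE s : complex.Im (a + ofR s * Complex 0 1) = complex.Im a + s by rewrite !ReImE; ring.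
rewrite /real_part ReofR rE iE.
have := is_derive_shift (d2 (complex.Re a) (complex.Im a + t)).
congr is_derive; apply/funext => s.
by rewrite ReofR rE iE.
Qed.

Lemma test_function_vsmooth g v n : test_function g ->
  (forall f, Ck n f -> vsmooth v n (real_part f)) -> vsmooth v n g.
Proof.
move=> [gr gi _] H; have := vsmooth_lin (Complex 0 1) (H _ (gr n)) (H _ (gi n)).
congr (vsmooth _ _ _); apply/funext => a; rewrite /real_part.
have -> : Complex (complex.Re a) (complex.Im a) = a by case: (a).
by apply: complex_ext; rewrite !ReImE; ring.
Qed.

Lemma test_function_rapid g : test_function g ->
  [/\ exists r, supported r g, ccontinuous g & Phi (smeared g)].
Proof.
move=> tg; have [_ _ [r sg]] := tg.
have s1 n : vsmooth 1 n g by apply: test_function_vsmooth => // f; exact: Ck_vsmooth1.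
have si n : vsmooth (Complex 0 1) n g by apply: test_function_vsmooth => // f; exact: Ck_vsmoothi.
have cg := vsmooth_continuous (s1 0%N).
split=> //; first by exists r.
apply: rapid_Phi; last exact: smeared_rapid sg s1 si.
exact: smeared_entire sg (supported_bounded cg sg).2.
Qed.

Lemma cvg_cmod_mul (x y : nat -> C) (l m : C) :
  (fun n => cmod (x n - l)) @ \oo --> (0 : R) -> (fun n => cmod (y n - m)) @ \oo --> (0 : R) ->
  (fun n => cmod (x n * y n - l * m)) @ \oo --> (0 : R).
Proof.
move=> hx hy.
apply: (@squeeze_cvgr _ _ _ _ (cst 0) (fun n => cmod (x n - l) * cmod (y n - m) +
  (cmod l * cmod (y n - m) + cmod (x n - l) * cmod m))).
- apply: nearW => n; rewrite cmod_ge0 /= -!cmodM.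
  rewrite (_ : x n * y n - l * m = (x n - l) * (y n - m) + (l * (y n - m) + (x n - l) * m)); last by ring.
  by apply: le_trans (cmodD _ _) _; rewrite lerD2l; exact: cmodD.
- exact: cvg_cst.
rewrite [X in _ --> X](_ : _ = 0 * 0 + (cmod l * 0 + 0 * cmod m)); last by ring.
apply: cvgD; first by apply: cvgM; [exact: hx|exact: hy].
by apply: cvgD; apply: cvgM; [exact: cvg_cst|exact: hy|exact: hx|exact: cvg_cst].
Qed.

(** From y exp (- y) <= 1 at y = k |z|^2 / 2. Integrated, it bounds the second moment of the
    Gaussian by 4 / k. *)
Lemma sqnorm_gauss1_le (k : R) (z : R * R) : 0 < k ->
  sqnorm (toC z) * gauss1 k z <= 4 / k * gauss1 (k / 2) z.
Proof.
move=> k0; rewrite /gauss1; set x := sqnorm (toC z).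
have -> : expR (- (k * x)) = expR (- (k / 2 * x)) * expR (- (k / 2 * x)).
  by rewrite -expRD; congr expR; field.
have x0 : 0 <= x := sqnorm_ge0 _.
have y1 : k / 2 * x * expR (- (k / 2 * x)) <= 1.
  have := expR_ge1Dx (k / 2 * x); have := expR_gt0 (k / 2 * x).
  rewrite expRN => e0 e1; rewrite ler_pdivrMr// mul1r; lra.
have e0 := expR_ge0 (- (k / 2 * x)).
move: y1 e0; move: (expR _) => e y1 e0.
have p0 : 0 < pi :> R := pi_gt0 R.
move: p0; move: (pi : R) => p p0.
rewrite [leLHS](_ : _ = 2 / p * e * (k / 2 * x * e)); last by field; rewrite gt_eqF.
rewrite [leRHS](_ : _ = 2 / p * e * 1); last by field; rewrite !gt_eqF.
by apply: ler_wpM2l => //; rewrite mulr_ge0// divr_ge0// ltW.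
Qed.

(** Instead of cutting the plane into near and far parts, |F(w) - F(a)| <= e + D |w - a|^2 holds
    everywhere: near [a] by continuity, and at distance at least [d] because D d^2 = 2 M. The second
    moment of the Gaussian then tends to 0. *)
Lemma approximate_identity F (M : R) a (k : nat -> R) : cmeasurable (fun z => F (toC z)) ->
  0 <= M -> (forall w, cmod (F w) <= M) ->
  (forall e, 0 < e -> exists2 d : R, 0 < d & forall w, cmod (w - a) < d -> cmod (F w - F a) <= e) ->
  (forall n, n.+1%:R / 2 <= k n) ->
  (fun n => cmod (cintegral leb1 (fun x : R * R => F (toC x) *
    ofR (gauss1 (k n) (x.1 + complex.Re (- a), x.2 + complex.Im (- a)))) - F a)) @ \oo --> (0 : R).
Proof.
move=> mF M0 bF cF hk.
have k0 n : 0 < k n by apply: lt_le_trans (hk n); rewrite divr_gt0.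
pose G n (x : R * R) : R := gauss1 (k n) (x.1 + complex.Re (- a), x.2 + complex.Im (- a)).
have G0 n x : 0 <= G n x by apply: gauss1_ge0; exact: ltW.
have igt (c : R) : 0 < c -> leb1.-integrable setT (EFin \o (fun x : R * R =>
    gauss1 c (x.1 + complex.Re (- a), x.2 + complex.Im (- a)))) /\
    (\int[leb1]_x gauss1 c (x.1 + complex.Re (- a), x.2 + complex.Im (- a)) = 1)%R.
  move=> c0; have [i e] := integral_gauss_plane c0.
  have [i' e'] := integrable_translate (- a) i.
  by split; [exact: i'|rewrite e' e].
have iG n : leb1.-integrable setT (EFin \o G n) := (igt _ (k0 n)).1.
have mG n : cmeasurable (fun x : R * R => ofR (G n x)).
  apply: cmeasurable_ofR; apply: (measurableT_comp (measurable_gauss1 (k n))).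
  exact: (translate_preserving _ _).1.
have cG n : cintegrable leb1 (fun x => ofR (G n x)).
  apply: (le_cintegrable _ _ (iG n)); first exact: mG.
  by move=> x; rewrite cmod_ofR (ger0_norm (G0 n x)).
have eG n : cintegral leb1 (fun x => ofR (G n x)) = 1.
  apply: complex_ext; rewrite /cintegral ?ReC ?ImC; last by rewrite /= /Rintegral integral0.
  exact: (igt _ (k0 n)).2.
have iFG n : cintegrable leb1 (fun x => F (toC x) * ofR (G n x)).
  apply: (le_cintegrable _ _ (rintegrableZ M (iG n))).
    exact: (cmeasurableM mF (mG n)).
  by move=> x; rewrite cmodM cmod_ofR (ger0_norm (G0 n x)) ler_wpM2r.
have key e : 0 < e -> exists2 D : R, 0 <= D & forall n,
    cmod (cintegral leb1 (fun x => F (toC x) * ofR (G n x)) - F a) <= 2 * (e + D / n.+1%:R).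
  move=> e0; have [d d0 hd] := cF e e0; pose D := 2 * M / d ^+ 2.
  have D0 : 0 <= D by rewrite divr_ge0 ?sqr_ge0// mulr_ge0.
  (* The second moment is at most 4 / k n, hence at most 8 / (n + 1) by [hk]. *)
  exists (8 * D) => [|n]; first by rewrite mulr_ge0.
  have hF w : cmod (F w - F a) <= e + D * sqnorm (w - a).
    have [wd|dw] := ltP (cmod (w - a)) d.
      by apply: le_trans (hd w wd) _; rewrite lerDl mulr_ge0 ?sqnorm_ge0.
    apply: le_trans (cmodB _ _) _; apply: le_trans (lerD (bF _) (bF _)) _.
    apply: le_trans (_ : D * d ^+ 2 <= _).
      by rewrite /D divfK ?gt_eqF ?exprn_gt0// mulr_natl mulr2n.
    apply: le_trans (_ : D * sqnorm (w - a) <= _); last by rewrite lerDr ltW.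
    by rewrite ler_wpM2l// -cmod2 lerXn2r ?nnegrE ?cmod_ge0// ltW.
  have k20 : 0 < k n / 2 by rewrite divr_gt0.
  have [i2 e2] := igt _ k20.
  have ib := rintegrableD (rintegrableZ e (iG n)) (rintegrableZ (D * (4 / k n)) i2).
  have E : cintegral leb1 (fun x => F (toC x) * ofR (G n x)) - F a =
      cintegral leb1 (fun x => F (toC x) * ofR (G n x) - F a * ofR (G n x)).
    by rewrite (cintegralB (iFG n) (cintegrableZ (F a) (cG n))) (cintegralZ (F a) (cG n)) eG mulr1.
  rewrite E.
  apply: le_trans (cmod_cintegral_le (cintegrableB (iFG n) (cintegrableZ (F a) (cG n))) _ ib) _.
    move=> x; rewrite -mulrBl cmodM cmod_ofR (ger0_norm (G0 n x)).
    apply: le_trans (ler_wpM2r (G0 n x) (hF _)) _; rewrite mulrDl lerD2l.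
    apply: le_trans (_ : D * (sqnorm (toC x - a) * G n x) <= _).
      by rewrite (mulrA D).
    apply: le_trans (_ : D * (4 / k n *
        gauss1 (k n / 2) (x.1 + complex.Re (- a), x.2 + complex.Im (- a))) <= _).
      2: by rewrite (mulrA D).
    apply: ler_wpM2l => //.
    have := sqnorm_gauss1_le (x.1 + complex.Re (- a), x.2 + complex.Im (- a)) (k0 n).
    by rewrite toC_translate.
  rewrite ler_wpM2l//.
  have -> : (\int[leb1]_x (e * G n x + D * (4 / k n) *
      gauss1 (k n / 2) (x.1 + complex.Re (- a), x.2 + complex.Im (- a))) =
      e * 1 + D * (4 / k n) * 1)%R.
    have iA := rintegrableZ e (iG n); have iB := rintegrableZ (D * (4 / k n)) i2.
    transitivity (\int[leb1]_x (e * G n x) + \int[leb1]_x (D * (4 / k n) *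
      gauss1 (k n / 2) (x.1 + complex.Re (- a), x.2 + complex.Im (- a))))%R.
      by apply: RintegralD.
    congr (_ + _).
      transitivity (e * \int[leb1]_x G n x)%R; first by apply: RintegralZl => //; exact: iG.
      by congr (_ * _); exact: (igt _ (k0 n)).2.
    transitivity (D * (4 / k n) * \int[leb1]_x
      gauss1 (k n / 2) (x.1 + complex.Re (- a), x.2 + complex.Im (- a)))%R; first by apply: RintegralZl.
    by rewrite e2.
  rewrite !mulr1 lerD2l [leRHS](_ : _ = D * (4 / (n.+1%:R / 2))); last first.
    by field; rewrite addrC natr1 pnatr_eq0.
  by rewrite ler_wpM2l// ler_wpM2l// lef_pV2 ?posrE// divr_gt0.
apply/cvgrPdist_le => /= e e0.
have e4 : 0 < e / 4 by rewrite divr_gt0.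
have [D D0 hD] := key _ e4.
have hn : (fun n => D * n.+1%:R^-1) @ \oo --> (D * 0 : R).
  by apply: cvgM; [exact: cvg_cst|exact: cvg_harmonic].
rewrite mulr0 in hn; move/cvgrPdist_le : hn => /(_ _ e4); apply: filterS => n.
rewrite !sub0r !normrN (ger0_norm (cmod_ge0 _)) => h.
apply: le_trans (hD n) _; have h2 := le_trans (ler_norm _) h.
by move: h2; move: (D / n.+1%:R) => x h2; clear -h2; lra.
Qed.

End Delta.

(** * The delta-function limit of the overlaps *)

Section Orthonormality.
Context (R : realType).
Local Notation C := R[i].
Local Notation leb1 := (@leb1 R).
Implicit Types (f : C -> C -> C) (g : C -> C) (a : C) (r : R).

(** With 1 - t_n = 1 / (n + 1), the Gaussian parameter (1 + t) / (2 (1 - t)) of the regularized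
    overlap is at least (n + 1) / 2, as [approximate_identity] asks. *)
Let t (n : nat) : R := 1 - n.+1%:R^-1.

Let t01 n : (0 <= t n) && (t n < 1).
Proof.
have n0 : 0 < n.+1%:R^-1 :> R by rewrite invr_gt0.
have n1 : n.+1%:R^-1 <= 1 :> R by rewrite invf_le1// ler1n.
rewrite /t; move: (n.+1%:R^-1) n0 n1 => x x0 x1.
by apply/andP; split; lra.
Qed.

Let E (n : nat) (z : C) : C := cexp (ofR (t n) * z).

Let E_entire n : centire (E n).
Proof.
by apply: (centire_comp (@centire_cexp R)); exact: centireMl (@centire_id R).
Qed.

Let E_le_t n z : cmod (E n z) <= 1 * expR (t n * cmod z).
Proof.
have /andP[t0 _] := t01 n.
by rewrite mul1r; apply: le_trans (cmod_cexpM_le _ _) _; rewrite cmod_ofR ger0_norm.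
Qed.

Let E_le n z : cmod (E n z) <= expR (cmod z).
Proof.
have /andP[_ t1] := t01 n; apply: le_trans (E_le_t n z) _.
by rewrite mul1r ler_expR -[leRHS]mul1r ler_wpM2r ?cmod_ge0// ltW.
Qed.

Let E_cvg z : (fun n => cmod (E n z - cexp z)) @ \oo --> (0 : R).
Proof.
apply/cvgrPdist_lt => e e0; have [d d0 hd] := centire_cvg z (@centire_cexp R) e0.
have hn : (fun n => cmod z * n.+1%:R^-1) @ \oo --> (cmod z * 0 : R).
  by apply: cvgM; [exact: cvg_cst|exact: cvg_harmonic].
rewrite mulr0 in hn; move/cvgrPdist_lt : hn => /(_ _ d0); apply: filterS => n.
rewrite !sub0r !normrN => h; rewrite (ger0_norm (cmod_ge0 _)).
have -> : E n z = cexp (z + - (ofR n.+1%:R^-1 * z)).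
  by rewrite /E /t ofRD ofRN mulrBl mul1r.
apply: hd; apply: le_lt_trans h; rewrite cmodN cmodM cmod_ofR mulrC normrM.
by rewrite (ger0_norm (cmod_ge0 z)).
Qed.

Lemma cvg_tn : (fun n => cmod (ofR (2 * pi / (1 + t n)) - ofR pi : C)) @ \oo --> (0 : R).
Proof.
have ht : (fun n => t n) @ \oo --> (1 - 0 : R).
  by apply: cvgB; [exact: cvg_cst|exact: cvg_harmonic].
have h : (fun n => 2 * pi / (1 + t n)) @ \oo --> (2 * pi / (1 + (1 - 0)) : R).
  apply: cvgM; first exact: cvg_cst.
  apply: cvgV; first by rewrite subr0 gt_eqF.
  by apply: cvgD; [exact: cvg_cst|exact: ht].
have e : 2 * pi / (1 + (1 - 0)) = pi :> R.
  by rewrite subr0 (_ : 1 + 1 = 2)// mulrAC divff ?mul1r// pnatr_eq0.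
rewrite e in h.
have z1 : (fun n => `|2 * pi / (1 + t n) - pi|) @ \oo --> (0 : R).
  by apply/norm_cvg0P/subr_cvg0.
move: z1; apply: cvg_trans; apply: near_eq_cvg; apply: nearW => n.
by rewrite -ofRN -ofRD cmod_ofR.
Qed.

Lemma sqrt_pi_pi : ofR (Num.sqrt pi)^-1 * (ofR (Num.sqrt pi)^-1 * ofR pi) = 1 :> C.
Proof.
have p0 : Num.sqrt pi != 0 :> R by rewrite gt_eqF// sqrtr_gt0 pi_gt0.
have pE : pi = Num.sqrt pi * Num.sqrt pi :> R by rewrite -expr2 sqr_sqrtr ?pi_ge0.
rewrite -!ofRM -ofR1; congr ofR.
by rewrite [X in _ * (_ * X)]pE mulKf// mulVf.
Qed.

(** The regularized overlaps have two limits that must agree: the overlap with the full series, by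
    dominated convergence, and the value at [a] of [F], up to constants, by the approximate
    identity. [F] is [g] times the phase of [braket_regularized], which is 1 at [a]. *)
Lemma smeared_overlap g r a : supported r g -> ccontinuous g -> tempered (smeared g) ->
  (braket (smeared g) (bell_series (@cexp R) a))^* = ofR (Num.sqrt pi)^-1 * ofR pi * g a.
Proof.
move=> sg cg ts; have [[M M0 bg] ig] := supported_bounded cg sg.
have conjE (F : C -> C) : centire F -> (forall z, cmod (F z) <= expR (cmod z)) ->
    (braket (smeared g) (bell_series F a))^* = braket (bell_series F a) (smeared g).
  move=> eF bF; have [i _] := braket_bound ts (cmeasurable_wave_bell_series a eF)
    (fun u => damped_bell_series_le1 a u bF).
  by have [_ ->] := braket_conj i.
have lim1 : (fun n => cmod (braket (bell_series (E n) a) (smeared g) -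
    (braket (smeared g) (bell_series (@cexp R) a))^*)) @ \oo --> (0 : R).
  have := braket_series_cvg a ts E_entire E_le E_cvg.
  apply: cvg_trans; apply: near_eq_cvg; apply: nearW => n.
  by rewrite -(conjE _ (E_entire n) (E_le n)) -[LHS]cmod_conj rmorphB.
apply: cvg_cmod_unique lim1 _.
pose k n : R := (1 + t n) / (2 * (1 - t n)).
pose F (w : C) : C := g w * cexp (Complex 0 (complex.Im (a^* * w))).
have bF w : cmod (F w) <= M.
  by rewrite /F cmodM cmod_cexp ReC expR0 mulr1.
have s_eq n : braket (bell_series (E n) a) (smeared g) = ofR (Num.sqrt pi)^-1 *
    (ofR (2 * pi / (1 + t n)) * cintegral leb1 (fun x : R * R => F (toC x) *
      ofR (gauss1 (k n) (x.1 + complex.Re (- a), x.2 + complex.Im (- a))))).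
  have tB := tempered_bell_series a (E_entire n) (t01 n) ler01 (E_le_t n).
  have [[iS <-] _] := smear_braket ig tB.
  have B (x : R * R) : braket (bell_series (E n) a) (bell (toC x)) = ofR (Num.sqrt pi)^-1 *
      (ofR (2 * pi / (1 + t n)) * cexp (Complex 0 (complex.Im (a^* * toC x))) *
        ofR (gauss1 (k n) (x.1 + complex.Re (- a), x.2 + complex.Im (- a)))).
    rewrite (braket_bell_series (toC x) tB).2; congr (_ * _).
    exact: braket_regularized.
  (* Since [c] is not 0, the integrability of [F] times the Gaussian can be read off from that of
     the smeared overlaps. *)
  pose c : C := ofR (Num.sqrt pi)^-1 * ofR (2 * pi / (1 + t n)).
  have c0 : c != 0.
    have /andP[t0 _] := t01 n.
    rewrite /c -ofRM; apply/eqP => -[] /eqP; rewrite gt_eqF//.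
    rewrite mulr_gt0 ?invr_gt0 ?sqrtr_gt0 ?pi_gt0// divr_gt0 ?mulr_gt0 ?pi_gt0//.
    by rewrite ltr_pwDl.
  have EB : (fun x : R * R => g (toC x) * braket (bell_series (E n) a) (bell (toC x))) =
      (fun x => c * (F (toC x) *
      ofR (gauss1 (k n) (x.1 + complex.Re (- a), x.2 + complex.Im (- a))))).
    by apply/funext => x; rewrite B /F /c; ring.
  rewrite EB in iS *; rewrite mulrA -/c; apply: cintegralZ.
  have := cintegrableZ c^-1 iS.
  by under eq_fun do rewrite (mulKf c0).
have mF : cmeasurable (fun z => F (toC z)).
  apply: cmeasurableM; first exact: cintegrable_cmeasurable ig.
  apply: cmeasurable_cexp; split; first exact: measurable_cst.
  by have [_] := cmeasurableM (cmeasurable_cst (R * R)%type a^*) (@cmeasurable_toC R).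
have cF e : 0 < e -> exists2 d : R, 0 < d &
    forall w, cmod (w - a) < d -> cmod (F w - F a) <= e.
  move=> e0; have [c1 c2] := cg.
  have cF1 : continuous (fun z : R * R => complex.Im (a^* * toC z)).
    rewrite (_ : (fun z => _) = (fun z : R * R => complex.Re a * z.2 - complex.Im a * z.1)).
      move=> z; apply: cvgB; apply: cvgM; [exact: cvg_cst|exact: cvg_snd|exact: cvg_cst|exact: cvg_fst].
    by apply/funext => z; rewrite /toC !ReImE; ring.
  have cc : continuous (fun z : R * R => cos (complex.Im (a^* * toC z))).
    by move=> z; apply: (continuous_comp (cF1 z)); exact: continuous_cos.
  have cs : continuous (fun z : R * R => sin (complex.Im (a^* * toC z))).
    by move=> z; apply: (continuous_comp (cF1 z)); exact: continuous_sin.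
  have cR : continuous (fun z : R * R => complex.Re (F (toC z))).
    rewrite (_ : (fun z => _) = (fun z : R * R => complex.Re (g (toC z)) * cos (complex.Im (a^* * toC z)) -
        complex.Im (g (toC z)) * sin (complex.Im (a^* * toC z)))).
      by move=> z; apply: cvgB; apply: cvgM; [exact: c1|exact: cc|exact: c2|exact: cs].
    by apply/funext => z; rewrite /F /cexp ReM !ReC !ImC expR0 !mul1r.
  have cI : continuous (fun z : R * R => complex.Im (F (toC z))).
    rewrite (_ : (fun z => _) = (fun z : R * R => complex.Re (g (toC z)) * sin (complex.Im (a^* * toC z)) +
        complex.Im (g (toC z)) * cos (complex.Im (a^* * toC z)))).
      by move=> z; apply: cvgD; apply: cvgM; [exact: c1|exact: cs|exact: c2|exact: cc].
    by apply/funext => z; rewrite /F /cexp ImM !ReC !ImC expR0 !mul1r.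
  pose z0 : R * R := (complex.Re a, complex.Im a).
  have Ew (w : C) : toC (complex.Re w, complex.Im w) = w by case: w.
  have e2 : 0 < e / 2 by rewrite divr_gt0.
  have /cvgrPdist_lt /(_ _ e2) /nbhs_ballP [d1 d10 hd1] := cR z0.
  have /cvgrPdist_lt /(_ _ e2) /nbhs_ballP [d2 d20 hd2] := cI z0.
  exists (Num.min d1 d2) => [|w]; first by rewrite lt_min d10.
  rewrite lt_min => /andP[w1 w2].
  have inb (d : R) : cmod (w - a) < d -> ball z0 d (complex.Re w, complex.Im w).
    move=> wd; split; rewrite /ball /= distrC; apply: le_lt_trans wd.
      by apply: le_trans (Re_le_cmod _); rewrite !ReImE.
    by apply: le_trans (Im_le_cmod _); rewrite !ReImE.
  have h1 := hd1 _ (inb _ w1); have h2 := hd2 _ (inb _ w2).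
  rewrite /= !Ew in h1 h2.
  move: h1 h2; move: (F a) (F w) => X Y h1 h2.
  apply: le_trans (cmod_le_ReIm _) _; rewrite !ReImE.
  rewrite distrC [X in _ + X <= _]distrC [leRHS](splitr e).
  by apply: lerD; exact: ltW.
have hk n : n.+1%:R / 2 <= k n.
  have /andP[t0 _] := t01 n.
  have n0 : 0 < n.+1%:R :> R by rewrite ltr0n.
  have -> : k n = (1 + t n) * (n.+1%:R / 2).
    rewrite /k (_ : 1 - t n = n.+1%:R^-1); last by rewrite /t opprB addrCA subrr addr0.
    by rewrite invfM invrK mulrA [_ / 2 * _]mulrAC mulrA.
  by rewrite ler_peMl ?divr_ge0 ?lerDl// ltW.
have Fa : F a = g a.
  rewrite /F (_ : complex.Im _ = 0) ?cexp0 ?mulr1//.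
  by rewrite !ReImE; ring.
have lim2 := approximate_identity mF M0 bF cF hk.
rewrite Fa in lim2.
have h := cvg_cmod_mul cvg_tn lim2.
have {}h := cvg_cmodM (ofR (Num.sqrt pi)^-1) h.
move: h; apply: cvg_trans; apply: near_eq_cvg; apply: nearW => n.
rewrite s_eq; congr cmod; move: (ofR (Num.sqrt pi)^-1) (cintegral _ _) (ofR (_ / _)) (ofR pi) => A B D P.
by ring.
Qed.

Lemma smeared_bell g r a : supported r g -> ccontinuous g -> tempered (smeared g) ->
  (braket (smeared g) (bell a))^* = g a.
Proof.
move=> sg cg ts; rewrite (braket_bell_series a ts).2 rmorphM /= conj_ofR (smeared_overlap a sg cg ts).
by rewrite !mulrA -(mulrA (ofR (Num.sqrt pi)^-1)) sqrt_pi_pi mul1r.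
Qed.

Lemma bell_sum_smeared g r a : supported r g -> ccontinuous g -> tempered (smeared g) ->
  (fun K => cmod (braket (bell_sum K a) (smeared g) - ofR (Num.sqrt pi)^-1 * ofR pi * g a))
    @ \oo --> (0 : R).
Proof.
move=> sg cg ts; rewrite -(smeared_overlap a sg cg ts).
have := braket_series_cvg a ts (@centire_exp_sum R) (@cmod_exp_sum_le R) (@cvg_exp_sum R).
apply: cvg_trans; apply: near_eq_cvg; apply: nearW => K.
have [i _] := braket_bound ts (cmeasurable_wave_bell_series a (@centire_exp_sum R K))
  (fun u => damped_bell_series_le1 a u (@cmod_exp_sum_le R K)).
by rewrite bell_sumE (braket_conj i).2 -[LHS]cmod_conj rmorphB.
Qed.

Lemma bell_sum_integral g a M N : cintegrable leb1 (fun x => g (toC x)) ->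
  is_cintegral leb1
    (fun x => g (toC x) * (ofR pi^-1 * braket (bell_sum M a) (bell_sum N (toC x))))
    (ofR (pi^-1 * Num.sqrt pi) * braket (bell_sum (minn M N) a) (smeared g)).
Proof.
move=> ig; have tK := tempered_bell_sum (minn M N) a.
have [[i e] _] := smear_braket ig tK.
have p0 : ofR (Num.sqrt pi) != 0 :> C.
  by apply/eqP => -[] /eqP; rewrite gt_eqF// sqrtr_gt0 pi_gt0.
rewrite (_ : (fun x => _) = (fun x => ofR (pi^-1 * Num.sqrt pi) *
    (g (toC x) * braket (bell_sum (minn M N) a) (bell (toC x))))); last first.
  apply/funext => x; rewrite bell_sum_overlap (braket_bell_series (toC x) tK).2 ofRM.
  rewrite (ofRV (Num.sqrt pi)); move: p0; move: (braket _ _) (ofR pi^-1) (ofR (Num.sqrt pi)) => X Y q q0.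
  by field.
by split; [exact: (cintegrableZ _ i)|rewrite (cintegralZ _ i) e].
Qed.

Lemma cvg_minn : (fun MN : nat * nat => minn MN.1 MN.2) @ filter_prod \oo \oo --> \oo.
Proof.
move=> P [n _ hP]; exists ([set k | (n <= k)%N], [set k | (n <= k)%N]).
  by split; exists n.
by move=> [k l] [/= nk nl]; apply: hP; rewrite /= leq_min nk.
Qed.

(** The integral depends on [M] and [N] only through [minn M N], so the limit along the product
    filter is that of the single sequence [u]. *)
Lemma bell_sum_integral_cvg g r a : supported r g -> ccontinuous g -> tempered (smeared g) ->
  (fun MN : nat * nat => cintegral leb1 (fun x => g (toC x) * (ofR pi^-1 *
    braket (bell_sum MN.1 a) (bell_sum MN.2 (toC x)))) : C^o) @ filter_prod \oo \oo --> (g a : C^o).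
Proof.
move=> sg cg ts; have ig := (supported_bounded cg sg).2.
pose u K : C^o := ofR (pi^-1 * Num.sqrt pi) * braket (bell_sum K a) (smeared g).
have hu : u @ \oo --> (g a : C^o).
  apply: cvg_cmod; have := cvg_cmodM (ofR (pi^-1 * Num.sqrt pi)) (bell_sum_smeared a sg cg ts).
  apply: cvg_trans; apply: near_eq_cvg; apply: nearW => K.
  rewrite /u mulrC; congr (cmod (_ - _)).
  have p0 : pi != 0 :> R by rewrite gt_eqF// pi_gt0.
  have q0 : Num.sqrt pi != 0 :> R by rewrite gt_eqF// sqrtr_gt0 pi_gt0.
  rewrite mulrAC -!ofRM.
  have -> : (Num.sqrt pi)^-1 * pi * (pi^-1 * Num.sqrt pi) = 1 :> R by rewrite mulrA mulfK// mulVf.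
  by rewrite ofR1 mul1r.
rewrite (_ : (fun MN => _) = u \o (fun MN : nat * nat => minn MN.1 MN.2)).
  have h := @cvg_comp _ _ _ (fun MN : nat * nat => minn MN.1 MN.2) u _ _ _ cvg_minn hu.
  exact: h.
by apply/funext => -[M N]; exact: (bell_sum_integral a M N ig).2.
Qed.

End Orthonormality.

Theorem mainTheorem1 (R : realType) :
  (* B_alpha = pi^{-1/2} \sum_n (D(alpha)|n>) \otimes |n> *)
  (forall alpha : R[i],
     [/\ forall w0 w1 : R[i],
           (fun N => ofR (Num.sqrt pi)^-1 * bell_sum N alpha w0 w1 : R[i]^o)
             @ \oo --> (bell alpha w0 w1 : R[i]^o),
         generalized_vector (bell alpha) &
         forall f, Phi f ->
           (fun N => braket f (fun w0 w1 =>
                       ofR (Num.sqrt pi)^-1 * bell_sum N alpha w0 w1) : R[i]^o)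
             @ \oo --> (braket f (bell alpha) : R[i]^o)]) /\
  (* completeness *)
  ((forall f g, Phi f -> Phi g ->
      is_cintegral (@leb1 R)
        (fun a => braket f (bell (toC a)) * (braket g (bell (toC a)))^*)
        (braket f g)) /\
   (forall u0 u1 v0 v1 alpha : R[i],
      bell alpha u0^* u1^* * (bell alpha v0^* v1^*)^*
      = ofR pi^-1 * (cexp (- (alpha^* * alpha))
          * cexp (u0^* * u1^*) * cexp (- alpha^* * u1^*) * cexp (alpha * u0^*)
          * cexp (v0 * v1) * cexp (- alpha * v1) * cexp (alpha^* * v0))) /\
   (forall u0 u1 v0 v1 : R[i],
      is_cintegral (@leb1 R)
        (fun a => let alpha := toC a in
           ofR pi^-1 * (cexp (- (alpha^* * alpha))
             * cexp (u0^* * u1^*) * cexp (- alpha^* * u1^*)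
             * cexp (alpha * u0^*)
             * cexp (v0 * v1) * cexp (- alpha * v1) * cexp (alpha^* * v0)))
        (cexp (u0^* * v0) * cexp (u1^* * v1))) /\
   has_kernel (@id (R[i] -> R[i] -> R[i]))
     (fun w0 w1 v0 v1 => cexp (w0 * v0) * cexp (w1 * v1))) /\
  (* orthonormality, tested against C_c^oo functions of alpha *)
  (forall g : R[i] -> R[i], test_function g ->
     (exists phi : R[i] -> R[i] -> R[i],
        [/\ Phi phi,
            forall f, Phi f ->
              is_cintegral (@leb1 R)
                (fun a => g (toC a) * braket f (bell (toC a)))
                (braket f phi) &
            forall alpha' : R[i], (braket phi (bell alpha'))^* = g alpha']) /\
     (forall alpha' : R[i],
        (forall M N : nat, cintegrable (@leb1 R)
           (fun a => g (toC a) * (ofR pi^-1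
              * braket (bell_sum M alpha') (bell_sum N (toC a))))) /\
        (fun MN : nat * nat => cintegral (@leb1 R)
           (fun a => g (toC a) * (ofR pi^-1
              * braket (bell_sum MN.1 alpha') (bell_sum MN.2 (toC a))))
             : R[i]^o)
          @ filter_prod \oo \oo --> (g alpha' : R[i]^o))).
Proof.
split=> [a|]; first split.
- by move=> w0 w1; exact: bell_sum_cvg.
- exact: bell_generalized_vector.
- by move=> f /Phi_tempered tf; exact: braket_bell_sum_cvg.
split.
  split=> [f g Pf Pg|].
    exact: bell_completeness (Phi_tempered Pf) Pg.1 (Phi_tempered Pg).
  split; first exact: bell_kernelE.
  by split; [exact: bell_kernel_integral|exact: id_has_kernel].
move=> g /test_function_rapid [[r sg] cg Pg]; have tg := Phi_tempered Pg.
have ig := (supported_bounded cg sg).2.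
split=> [|a].
  exists (smeared g); split=> // [f /Phi_tempered tf|a].
    exact: (smear_braket ig tf).1.
  exact: smeared_bell sg cg tg.
split=> [M N|]; first exact: (bell_sum_integral a M N ig).1.
exact: bell_sum_integral_cvg sg cg tg.
Qed.
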